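(* For $1\le p\le t-1$, the map $\tau_p$ is an isomorphism of graded posets $(\mathrm{LRT}(R),\le_R)\to(\mathrm{LRT}(\tau_pR),\le_{\tau_pR})$; i.e. it is a bijection such that for $S,T\in\mathrm{LRT}(R)$, $T<_RS$ implies $\tau_pT<_{\tau_pR}\tau_pS$ (and it is order-preserving in both directions).
   Context: $\sim_K$ is Knuth equivalence; $w|_B$ is the subword of $w$ of letters in $B$; tableaux are in English notation, column-strict meaning rows weakly increase and columns strictly increase; $\mathrm{word}(T)=\dotsb u^2u^1$ with $u^i$ the $i$-th row read left to right; $P(w)$, $Q(w)$ are the Schensted row-insertion and recording tableaux. $R=(R_1,\dots,R_t)$ is a sequence of rectangular partitions, $R_i$ with $\eta_i$ rows and $\mu_i$ columns; $n=\sum\eta_i$; $a=\max_i\mu_i$; $A_i=\{\eta_1+\dots+\eta_{i-1}+1,\dots,\eta_1+\dots+\eta_i\}$; $Y_i$ is the column-strict tableau of shape $R_i$ whose $j$-th row consists of $\mu_i$ copies of $\eta_1+\dots+\eta_{i-1}+j$. $W(R)$ is the set of words $w$ in $[n]$ with $w|_{A_i}\sim_K\mathrm{word}(Y_i)$ for all $i$; $\mathrm{LRT}(\lambda;R)$ ($\mathrm{LRT}(R)$) is the set of column-strict tableaux of shape $\lambda$ (of any partition shape) whose word lies in $W(R)$. Rectangle switching: $\tau_pR=(R_1,\dots,R_{p-1},R_{p+1},R_p,R_{p+2},\dots,R_t)$. For $t=2$, $\tau_1:\mathrm{LRT}(\lambda;(R_1,R_2))\to\mathrm{LRT}(\lambda;(R_2,R_1))$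 is the unique map (both sets are empty or singletons of equal size) and $\tau_1:W((R_1,R_2))\to W((R_2,R_1))$ is defined by $P(\tau_1w)=\tau_1P(w)$, $Q(\tau_1w)=Q(w)$. For general $t$, $\tau_pw$ replaces the subword $w|_{A_p\cup A_{p+1}}$ (same positions) by its image under the two-rectangle map for $(R_p,R_{p+1})$ (letters shifted by $\eta_1+\dots+\eta_{p-1}$); for a tableau $T$, $\tau_pT$ is the tableau of the same shape with $\mathrm{word}(\tau_pT)=\tau_p\mathrm{word}(T)$. Cocyclage: for $1\le r\le n-1$ and a word $u$, regard letters $r$ as right and $r+1$ as left parentheses, match them, leaving an unmatched subword $r^c(r+1)^d$; $s_ru$ replaces it by $r^d(r+1)^c$; this gives an action of $S_n$ on words. $w_0^R$ is the longest element of the Young subgroup of $S_n$ stabilizing each $A_i$; for $w=ux$ with $x$ a letter, $\chi_R(w)=(w_0^Rx)(w_0^Ru)$. For $S,T\in\mathrm{LRT}(R)$, $T<_RS$ if there is $w=ux\in W(R)$ ($x$ a letter) with $S=P(w)$, $T=P(\chi_R(w))$, and the cell by which the shape of $P(w)$ exceeds that of $P(u)$ lies in a column strictly right of column $a$; $\le_R$ is the reflexive transitive closure of $<_R$, a graded partial order. *)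

(* Defs.v *)
From mathcomp Require Import all_boot.
From Stdlib Require Import Relations ClassicalEpsilon.

Set Implicit Arguments.
Unset Strict Implicit.
Unset Printing Implicit Defensive.

(* Words are sequences of positive integers; tableaux are lists of rows (top
   row first, English notation). A rectangle R_i is a pair (eta_i, mu_i)
   = (number of rows, number of columns). *)
Definition word := seq nat.
Definition tableau := seq (seq nat).
Definition rects := seq (nat * nat).

Definition shape (T : tableau) : seq nat := map size T.

Definition is_tableau (T : tableau) : bool :=
  [&& all (fun r => 0 < size r) T,
      sorted geq (shape T),
      all (sorted leq) T &
      all (fun i => all (fun j => nth 0 (nth [::] T i) j < nth 0 (nth [::] T i.+1) j)
                        (iota 0 (size (nth [::] T i.+1))))
          (iota 0 (size T))].

Definition word_of (T : tableau) : word := flatten (rev T).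

Definition tab_of_word (sh : seq nat) (w : word) : tableau :=
  rev (reshape (rev sh) w).

Fixpoint ins (T : tableau) (x : nat) : tableau :=
  match T with
  | [::] => [:: [:: x]]
  | r :: T' =>
      let i := find (fun y => x < y) r in
      if i < size r then set_nth 0 r i x :: ins T' (nth 0 r i)
      else rcons r x :: T'
  end.

Fixpoint rec_step (Q : tableau) (sh : seq nat) (k : nat) : tableau :=
  match sh with
  | [::] => [::]
  | s :: sh' =>
      let q := head [::] Q in
      (if size q < s then rcons q k else q) :: rec_step (behead Q) sh' k
  end.

Definition rsk_step (pq : tableau * tableau * nat) (x : nat) :=
  let '(P, Q, k) := pq in
  let P' := ins P x in (P', rec_step Q (shape P') k.+1, k.+1).

Definition rsk (w : word) := foldl rsk_step ([::], [::], 0) w.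
Definition Ptab (w : word) : tableau := (rsk w).1.1.
Definition Qtab (w : word) : tableau := (rsk w).1.2.

Definition knuth_move (u v : word) : Prop :=
  (exists a b x y z, x <= y < z /\ u = a ++ [:: x; z; y] ++ b
                                 /\ v = a ++ [:: z; x; y] ++ b) \/
  (exists a b x y z, x < y <= z /\ u = a ++ [:: y; x; z] ++ b
                                /\ v = a ++ [:: y; z; x] ++ b).

Definition knuth_equiv : relation word := clos_refl_sym_trans word knuth_move.

Definition etas (R : rects) : seq nat := map fst R.
Definition ntot (R : rects) : nat := sumn (etas R).
Definition amax (R : rects) : nat := \max_(r <- R) r.2.
(* offset eta_1 + ... + eta_{i-1}, with i 0-indexed here: sum of first i *)
Definition offs (R : rects) (i : nat) : nat := sumn (take i (etas R)).
Definition rect (R : rects) (i : nat) : nat * nat := nth (0, 0) R i.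

Definition inA (R : rects) (i : nat) (x : nat) : bool :=
  (offs R i < x) && (x <= offs R i + (rect R i).1).

Definition Ytab (R : rects) (i : nat) : tableau :=
  [seq nseq (rect R i).2 (offs R i + j) | j <- iota 1 (rect R i).1].

Definition inW (R : rects) (w : word) : Prop :=
  all (fun x => (0 < x) && (x <= ntot R)) w /\
  forall i, i < size R -> knuth_equiv (filter (inA R i) w) (word_of (Ytab R i)).

Definition inLRT (R : rects) (T : tableau) : Prop :=
  is_tableau T /\ inW R (word_of T).

(* tau_p R, p 1-indexed: swap R_p and R_{p+1} *)
Definition tauR (p : nat) (R : rects) : rects :=
  take p.-1 R ++ [:: rect R p; rect R p.-1] ++ drop p.+1 R.

(* two-rectangle map on tableaux: the unique element of LRT(lambda;(R2,R1)) *)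
Definition tau2T (R1 R2 : nat * nat) (T : tableau) : tableau :=
  epsilon (inhabits T) (fun T' => shape T' = shape T /\ inLRT [:: R2; R1] T').

Definition tau2W (R1 R2 : nat * nat) (w : word) : word :=
  epsilon (inhabits w)
    (fun w' => Ptab w' = tau2T R1 R2 (Ptab w) /\ Qtab w' = Qtab w).

Fixpoint fill (B : pred nat) (w v : word) : word :=
  match w with
  | [::] => [::]
  | x :: w' => if B x then head 0 v :: fill B w' (behead v)
               else x :: fill B w' v
  end.

Definition tauW (p : nat) (R : rects) (w : word) : word :=
  let off := offs R p.-1 in
  let B := fun x => (off < x) && (x <= off + (rect R p.-1).1 + (rect R p).1) in
  let v := [seq x - off | x <- w & B x] in
  let v' := tau2W (rect R p.-1) (rect R p) v in
  fill B w [seq x + off | x <- v'].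

Definition tauT (p : nat) (R : rects) (T : tableau) : tableau :=
  tab_of_word (shape T) (tauW p R (word_of T)).

(* scan: st = positions of unmatched (r+1)'s, ur = positions of unmatched r's *)
Fixpoint scan (r : nat) (u : word) (i : nat) (st ur : seq nat) : seq nat * seq nat :=
  match u with
  | [::] => (st, ur)
  | y :: u' =>
      if y == r.+1 then scan r u' i.+1 (i :: st) ur
      else if y == r then
        (if st is _ :: st' then scan r u' i.+1 st' ur
         else scan r u' i.+1 st (rcons ur i))
      else scan r u' i.+1 st ur
  end.

(* s_r u : unmatched subword r^c (r+1)^d replaced by r^d (r+1)^c *)
Definition sr (r : nat) (u : word) : word :=
  let '(st, ur) := scan r u 0 [::] [::] in
  let um := ur ++ st in
  [seq (if i \in um then
          (if count (fun j => j < i) um < size st then r else r.+1)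
        else nth 0 u i) | i <- iota 0 (size u)].

(* a reduced word for w_0^R : on each block A_i of size m, the reduced word
   (s_1)(s_2 s_1)...(s_{m-1} ... s_1) shifted by the block offset *)
Definition w0gens (R : rects) : seq nat :=
  flatten [seq flatten [seq [seq offs R i + k | k <- rev (iota 1 j)]
                         | j <- iota 1 (rect R i).1.-1]
          | i <- iota 0 (size R)].

Definition w0act (R : rects) (u : word) : word := foldr sr u (w0gens R).

Definition chi (R : rects) (w : word) : word :=
  match rev w with
  | [::] => [::]
  | x :: ru => w0act R [:: x] ++ w0act R (rev ru)
  end.

Definition ltR (R : rects) (T S : tableau) : Prop :=
  inLRT R S /\ inLRT R T /\
  exists (u : word) (x : nat),
    inW R (rcons u x) /\ S = Ptab (rcons u x) /\ T = Ptab (chi R (rcons u x)) /\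
    (* the new cell (row i) lies in a column strictly right of column a *)
    exists i, nth 0 (shape (Ptab u)) i != nth 0 (shape (Ptab (rcons u x))) i /\
              amax R < nth 0 (shape (Ptab (rcons u x))) i.

Definition leR (R : rects) (T S : tableau) : Prop :=
  clos_refl_trans tableau (ltR R) T S.

(* Main.v *)
Require Import Defs.
From mathcomp Require Import all_boot zify.
From Stdlib Require Import Relations ClassicalEpsilon.

Set Implicit Arguments.
Unset Strict Implicit.
Unset Printing Implicit Defensive.

(* An elementary Knuth transformation at a fixed position changes the recording
   tableau in a way that depends on the recording tableau only. Hence two words
   have the same recording tableau as soon as they are related by a relation
   that respects descents and is stable under these transformations; this
   applies to reverse complementation, to the raising operators in s_r, and to
   the replacement of the subword on an interval of letters by a word with the
   same recording tableau. The last case gives Q(tau_p w) = Q(w) and shows that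
   tau_p is compatible with Knuth equivalence, which reduces the theorem to the
   identity tau_p chi = chi tau_p, and this in turn to two rectangles.

   For two rectangles a Littlewood-Richardson tableau is determined by its
   shape, so it suffices to compare recording tableaux. Write w = ux and
   chi w = yv; then Q(v) = Q(u), and Q(yv) is determined by Q(v) and the shape
   of P(yv). Two different admissible shapes covering nu = shape P(u) have one
   new cell in a column at most a = max(mu_1, mu_2) and the other one to the
   right of column a. If the last cell of P(w) is right of column a, then x lies
   in the second block, y is the largest letter, and, reading yv backwards, its
   new cell lies in a column at most a. As chi is injective, the new shape is
   therefore a function of nu and of shape P(w) that is symmetric in the two
   rectangles. *)

(** The obstacle is that [tau_p] is defined through recording tableaux, whereas [chi] carries a
    letter from the end of a word to its front, where row insertion does not see it as one more
    cell. Reverse complementation, which preserves shapes and equality of recording tableaux, turns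
    a front letter into a last letter; so the position of a single cell remains to be found.
    Rectangularity makes [chi] tractable. The last letter of a word in its block must be the
    smallest letter of the block, and after its removal each generator of w_0^R either fixes the
    word or meets exactly one unmatched letter. If the cycled letter lies outside the two switched
    blocks, [chi] and [tau_p] substitute on disjoint sets of letters and commute formally. For two
    rectangles with e1 and e2 rows, row l and row e1 + e2 - 1 - l (counted from 0) have
    complementary lengths for l < min(e1, e2). This is why the shape determines the tableau and why
    a given shape has at most two admissible covers. *)

(** * Row insertion of Knuth triples *)

(* The elementary Knuth transformation of a triple, in terms of the strict
   comparison g: monotone triples are fixed. With g reversed it describes the
   induced action on the rows of the new cells. *)
Definition kt (g : rel nat) (a b c : nat) : seq nat :=
  if g a b == g b c then [:: a; b; c]
  else if g a b == g a c then [:: b; a; c] else [:: a; c; b].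

(* A weakly increasing row is modelled by its multiplicity function m:
   inserting x bumps y, where y = M means that x is appended at the end. *)
Definition succ_in (M : nat) (m : nat -> nat) (x y : nat) : Prop :=
  [/\ x < y, y = M \/ 0 < m y & forall z, x < z < y -> m z = 0].

(** The multiset after [x] has displaced [y]. Truncated subtraction is intended: the end marker [M]
    has multiplicity 0, so displacing it removes nothing. *)
Definition swapm (m : nat -> nat) (x y : nat) : nat -> nat :=
  fun z => m z + (z == x) - (z == y).

Lemma succ_in_inj M m x y y' : (forall z, M <= z -> m z = 0) -> y <= M -> y' <= M ->
  succ_in M m x y -> succ_in M m x y' -> y = y'.
Proof.
move=> hM hy hy' [h1 h2 h3] [h1' h2' h3'].
case: (ltngtP y y') => // h.
- have := h3' y; case: h2; lia.
- have := h3 y'; case: h2'; lia.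
Qed.

(** Row bumping for two letters, with [M] as the largest output. If [y < x], the copy of [x] just
    inserted can be bumped, so the output is at most [x]; if [x <= y], nothing between [x] and [o1]
    is left to bump. *)
Lemma succ_in2 M m x y o1 o2 : x < M -> y < M -> o1 <= M -> o2 <= M ->
  (forall z, M <= z -> m z = 0) ->
  succ_in M m x o1 -> succ_in M (swapm m x o1) y o2 -> (o2 < o1) = (y < x).
Proof.
move=> hx hy ho1 ho2 hM [h1 h2 h3] [h1' h2' h3']; rewrite /swapm in h2' h3'.
have e1 := h3' x; have e2 := h3 o2; have e3 := h3' o1.
case: h2 => h2; case: h2' => h2'; lia.
Qed.
Lemma swapm_other m x y z : z != x -> z != y -> swapm m x y z = m z.
Proof. by rewrite /swapm => /negPf-> /negPf->; rewrite addn0 subn0. Qed.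

Lemma swapm_in m x y : x < y -> swapm m x y x = (m x).+1.
Proof. by move=> h; rewrite /swapm eqxx (ltn_eqF h) subn0 addn1. Qed.

Lemma swapm_out m x y : x < y -> swapm m x y y = (m y).-1.
Proof. by move=> h; rewrite /swapm eqxx eq_sym (ltn_eqF h) addn0 subn1. Qed.

(** With truncated subtraction the order matters when one update adds a letter that the other
    removes while it is absent; the positivity conditions exclude this. *)
Lemma swapmC m x y x' y' z : x < y -> x' < y' -> y <> y' ->
  (x' = y -> 0 < m y) -> (x = y' -> 0 < m y') ->
  swapm (swapm m x y) x' y' z = swapm (swapm m x' y') x y z.
Proof.
move=> h h' n; rewrite /swapm.
case: (eqVneq z x); case: (eqVneq z y); case: (eqVneq z x');
 case: (eqVneq z y') => ????; subst; lia.
Qed.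

Lemma succ_gap M m x y z : succ_in M m x y -> x < z < y -> m z = 0.
Proof. by case=> _ _; apply. Qed.

Lemma succ_gt M m x y : succ_in M m x y -> x < y.
Proof. by case. Qed.

Lemma succ_pos M m x y : succ_in M m x y -> y < M -> 0 < m y.
Proof. by case=> _ [->|//]; rewrite ltnn. Qed.

Lemma succ_le M m x y z : succ_in M m x y -> 0 < m z -> x < z -> y <= z.
Proof. by move=> h mz xz; rewrite leqNgt; apply/negP => zy; move: mz; rewrite (succ_gap h) ?xz. Qed.

(** * Three successive bumps in one row, in terms of multiplicities *)

Section SuccTriple.
Variables (M : nat) (m : nat -> nat) (a b c o1 o2 o3 : nat).
Hypotheses (ha : a < M) (hb : b < M) (hc : c < M).
Hypotheses  (ho1: o1 <= M) (ho2 : o2 <= M) (ho3 : o3 <= M).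
Hypothesis hM : (forall z, M <= z -> m z = 0).
Hypotheses (h1 :  succ_in M m a o1) (h2 : succ_in M (swapm m a o1) b o2)
  (h3 : succ_in M (swapm (swapm m a o1) b o2) c o3).

Let g1 := succ_gt h1.
Let g2 := succ_gt h2.
Let g3 := succ_gt h3.

(** The letter [o2] occurs already before [a] is inserted, even if [o2 = a]; hence [b] may go
    first. *)
Lemma succ_in_zxy_low : b <= c < a -> o2 <= o3 < o1 ->
   [/\ succ_in M m b o2, succ_in M (swapm m b o2) a o1 & 
      succ_in M (swapm (swapm m b o2) a o1) c o3
      /\ forall z, swapm (swapm (swapm m b o2) a o1) c o3 z
       = swapm (swapm (swapm m a o1) b o2) c o3 z].
Proof.
move=> hs ho.
have q2 : o2 <= a by apply: (succ_le h2); rewrite ?swapm_in //; lia.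
have p2 : 0 < m o2.
  case: (eqVneq o2 a) => [e|ne]; last first.
    by have := succ_pos h2; rewrite swapm_other //; [apply|..]; lia.
  subst o2; case: (posnP (m a)) => // ma.
  have := succ_pos h3; case: (eqVneq o3 a) => [->|n3].
    by rewrite swapm_out // swapm_in // ma => /(_ ha).
  rewrite !swapm_other; try lia.
  by rewrite (succ_gap h1) //; lia.
have eqz z : swapm (swapm m b o2) a o1 z = swapm (swapm m a o1) b o2 z.
  by apply: swapmC => //; lia.
split.
- split=> //; [by right |].
  move=> z hz; rewrite -(succ_gap h2 hz) swapm_other //; lia.
- split=> //; [case: h1 => _ [->|hh] _; [by left|right] |].
    rewrite swapm_other //; lia.
  move=> z hz; rewrite swapm_other ?(succ_gap h1 hz) //; lia.
- split; last by move=> z; rewrite /swapm -/(swapm m a o1 z) -/(swapm m b o2 z) 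
   -/(swapm (swapm m b o2) a o1 z) eqz.
  case: h3 => hh1 hh2 hh3; split=> //.
  + by rewrite eqz.
  + by move=> z hz; rewrite eqz; apply: hh3.
Qed.

(** Here the Knuth move changes its kind. In the given order [b] bumps the fresh copy of [a]. If [b]
    goes first, it bumps [o1], then [a] bumps [o3], and it is [c] that bumps [a]; so the last two
    outputs are exchanged instead of the first two. *)
Lemma succ_in_zxy_high : b <= c < a -> o2 < o1 <= o3 ->
   [/\ succ_in M m b o1, succ_in M (swapm m b o1) a o3 & 
      succ_in M (swapm (swapm m b o1) a o3) c o2
      /\ forall z, swapm (swapm (swapm m b o1) a o3) c o2 z
       = swapm (swapm (swapm m a o1) b o2) c o3 z].
Proof.
move=> hs ho.
have q2 : o2 <= a by apply: (succ_le h2); rewrite ?swapm_in //; lia.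
have e2 : o2 = a.
  case: (eqVneq o2 a) => // n.
  suff : o3 <= a by lia.
  apply: (succ_le h3); last by lia.
  rewrite swapm_other ?swapm_in //; lia.
subst o2.
have ma : m a = 0.
  have : swapm (swapm m a o1) b a a = 0 by rewrite (succ_gap h3) //; lia.
  by rewrite swapm_out // swapm_in.
have hb1 z : b < z < o1 -> m z = 0.
  case: (ltngtP z a) => [lz|gz|->] // hz.
    by rewrite -(succ_gap h2 (z := z)) ?swapm_other //; lia.
  by rewrite (succ_gap h1) //; lia.
have p3 : o3 = M \/ (o1 < o3 /\ 0 < m o3) \/ (o1 = o3 /\ 1 < m o3).
  case: (eqVneq o3 M) => [|n]; [by left|right].
  have := succ_pos h3; case: (eqVneq o3 o1) => [e|n1]; last first.
    by rewrite !swapm_other; lia.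
  by rewrite e swapm_other ?swapm_out; lia.
split.
- split=> //; first lia.
  by case: h1 => _ hh _.
- split=> //; first by lia.
    case: (eqVneq o3 M) => [|n]; [by left|right].
    case: p3 => [|[[p3 p4]|[p3 p4]]]; first by move/eqP: n.
      by rewrite swapm_other //; lia.
    by rewrite -p3 in p4 *; rewrite swapm_out; lia.
  move=> z hz; case: (ltngtP z o1) => [lz|gz|ez].
  + rewrite swapm_other ?hb1 //; lia.
  + rewrite -(succ_gap h3 (z := z)) ?swapm_other //; lia.
  + have : swapm (swapm m a o1) b a z = 0 by rewrite (succ_gap h3) //; lia.
    by rewrite ez swapm_other ?swapm_out ?swapm_out //; lia.
- split.
    split; [lia | right | ].
      rewrite swapm_in //; lia.
    move=> z hz; rewrite !swapm_other ?hb1 //; lia.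
  move=> z.
  have ea : m o3 = 0 \/ a <> o3 by lia.
  clear -ma p3 hM g1 g2 g3 hs ho ha ho1.
  have := hM (z := M) (leqnn M).
  rewrite /swapm; clear hM.
  case: (eqVneq z o3); case: (eqVneq z o1); case: (eqVneq z a);
   case: (eqVneq z b); case: (eqVneq z c) => ?????; subst; lia.
Qed.

(** Since [o2 <= a <= c < o3], the bumps caused by [b] and [c] take place in separate parts of the
    row. *)
Lemma succ_in_yxz : b < a <= c -> (o2 < o1 <= o3) /\ 
   [/\ succ_in M m a o1, succ_in M (swapm m a o1) c o3 & 
      succ_in M (swapm (swapm m a o1) c o3) b o2
      /\ forall z, swapm (swapm (swapm m a o1) c o3) b o2 z
       = swapm (swapm (swapm m a o1) b o2) c o3 z].
Proof.
move=> hs.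
have q2 : o2 <= a by apply: (succ_le h2); rewrite ?swapm_in //; lia.
have q3 : o1 <= o3.
  case: (eqVneq o3 M) => [->//|n].
  have := succ_pos h3; rewrite swapm_other; try lia.
  case: (eqVneq o3 o1) => [->//|n3].
  rewrite swapm_other; try lia.
  move=> /(_ _)/(fun p => succ_le h1 p _) ->; lia.
have eqz z : swapm (swapm (swapm m a o1) c o3) b o2 z
       = swapm (swapm (swapm m a o1) b o2) c o3 z.
  apply: swapmC => //; try lia.
  by move=> _; apply: (succ_pos h2); lia.
split; first by lia.
split=> //.
- split=> //.
    case: (eqVneq o3 M) => [|n]; [by left|right].
    have := succ_pos h3; rewrite swapm_other; try lia.
  move=> z hz; rewrite -(succ_gap h3 hz) [RHS]swapm_other //; lia.
- split=> //; split=> //.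
  + right; case: (eqVneq o2 c) => [->|n]; first by rewrite swapm_in.
    rewrite swapm_other; try lia.
    apply: (succ_pos h2); lia.
  + move=> z hz; rewrite swapm_other ?(succ_gap h2 hz) //; lia.
Qed.
End SuccTriple.

Lemma eq_swapm m m' x y : m =1 m' -> swapm m x y =1 swapm m' x y.
Proof. by move=> e z; rewrite /swapm e. Qed.

Lemma eq_succ_in M m m' x y : m =1 m' -> succ_in M m x y -> succ_in M m' x y.
Proof.
move=> e [h1 h2 h3]; split=> //; first by rewrite -e.
by move=> z hz; rewrite -e h3.
Qed.

(** * Rows as lists, and their translation into multiplicities *)

Definition gt2 (a b : nat) : bool := b < a.

Definition rrow (r : seq nat) (x : nat) : seq nat := set_nth 0 r (find (fun y => x < y) r) x.

Definition rout (M : nat) (r : seq nat) (x : nat) : nat := nth M r (find (fun y => x < y) r).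

Fixpoint routs (M : nat) (r l : seq nat) : seq nat :=
  if l is x :: l' then rout M r x :: routs M (rrow r x) l' else [::].

Definition mult (r : seq nat) : nat -> nat := fun z => count_mem z r.

Definition below (M : nat) : pred nat := fun y => y < M.

Lemma find_sorted_split (r : seq nat) x : sorted leq r ->
  let i := find (fun y => x < y) r in
  all (fun y => y <= x) (take i r) /\ all (fun y => x < y) (drop i r).
Proof.
elim: r => //= y r IH; rewrite (path_sortedE leq_trans) => /andP[hy hr].
case: ltnP => h /=; last by rewrite h /=; apply: IH.
rewrite h; split=> //; apply: sub_all hy => z; exact: leq_trans.
Qed.

Lemma rrowE r x : let i := find (fun y => x < y) r in
  rrow r x = take i r ++ x :: drop i.+1 r.
Proof.
rewrite /rrow; elim: r => //= y r IH; case: ifP => h //=; first by rewrite drop0.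
by rewrite IH.
Qed.

Lemma routE M r x : let i := find (fun y => x < y) r in
  drop i r = if i < size r then rout M r x :: drop i.+1 r else [::].
Proof.
move=> i; case: (ltnP i (size r)) => h; last by rewrite drop_oversize.
by rewrite /rout (drop_nth M).
Qed.

Lemma rrow_sorted r x : sorted leq r -> sorted leq (rrow r x).
Proof.
move=> hr; have [h1 h2] := find_sorted_split x hr.
rewrite rrowE /=; set i := find _ _ in h1 h2 *.
have hd : all (fun y => x < y) (drop i.+1 r).
  by apply/allP => y hy; apply: (allP h2); rewrite -addn1 addnC -drop_drop in hy; apply: mem_drop hy.
rewrite -cat1s !(sorted_pairwise leq_trans) !pairwise_cat allrel_catr /=.
have p1 : pairwise leq (take i r) by rewrite -sorted_pairwise ?take_sorted //; exact: leq_trans.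
have p2 : pairwise leq (drop i.+1 r) by rewrite -sorted_pairwise ?drop_sorted //; exact: leq_trans.
rewrite p1 p2 andbT.
apply/and3P; split=> //.
- apply/andP; split; apply/allrelP => y z hy hz.
    by rewrite mem_seq1 in hz; rewrite (eqP hz) (allP h1).
  by apply: leq_trans (allP h1 _ hy) (ltnW (allP hd _ hz)).
- by rewrite allrel1l; apply: sub_all hd => y; apply: ltnW.
Qed.

Lemma rout_le M r x : all (below M) r -> rout M r x <= M.
Proof.
move=> hr; rewrite /rout; set i := find _ _.
case: (ltnP i (size r)) => h; last by rewrite nth_default.
by apply: ltnW; apply: (allP hr); apply: mem_nth.
Qed.

Lemma rrow_below M r x : all (below M) r -> x < M -> all (below M) (rrow r x).
Proof.
move=> hr hx; rewrite rrowE /= all_cat /= {2}/below hx /=.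
by apply/andP; split; apply/allP => y hy; apply: (allP hr); [apply: mem_take hy|apply: mem_drop hy].
Qed.

Lemma mult_below M r z : all (below M) r -> M <= z -> mult r z = 0.
Proof.
move=> hr hz; apply: count_memPn; apply/negP => h.
by have := allP hr _ h; rewrite /below ltnNge hz.
Qed.

Lemma rout_succ M r x : sorted leq r -> all (below M) r -> x < M ->
  succ_in M (mult r) x (rout M r x).
Proof.
move=> hr hM hx; have [h1 h2] := find_sorted_split x hr.
have := routE M r x; set i := find _ _ in h1 h2 * => /= e.
split.
- move: e h2; case: ltnP => h ->; first by case/andP.
  by rewrite /rout nth_default.
- case: (ltnP i (size r)) => h; last by left; rewrite /rout nth_default.
  by right; rewrite /mult -has_count has_pred1 /rout mem_nth.
- move=> z hz; rewrite /mult -(cat_take_drop i r) count_cat.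
  have -> : count_mem z (take i r) = 0.
    apply: count_memPn; apply/negP => h; have := allP h1 _ h; lia.
  apply: count_memPn; apply/negP => h.
  move: h hr e h2; rewrite -{2}(cat_take_drop i r) (sorted_pairwise leq_trans) pairwise_cat.
  move=> h /and3P[_ _ h3] e; move: h h3; rewrite e; case: ifP => // _.
  rewrite inE => /orP[/eqP e1|h] /=; first by lia.
  by case/andP=> /allP /(_ _ h); lia.
Qed.

Lemma mult_rrow M r x : sorted leq r -> all (below M) r -> x < M ->
  mult (rrow r x) =1 swapm (mult r) x (rout M r x).
Proof.
move=> hr hM hx z; have hs := rout_succ hr hM hx.
have := routE M r x; rewrite /mult rrowE /swapm /=; set i := find _ _ => e.
rewrite -{3}(cat_take_drop i r) e !count_cat /= ![_ == z]eq_sym.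
case: (ltnP i (size r)) => h /=; first lia.
rewrite (drop_oversize (ltnW _)) //=.
rewrite [rout M r x]nth_default //.
case: (eqVneq z M) => [ez|_]; last by lia.
have : mult r z = 0 by apply: mult_below hM _; rewrite ez.
rewrite /mult -{1}(cat_take_drop i r) count_cat => /eqP; rewrite addn_eq0 => /andP[/eqP -> _].
by rewrite ez gtn_eqF.
Qed.

Lemma mult_inj r r' : sorted leq r -> sorted leq r' -> mult r =1 mult r' -> r = r'.
Proof.
move=> hr hr' e; apply: (sorted_eq leq_trans anti_leq) => //.
by rewrite /perm_eq; apply/allP => z _ /=; apply/eqP; apply: e.
Qed.

Definition kt3 (g : rel nat) (l : seq nat) : seq nat :=
  if l is [:: a; b; c] then kt g a b c else l.

Lemma kt3_gt2K a b c : kt3 gt2 (kt gt2 a b c) = [:: a; b; c].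
Proof.
rewrite /kt /gt2.
case: (ltnP b a); case: (ltnP c b); case: (ltnP c a) => /= h1 h2 h3; rewrite /kt;
 repeat (case: ifP => /=); move=> *; try done; lia.
Qed.

Lemma succ_chain M r l : sorted leq r -> all (below M) r -> all (below M) l ->
  [/\ sorted leq (foldl rrow r l), all (below M) (foldl rrow r l) & all (fun y => y <= M) (routs M r l)].
Proof.
elim: l r => //= x l IH r hr hM /andP[hx hl].
have [||//|-> -> ->] := IH (rrow r x); first exact: rrow_sorted.
  exact: rrow_below.
by rewrite rout_le.
Qed.

(** The multiplicity relations determine the outputs and the final row, so a chain exhibited by the
    case lemmas above is the actual insertion. *)
Lemma succ_routs M r r' a b c o1 o2 o3 :
  sorted leq r -> all (below M) r -> all (below M) [:: a; b; c] -> 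
  sorted leq r' -> all (fun y => y <= M) [:: o1; o2; o3] ->
  succ_in M (mult r) a o1 -> succ_in M (swapm (mult r) a o1) b o2 ->
  succ_in M (swapm (swapm (mult r) a o1) b o2) c o3 ->
  (swapm (swapm (swapm (mult r) a o1) b o2) c o3) =1 mult r' ->
  routs M r [:: a; b; c] = [:: o1; o2; o3] /\ foldl rrow r [:: a; b; c] = r'.
Proof.
move=> hr hM /and4P[ha hb hc _] hr' /and4P[p1 p2 p3 _] h1 h2 h3 h4 /=.
have e1 : rout M r a = o1.
  apply: succ_in_inj h1; [by move=> z; apply: mult_below|exact: rout_le|by []|exact: rout_succ].
have [hr1 hM1] := (rrow_sorted a hr, rrow_below hM ha).
have f1 : mult (rrow r a) =1 swapm (mult r) a o1 by rewrite -e1; apply: mult_rrow.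
have e2 : rout M (rrow r a) b = o2.
  apply: succ_in_inj (eq_succ_in (fun z => esym (f1 z)) h2);
   [by move=> z; apply: mult_below|exact: rout_le|by []|exact: rout_succ].
have [hr2 hM2] := (rrow_sorted b hr1, rrow_below hM1 hb).
have f2 : mult (rrow (rrow r a) b) =1 swapm (swapm (mult r) a o1) b o2.
  by move=> z; rewrite (mult_rrow hr1 hM1 hb) e2; apply: eq_swapm.
have e3 : rout M (rrow (rrow r a) b) c = o3.
  apply: succ_in_inj (eq_succ_in (fun z => esym (f2 z)) h3);
   [by move=> z; apply: mult_below|exact: rout_le|by []|exact: rout_succ].
have [hr3 hM3] := (rrow_sorted c hr2, rrow_below hM2 hc).
rewrite e1 e2 e3; split=> //.
apply: mult_inj => // z.
by rewrite (mult_rrow hr2 hM2 hc) e3 -h4; apply: eq_swapm.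
Qed.

Lemma routs_succ M r a b c :
  sorted leq r -> all (below M) r -> all (below M) [:: a; b; c] -> 
  exists o1 o2 o3, [/\ routs M r [:: a; b; c] = [:: o1; o2; o3],
  [/\ o1 <= M, o2 <= M & o3 <= M],
  [/\ succ_in M (mult r) a o1, succ_in M (swapm (mult r) a o1) b o2 &
  succ_in M (swapm (swapm (mult r) a o1) b o2) c o3] &
  (swapm (swapm (swapm (mult r) a o1) b o2) c o3) =1 mult (foldl rrow r [:: a; b; c])].
Proof.
move=> hr hM /and4P[ha hb hc _].
have [hr1 hM1] := (rrow_sorted a hr, rrow_below hM ha).
have [hr2 hM2] := (rrow_sorted b hr1, rrow_below hM1 hb).
have f1 := mult_rrow hr hM ha. have f2 := mult_rrow hr1 hM1 hb.
have f3 := mult_rrow hr2 hM2 hc.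
exists (rout M r a), (rout M (rrow r a) b), (rout M (rrow (rrow r a) b) c).
have f12 : swapm (swapm (mult r) a (rout M r a)) b (rout M (rrow r a) b)
   =1 mult (rrow (rrow r a) b) by move=> z; rewrite f2; apply: eq_swapm => t; rewrite f1.
split=> //.
- by split; apply: rout_le.
- split; first exact: rout_succ.
    by apply: eq_succ_in (rout_succ hr1 hM1 hb) => z; rewrite f1.
  by apply: eq_succ_in (rout_succ hr2 hM2 hc) => z; rewrite f12.
- by move=> z; rewrite [RHS]f3; apply: eq_swapm.
Qed.

Lemma size_routs M r l : size (routs M r l) = size l.
Proof. by elim: l r => //= x l IH r; rewrite IH. Qed.

Lemma row_kt_DA M r a b c : b < a -> b <= c ->
  sorted leq r -> all (below M) r -> all (below M) [:: a; b; c] -> 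
  routs M r (kt gt2 a b c) = kt3 gt2 (routs M r [:: a; b; c]) /\
  foldl rrow r (kt gt2 a b c) = foldl rrow r [:: a; b; c].
Proof.
move=> hba hbc hr hM hl; have /and4P[ha hb hc _] := hl.
have [o1 [o2 [o3 [-> [q1 q2 q3] [h1 h2 h3] h4]]]] := routs_succ hr hM hl.
have hm z : M <= z -> mult r z = 0 by apply: mult_below.
have [hs _ _] := succ_chain hr hM hl.
have q : b < o2 by case: h2.
rewrite /kt3 {1 3}/kt /gt2 hba ltnNge hbc /=.
have e12 : o2 < o1 by rewrite (succ_in2 _ _ _ _ _ h1 h2).
have e23 : (o3 < o2) = false.
  rewrite (succ_in2 _ _ _ _ _ h2 h3) //; first by rewrite ltnNge hbc.
  by move=> z hz; rewrite /swapm hm //; move: hz; rewrite /below in ha *; lia.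
rewrite /kt e12 e23 /=.
case: ltnP => hca.
- case: ltnP => h13 /=.
  + have [||p1 p2 [p3 p4]] := succ_in_zxy_low ha hb hc q1 q2 q3 h1 h2 h3; [lia|lia|].
    apply: succ_routs p1 p2 p3 _ => //; first by rewrite /= hb ha hc.
      by rewrite /= q1 q2 q3.
    by move=> z; rewrite p4 h4.
  + have [||p1 p2 [p3 p4]] := succ_in_zxy_high ha hb hc q1 q2 q3 hm h1 h2 h3; [lia|lia|].
    apply: succ_routs p1 p2 p3 _ => //; first by rewrite /= hb ha hc.
      by rewrite /= q1 q2 q3.
    by move=> z; rewrite p4 h4.
- have [|h13 [p1 p2 [p3 p4]]] := succ_in_yxz ha hb hc q1 q2 q3 h1 h2 h3; first lia.
  have -> : o3 < o1 = false by lia.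
  apply: succ_routs p1 p2 p3 _ => //; first by rewrite /= hb ha hc.
      by rewrite /= q1 q2 q3.
    by move=> z; rewrite p4 h4.
Qed.

Lemma kt_below M a b c : all (below M) [:: a; b; c] -> all (below M) (kt gt2 a b c).
Proof. by rewrite /kt; case: ifP => // _; case: ifP => _ /= /and4P[-> -> -> _]. Qed.

(** The transformation is an involution exchanging the triples with a descent before an ascent and
    those with the opposite pattern; the latter are reduced to the former by applying the case
    already treated to the transformed triple. *)
Lemma row_kt M r a b c : 
  sorted leq r -> all (below M) r -> all (below M) [:: a; b; c] -> 
  gt2 a b != gt2 b c ->
  routs M r (kt gt2 a b c) = kt3 gt2 (routs M r [:: a; b; c]) /\
  foldl rrow r (kt gt2 a b c) = foldl rrow r [:: a; b; c].
Proof.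
move=> hr hM hl hn.
case hab: (gt2 a b); first by apply: row_kt_DA => //; rewrite /gt2 in hn hab *; lia.
have := kt3_gt2K a b c; have := kt_below hl.
case e: (kt gt2 a b c) => [|a' [|b' [|c' [|? ?]]]];
 try by move: e; rewrite /kt; case: ifP => // _; case: ifP.
rewrite /kt3 => hl' e'.
have [d1 d2] : b' < a' /\ b' <= c'.
  by move: e; rewrite /kt (negPf hn); move: hn hab; rewrite /gt2;
   case: ifP => h1 h2 h3 [<- <- <-]; lia.
have [] := row_kt_DA d1 d2 hr hM hl'.
rewrite e' => h1 h2; rewrite h2 h1; split=> //.
by case: (routs M r [:: a'; b'; c']) (size_routs M r [:: a'; b'; c'])
  => [|x [|y [|z [|? ?]]]] // _; exact: esym (kt3_gt2K x y z).
Qed.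

(** * From one row to a whole tableau *)

Definition lt2 (a b : nat) : bool := a < b.

Fixpoint irow (T : tableau) (x : nat) : nat :=
  if T is r :: T' then
    let i := find (fun y => x < y) r in
    if i < size r then (irow T' (nth 0 r i)).+1 else 0
  else 0.

Fixpoint rowsq (T : tableau) (l : seq nat) : seq nat :=
  if l is x :: l' then irow T x :: rowsq (ins T x) l' else [::].

Definition rsorted (T : tableau) := all (sorted leq) T.
Definition tbelow (M : nat) (T : tableau) := all (all (below M)) T.

Lemma ex_below (T : tableau) (l : seq nat) : exists M, tbelow M T /\ all (below M) l.
Proof.
pose s := flatten T ++ l; exists (\max_(y <- s) y).+1.
have h y : y \in s -> below (\max_(y <- s) y).+1 y.
  by move=> hy; rewrite /below ltnS; apply: (@leq_bigmax_seq _ _ xpredT id).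
split; last by apply/allP => y hy; apply: h; rewrite mem_cat hy orbT.
apply/allP => r hr; apply/allP => y hy; apply: h; rewrite mem_cat.
by apply/orP; left; apply/flattenP; exists r.
Qed.

Lemma ins_cons M r T x : all (below M) r ->
  ins (r :: T) x = rrow r x :: (if rout M r x == M then T else ins T (rout M r x)).
Proof.
move=> hM; rewrite /ins -/ins /rout /rrow; set i := find _ _.
case: (ltnP i (size r)) => h.
  have hn := mem_nth M h; have := allP hM _ hn; rewrite /below => hlt.
  by rewrite ltn_eqF // (set_nth_default M 0).
rewrite nth_default // eqxx.
have -> : i = size r by apply/eqP; rewrite eqn_leq h find_size.
by congr (_ :: _); elim: r {hM i h} => //= y r ->.
Qed.

Lemma irow_cons M r T x : all (below M) r ->
  irow (r :: T) x = if rout M r x == M then 0 else (irow T (rout M r x)).+1.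
Proof.
move=> hM; rewrite /irow -/irow /rout; set i := find _ _.
case: (ltnP i (size r)) => h.
  have hn := mem_nth M h; have := allP hM _ hn; rewrite /below => hlt.
  by rewrite ltn_eqF // (set_nth_default M 0).
by rewrite nth_default // eqxx.
Qed.

Lemma rout_below M r x : all (below M) r -> rout M r x != M -> below M (rout M r x).
Proof. by move=> h n; rewrite /below ltn_neqAle n rout_le. Qed.

Lemma ins_rsorted M T x : tbelow M T -> x < M -> rsorted T ->
  rsorted (ins T x) /\ tbelow M (ins T x).
Proof.
elim: T x => [|r T IH] x; first by rewrite /= /below => _ ->.
move=> /andP[hr hT] hx /andP[sr sT]; rewrite (ins_cons T x hr) /=.
rewrite rrow_sorted // rrow_below //=.
by case: ifP => [_|/negbT n]; [|apply: IH => //; apply: rout_below].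
Qed.

(** Descend row by row with [succ_in2]. A path that stops in a row has the largest output [M] there,
    so stopping earlier is consistent with carrying the larger letter. *)
Lemma irow_lt T a b : rsorted T -> (irow T a < irow (ins T a) b) = (b < a).
Proof.
have [M [hM hl]] := ex_below T [:: a; b].
elim: T a b hM hl => [|r T IH] a b; first by move=> _ _ _ /=; case: (ltnP b a).
move=> /andP[hr hT] hl /andP[sr sT]; have [ha hb] : a < M /\ b < M by case/and3P: hl.
have hrr := rrow_below hr ha.
have h1 := rout_succ sr hr ha; have h2 := rout_succ (rrow_sorted a sr) hrr hb.
have h2' := eq_succ_in (mult_rrow sr hr ha) h2.
have := succ_in2 ha hb (rout_le a hr) (rout_le b hrr) (fun z => mult_below hr) h1 h2' => <-.
rewrite (ins_cons T a hr) (irow_cons T a hr) (irow_cons _ b hrr).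
have l1 := rout_le a hr; have l2 := rout_le b hrr.
case: (eqVneq (rout M r a) M) => [->|n1]; case: (eqVneq (rout M (rrow r a) b) M) => [->|n2];
 rewrite ?ltnn ?ltnS //.
- by rewrite [RHS]ltn_neqAle n2 l2.
- by rewrite [RHS]ltnNge l1.
- by apply: IH => //=; rewrite !rout_below.
Qed.

(** Rebuilds the row indices of the new cells from the outputs [os] of the first row and the indices
    [q] obtained below it: an output [M] stops in row 0 and consumes nothing of [q]. *)
Fixpoint weave (M : nat) (os q : seq nat) : seq nat :=
  if os is y :: os' then
    if y == M then 0 :: weave M os' q else (head 0 q).+1 :: weave M os' (behead q)
  else [::].

Lemma foldl_ins_cons M r T l : all (below M) r -> all (below M) l ->
  foldl ins (r :: T) l =
  foldl rrow r l :: foldl ins T [seq y <- routs M r l | y != M].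
Proof.
elim: l r T => // x l IH r T hr /andP[hx hl].
rewrite -[LHS]/(foldl ins (ins (r :: T) x) l) (ins_cons T x hr) IH /=; first last; rewrite ?hl //; first exact: rrow_below.
by case: (rout M r x == M).
Qed.

Lemma rowsq_cons M r T l : all (below M) r -> all (below M) l ->
  rowsq (r :: T) l =
  weave M (routs M r l) (rowsq T [seq y <- routs M r l | y != M]).
Proof.
elim: l r T => // x l IH r T hr /andP[hx hl].
rewrite -[LHS]/(irow (r :: T) x :: rowsq (ins (r :: T) x) l) (ins_cons T x hr) (irow_cons T x hr).
rewrite IH //=; last exact: rrow_below.
by case: (rout M r x == M).
Qed.

(** If all three letters are passed on, the hypothesis about the lower rows applies. If some output
    is [M], it is the largest, and the transformed outputs differ by exchanging an [M] with a
    neighbour; the letters that are passed on keep their order, and [irow_lt] settles the comparison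
    of rows. *)
Lemma ins_kt_step M r T a b c : rsorted (r :: T) -> tbelow M (r :: T) ->
  all (below M) [:: a; b; c] -> gt2 a b != gt2 b c ->
  (forall o1 o2 o3, routs M r [:: a; b; c] = [:: o1; o2; o3] -> all (below M) [:: o1; o2; o3] ->
   gt2 o1 o2 != gt2 o2 o3 -> 
   foldl ins T (kt gt2 o1 o2 o3) = foldl ins T [:: o1; o2; o3] /\
   rowsq T (kt gt2 o1 o2 o3) = kt3 lt2 (rowsq T [:: o1; o2; o3])) ->
  foldl ins (r :: T) (kt gt2 a b c) = foldl ins (r :: T) [:: a; b; c] /\
  rowsq (r :: T) (kt gt2 a b c) = kt3 lt2 (rowsq (r :: T) [:: a; b; c]).
Proof.
move=> /andP[sr sT] /andP[hr hT] hl hn IH.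
have [e1 e2] := row_kt sr hr hl hn.
have hl' := kt_below hl.
rewrite !(@foldl_ins_cons M) // !(@rowsq_cons M) // e2 e1.
have [o1 [o2 [o3 [eo [q1 q2 q3] [h1 h2 h3] _]]]] := routs_succ sr hr hl.
have /and3P[ha hb hc] : [&& a < M, b < M & c < M] by case/and4P: hl; rewrite /below => -> -> ->.
have hm z : M <= z -> mult r z = 0 by apply: mult_below.
have d12 := succ_in2 ha hb q1 q2 hm h1 h2.
have hm' z : M <= z -> swapm (mult r) a o1 z = 0.
  by move=> hz; rewrite /swapm hm //; move: hz; rewrite /below in ha *; lia.
have d23 := succ_in2 hb hc q2 q3 hm' h2 h3.
have {}hn : gt2 o1 o2 != gt2 o2 o3 by rewrite /gt2 d12 d23.
have {}IH := IH _ _ _ eo; rewrite eo; clear -IH q1 q2 q3 hn sT.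
have D x y : ((irow T x).+1 < (irow (ins T x) y).+1) = (y < x) by rewrite ltnS irow_lt.
have ltM x : x <= M -> (x == M) = false -> (x < M) * ((M < x) = false).
  by move=> h1 /negbT h2; rewrite [x < M]ltn_neqAle h1 h2 ltnNge h1.
case n1: (o1 == M); case n2: (o2 == M); case n3: (o3 == M);
 try (move/eqP: (n1) => E1; rewrite ?E1 in hn q1 * );
 try (move/eqP: (n2) => E2; rewrite ?E2 in hn q2 * );
 try (move/eqP: (n3) => E3; rewrite ?E3 in hn q3 * );
 try (have [m1 m1'] := ltM _ q1 n1); try (have [m2 m2'] := ltM _ q2 n2);
 try (have [m3 m3'] := ltM _ q3 n3);
 move: (hn); rewrite /kt3 /kt /gt2 /lt2 ?m1 ?m1' ?m2 ?m2' ?m3 ?m3' ?ltnn //= ?eqxx ?n1 ?n2 ?n3 //=.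
- rewrite D; case: (o3 < o2) => //= _.
  by rewrite ?eqxx ?n1 ?n2 ?n3 /= ?eqxx ?n1 ?n2 ?n3.
- by move=> _; rewrite D; case: (o3 < o1) => /=; rewrite ?eqxx ?n1 ?n2 ?n3 /= ?eqxx ?n1 ?n2 ?n3.
- rewrite D; case: (o2 < o1) => //= _.
  by rewrite ?eqxx ?n1 ?n2 ?n3 /= ?eqxx ?n1 ?n2 ?n3.
- move=> h; have := IH _ hn; rewrite /below /= m1 m2 m3 => /(_ isT).
  move: h; rewrite /kt3 /kt /lt2 /gt2 /= !ltnS.
  case: (_ == (o3 < o2)) => // _; case: (_ == _) => /=; rewrite n1 n2 n3 /= => -[-> /=];
  by case: ifP => _; [|case: ifP => _]; move/(congr1 (map succn)) => /= ->.
Qed.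

Lemma ins_kt T a b c : rsorted T -> gt2 a b != gt2 b c ->
  foldl ins T (kt gt2 a b c) = foldl ins T [:: a; b; c] /\
  rowsq T (kt gt2 a b c) = kt3 lt2 (rowsq T [:: a; b; c]).
Proof.
move=> sT hn; have [M [hM hl]] := ex_below T [:: a; b; c].
elim: T sT a b c hn hM hl => [|r T IH] sT a b c hn hM hl; last first.
  apply: (ins_kt_step (M := M)) => // o1 o2 o3 _ hl' hn'.
  by apply: IH => //; [case/andP: sT | case/andP: hM].
(* Inserting into the empty tableau is inserting into an empty row above it. There the first output
   is [M], so the hypothesis about lower rows is vacuous. *)
have [] := @ins_kt_step M [::] [::] a b c isT isT hl hn.
  by move=> o1 o2 o3 [<- _ _]; rewrite {1}/rout /= /below ltnn.
by rewrite /kt; case: ifP => // _; case: ifP.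
Qed.

(** * Knuth moves at a position and recording sequences *)

Definition kmove (g : rel nat) (k : nat) (w : seq nat) : seq nat :=
  if drop k w is a :: b :: c :: q then take k w ++ kt g a b c ++ q else w.

Definition kmoves (w : word) (ks : seq nat) : word := foldl (fun u k => kmove gt2 k u) w ks.

(* The row indices of the successive new cells; equivalent to the recording
   tableau by rw_Qtab and Qtab_rw. A descent of w is an ascent of rw w. *)
Definition rw (w : word) : seq nat := rowsq [::] w.

Lemma PtabE w : Ptab w = foldl ins [::] w.
Proof.
suff h P Q k : (foldl rsk_step (P, Q, k) w).1.1 = foldl ins P w by exact: h.
by elim: w P Q k => //= x w IH P Q k; apply: IH.
Qed.

Lemma foldl_ins_rsorted T w : rsorted T -> rsorted (foldl ins T w).
Proof.
elim: w T => //= x w IH T hT; apply: IH.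
have [M [hM /andP[hx _]]] := ex_below T [:: x].
by case: (ins_rsorted hM hx hT).
Qed.

Lemma Ptab_rsorted w : rsorted (Ptab w).
Proof. by rewrite PtabE; apply: foldl_ins_rsorted. Qed.

Lemma Ptab_rcons u x : Ptab (rcons u x) = ins (Ptab u) x.
Proof. by rewrite !PtabE -cats1 foldl_cat. Qed.

Lemma rowsq_cat T u v : rowsq T (u ++ v) = rowsq T u ++ rowsq (foldl ins T u) v.
Proof. by elim: u T => //= x u IH T; rewrite IH. Qed.

Lemma size_rowsq T w : size (rowsq T w) = size w.
Proof. by elim: w T => //= x w IH T; rewrite IH. Qed.

Lemma size_rw w : size (rw w) = size w.
Proof. exact: size_rowsq. Qed.

Lemma rw_cat u v : rw (u ++ v) = rw u ++ rowsq (Ptab u) v.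
Proof. by rewrite /rw rowsq_cat PtabE. Qed.

Lemma rw_rcons u x : rw (rcons u x) = rcons (rw u) (irow (Ptab u) x).
Proof. by rewrite -cats1 rw_cat cats1. Qed.

Lemma kmove_split g p a b c q :
  kmove g (size p) (p ++ a :: b :: c :: q) = p ++ kt g a b c ++ q.
Proof. by rewrite /kmove drop_size_cat // take_size_cat. Qed.

Lemma kmove_short g k w : size w < k + 3 -> kmove g k w = w.
Proof.
rewrite /kmove; case e: (drop k w) => [|a [|b [|c q]]] //; have := congr1 size e.
by rewrite size_drop /=; lia.
Qed.

Lemma kmoveP g k w :
  (kmove g k w = w /\ size w < k + 3) \/
  exists p a b c q, [/\ size p = k, w = p ++ a :: b :: c :: q & kmove g k w = p ++ kt g a b c ++ q].
Proof.
rewrite /kmove; case e: (drop k w) => [|a [|b [|c q]]]; have := congr1 size e;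
 rewrite size_drop /= => h; try (left; split=> //; lia).
right; exists (take k w), a, b, c, q; split=> //; last by rewrite -e cat_take_drop.
by rewrite size_take; case: ltnP; lia.
Qed.

Lemma size_kt g a b c : size (kt g a b c) = 3.
Proof. by rewrite /kt; case: ifP => // _; case: ifP. Qed.

Lemma size_kmove g k w : size (kmove g k w) = size w.
Proof.
case: (kmoveP g k w) => [[-> //]|[p [a [b [c [q [_ -> ->]]]]]]].
by rewrite !size_cat size_kt.
Qed.

Lemma perm_kt g a b c : perm_eq (kt g a b c) [:: a; b; c].
Proof.
rewrite /kt; case: ifP => // _; case: ifP => _.
  by rewrite (perm_catCA [:: b] [:: a]).
by rewrite perm_cons (perm_catC [:: c]).
Qed.

Lemma perm_kmove g k w : perm_eq (kmove g k w) w.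
Proof.
case: (kmoveP g k w) => [[-> //]|[p [a [b [c [q [_ -> ->]]]]]]].
by rewrite perm_cat2l (perm_cat2r q (kt g a b c) [:: a; b; c]) perm_kt.
Qed.

(** The new recording sequence is computed from the old one without reference to the letters; all
    comparisons of recording tableaux below rest on this. On monotone triples both sides are fixed,
    because [irow_lt] makes the rows monotone too. *)
Lemma Ptab_kmove k w : Ptab (kmove gt2 k w) = Ptab w /\ rw (kmove gt2 k w) = kmove lt2 k (rw w).
Proof.
case: (kmoveP gt2 k w) => [[-> hk]|[p [a [b [c [q [<- -> ->]]]]]]].
  by split=> //; rewrite kmove_short // size_rw.
have e : foldl ins (Ptab p) (kt gt2 a b c) = foldl ins (Ptab p) [:: a; b; c] /\
   rowsq (Ptab p) (kt gt2 a b c) = kt3 lt2 (rowsq (Ptab p) [:: a; b; c]).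
  have sT := Ptab_rsorted p.
  case n : (gt2 a b == gt2 b c); last by apply: ins_kt => //; rewrite n.
  have [M [hM /andP[ha _]]] := ex_below (Ptab p) [:: a].
  have [sT' _] := ins_rsorted hM ha sT.
  by rewrite /kt n /= /kt /lt2 !irow_lt // -/(gt2 a b) -/(gt2 b c) n.
split.
  by rewrite !PtabE !foldl_cat -(PtabE p) /= (proj1 e).
rewrite rw_cat rowsq_cat (proj2 e) (proj1 e) /= -[X in kmove _ X]size_rw.
by rewrite [in RHS]rw_cat /= kmove_split.
Qed.

Lemma knuth_move_kmove u v : knuth_move u v -> exists k, v = kmove gt2 k u.
Proof.
case=> [] [p [q [x [y [z [h [-> ->]]]]]]]; exists (size p); rewrite kmove_split /kt /gt2;
 repeat case: ifP; move=> *; rewrite /= //; lia.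
Qed.

Lemma kmove_knuth k w : knuth_equiv (kmove gt2 k w) w.
Proof.
case: (kmoveP gt2 k w) => [[-> _]|[p [a [b [c [q [_ -> ->]]]]]]]; first exact: rst_refl.
rewrite /kt /gt2; case: ifP => [_|h1]; first exact: rst_refl.
case: ifP => h2.
  case: (ltnP b a) => h3.
    by apply: rst_step; left; exists p, q, b, c, a; split=> //; lia.
  by apply: rst_sym; apply: rst_step; left; exists p, q, a, c, b; split=> //; lia.
case: (ltnP b a) => h3.
  by apply: rst_sym; apply: rst_step; right; exists p, q, b, a, c; split=> //; lia.
by apply: rst_step; right; exists p, q, c, a, b; split=> //; lia.
Qed.

Lemma kmoves_knuth w ks : knuth_equiv (kmoves w ks) w.
Proof.
rewrite /kmoves; elim: ks w => /= [|k ks IH] w; first exact: rst_refl.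
by apply: rst_trans (IH _) _; apply: kmove_knuth.
Qed.

Lemma kmoveK k w : kmove gt2 k (kmove gt2 k w) = w.
Proof.
case: (kmoveP gt2 k w) => [[e _]|[p [a [b [c [q [<- -> ->]]]]]]]; first by rewrite !e.
have := kt3_gt2K a b c.
move: (size_kt gt2 a b c); case e: (kt gt2 a b c) => [|a' [|b' [|c' [|? ?]]]] //= _ e'.
by rewrite kmove_split e'.
Qed.

Lemma kmoves_cat w k1 k2 : kmoves w (k1 ++ k2) = kmoves (kmoves w k1) k2.
Proof. by rewrite /kmoves foldl_cat. Qed.

Lemma kmovesK w ks : kmoves (kmoves w ks) (rev ks) = w.
Proof.
rewrite /kmoves; elim: ks w => //= k ks IH w.
by rewrite rev_cons -cats1 foldl_cat IH /= kmoveK.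
Qed.

(** Moves at a position are involutions, so a chain of Knuth relations becomes a list of positions,
    which can then be applied to a different word. *)
Lemma knuth_kmoves u v : knuth_equiv u v -> exists ks, v = kmoves u ks.
Proof.
elim=> {u v} [u v /knuth_move_kmove[k ->]|u|u v _ [ks ->]|u v w _ [k1 ->] _ [k2 ->]].
- by exists [:: k].
- by exists [::].
- by exists (rev ks); rewrite kmovesK.
- by exists (k1 ++ k2); rewrite kmoves_cat.
Qed.

Lemma Ptab_kmoves w ks : Ptab (kmoves w ks) = Ptab w.
Proof. by rewrite /kmoves; elim: ks w => //= k ks IH w; rewrite IH (proj1 (Ptab_kmove _ _)). Qed.

Lemma knuth_Ptab u v : knuth_equiv u v -> Ptab u = Ptab v.
Proof. by case/knuth_kmoves=> ks ->; rewrite Ptab_kmoves. Qed.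

Lemma knuth_perm u v : knuth_equiv u v -> perm_eq u v.
Proof.
case/knuth_kmoves=> ks ->; rewrite /kmoves perm_sym.
by elim: ks u => //= k ks IH u; apply: perm_trans (IH _) (perm_kmove _ _ _).
Qed.

Lemma rw_desc w i : i.+1 < size w ->
  (nth 0 w i.+1 < nth 0 w i) = (nth 0 (rw w) i < nth 0 (rw w) i.+1).
Proof.
move=> h; have hs := Ptab_rsorted (take i w).
rewrite -[in RHS](cat_take_drop i w) rw_cat !nth_cat !size_rw size_takel; last by lia.
have -> : (i.+1 < i) = false by lia.
rewrite ltnn subnn subSnn (drop_nth 0 (ltnW h)) (drop_nth 0 h) /= irow_lt //.
Qed.

Lemma size_ins T x : shape (ins T x) = incr_nth (shape T) (irow T x).
Proof.
elim: T x => //= r T IH x; case: ltnP => h /=; last by rewrite size_rcons.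
by rewrite IH size_set_nth (maxn_idPr h).
Qed.

Lemma shape_Ptab w : shape (Ptab w) = foldl incr_nth [::] (rw w).
Proof.
elim/last_ind: w => // w x IH.
by rewrite Ptab_rcons size_ins rw_rcons -cats1 foldl_cat IH.
Qed.

Lemma rw_shape u v : rw u = rw v -> shape (Ptab u) = shape (Ptab v).
Proof. by rewrite !shape_Ptab => ->. Qed.

Lemma rw_size u v : rw u = rw v -> size u = size v.
Proof. by move/(congr1 size); rewrite !size_rw. Qed.

(** * Tableaux and reverse insertion *)

Definition dom (r s : seq nat) : bool :=
  (size s <= size r) && all (fun j => nth 0 r j < nth 0 s j) (iota 0 (size s)).

(** A recursive form of [is_tableau]. Below the last row, [head [::]] supplies an empty row, which
    every row dominates. *)
Fixpoint tab (T : tableau) : bool :=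
  if T is r :: T' then [&& 0 < size r, sorted leq r, dom r (head [::] T') & tab T'] else true.

Lemma domP r s : reflect (size s <= size r /\ forall j, j < size s -> nth 0 r j < nth 0 s j) (dom r s).
Proof.
apply: (iffP andP) => -[h1 h2]; split=> //.
  by move=> j hj; apply: (allP h2); rewrite mem_iota.
by apply/allP => j; rewrite mem_iota => hj; apply: h2.
Qed.

Lemma tabP T : reflect
  [/\ all (fun r => 0 < size r) T, all (sorted leq) T &
      forall i, dom (nth [::] T i) (nth [::] T i.+1)] (tab T).
Proof.
elim: T => [|r T IH] /=.
  by apply: ReflectT; split=> // i; rewrite !nth_nil.
apply: (iffP and4P) => [[h1 h2 h3 /IH[h4 h5 h6]]|[/andP[h1 h2] /andP[h3 h4] h5]].
  by rewrite h1 h2; split=> // -[|i] //=; rewrite nth0.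
split=> //; first by have := h5 0; rewrite /= nth0.
by apply/IH; split=> // i; apply: (h5 i.+1).
Qed.

Lemma tab_is_tableau T : is_tableau T = tab T.
Proof.
apply/and4P/tabP => [[h1 h2 h3 h4]|[h1 h3 h5]].
- split=> // i; apply/domP; case: (ltnP i.+1 (size T)) => hi; last first.
    by rewrite [nth _ _ i.+1]nth_default //=; split.
  split.
    have := sorted_ltn_nth (fun y x z (h : geq x y) (h' : geq y z) => leq_trans h' h) 0 h2.
    move=> /(_ i i.+1); rewrite !inE size_map hi (ltnW hi) !(nth_map [::]) ?(ltnW hi) //.
    by apply.
  move=> j hj; have := allP h4 i; rewrite mem_iota (ltnW hi) => /(_ isT)/allP/(_ j).
  by rewrite mem_iota hj; apply.
- split=> //.
  + apply/(sortedP 0) => i; rewrite size_map => hi.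
    by rewrite !(nth_map [::]) ?(ltnW hi) //; have /domP[] := h5 i.
  + apply/allP => i _; apply/allP => j; rewrite mem_iota => hj.
    by have /domP[_] := h5 i; apply.
Qed.

Lemma tab_rsorted T : tab T -> rsorted T.
Proof. by case/tabP. Qed.

Lemma tab_cons r T : tab (r :: T) = [&& 0 < size r, sorted leq r, dom r (head [::] T) & tab T].
Proof. by []. Qed.

Lemma head_ins T x : head [::] (ins T x) = rrow (head [::] T) x.
Proof.
case: T => [|r T] //=; case: ltnP => //= h; rewrite /rrow.
have -> : find (fun y => x < y) r = size r by apply/eqP; rewrite eqn_leq h find_size.
by elim: r {h} => //= y r ->.
Qed.

Lemma insE r T x : ins (r :: T) x = rrow r x ::
  (if find (fun y => x < y) r < size r then ins T (nth 0 r (find (fun y => x < y) r)) else T).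
Proof.
rewrite [LHS]/=; case: ltnP => // h.
have := head_ins (r :: T) x; rewrite /= ltnNge h /= => ->.
by [].
Qed.

Lemma find_gtP (r : seq nat) x j : sorted leq r -> j < size r ->
  (nth 0 r j <= x) = (j < find (fun y => x < y) r).
Proof.
move=> hr hj; case: (ltnP j) => h.
  by have := before_find 0 h => /=; lia.
have hf : has (fun y => x < y) r by rewrite has_find; lia.
have := nth_find 0 hf => h1.
have := sorted_leq_nth leq_trans leqnn 0 hr.
move=> /(_ (find (fun y => x < y) r) j); rewrite !inE hj -has_find hf h => /(_ isT isT isT); lia.
Qed.

(** The bumped letter is smaller than the entry below it, if there is one, so it enters the next row
    weakly to the left of the column it leaves. *)
Lemma dom_rrow r s x : sorted leq r -> sorted leq s -> dom r s ->
  let k := find (fun y => x < y) r in k < size r ->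
  dom (rrow r x) (rrow s (nth 0 r k)).
Proof.
move=> hr hs /domP[h1 h2] k hk; apply/domP.
set y := nth 0 r k; set k' := find (fun z => y < z) s.
have xy : x < y by apply: (nth_find 0); rewrite has_find.
have hk' : k' <= k.
  case: (ltnP k (size s)) => h; last by apply: leq_trans (find_size _ _) h.
  by rewrite leqNgt -(find_gtP _ hs h) -ltnNge; apply: h2.
rewrite /rrow -/k -/k' !size_set_nth.
split; first by rewrite !geq_max; apply/andP; split; rewrite leq_max; lia.
move=> j hj; rewrite !nth_set_nth /=.
case: (eqVneq j k') => [->|n'].
  case: (eqVneq k' k) => [//|n].
  apply: leq_ltn_trans xy; rewrite (find_gtP _ hr); lia.
have hjs : j < size s.
  move: hj; case: (ltnP k' (size s)) => h; first by rewrite (maxn_idPr h).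
  have : k' = size s by apply/eqP; rewrite eqn_leq find_size.
  move=> e; rewrite e; move/maxn_idPl: (leqnSn (size s)) => ->; rewrite e in n'; lia.
case: (eqVneq j k) => [e|n]; last exact: h2.
by rewrite e in hjs *; apply: ltn_trans xy _; apply: h2.
Qed.

Lemma rrow_nonempty r x : 0 < size (rrow r x).
Proof. by rewrite /rrow size_set_nth leq_max. Qed.

Lemma ins_tab T x : tab T -> tab (ins T x).
Proof.
elim: T x => [|r T IH] x //; rewrite tab_cons => /and4P[h1 h2 h3 h4].
rewrite insE tab_cons rrow_nonempty rrow_sorted //=.
case: ltnP => h; last first.
  rewrite h4 andbT; have /domP[d1 d2] := h3; apply/domP.
  have -> : rrow r x = rcons r x.
    rewrite /rrow; have -> : find (fun y => x < y) r = size r by apply/eqP; rewrite eqn_leq h find_size.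
    by elim: r {h h1 h2 h3 d1 d2} => //= y r ->.
  rewrite size_rcons; split=> [|j hj]; first by lia.
  by rewrite nth_rcons (leq_trans hj d1); apply: d2.
rewrite IH // andbT head_ins; apply: dom_rrow => //.
by case: T h4 {IH h3} => //= s T /and4P[].
Qed.

Lemma Ptab_tab w : tab (Ptab w).
Proof. by elim/last_ind: w => // w x IH; rewrite Ptab_rcons ins_tab. Qed.

Lemma tab_shape_pos T : tab T -> all (fun m => 0 < m) (shape T).
Proof. by case/tabP=> h _ _; rewrite all_map. Qed.

Lemma tab_shape_dec T i : tab T -> nth 0 (shape T) i.+1 <= nth 0 (shape T) i.
Proof.
case/tabP=> _ _ /(_ i)/domP[h _].
case: (ltnP i.+1 (size T)) => hi; last by rewrite nth_default // size_map.
by rewrite !(nth_map [::]) // ltnW.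
Qed.

Lemma pos_eq_nth (v v' : seq nat) : all (fun m => 0 < m) v -> all (fun m => 0 < m) v' ->
  (forall j, nth 0 v j = nth 0 v' j) -> v = v'.
Proof.
move=> h h' e; apply: (@eq_from_nth _ 0) => //.
have H (u u' : seq nat) : all (fun m => 0 < m) u -> (forall j, nth 0 u j = nth 0 u' j) -> size u <= size u'.
  move=> hu eu; rewrite leqNgt; apply/negP => hlt.
  by have := allP hu _ (mem_nth 0 hlt); rewrite eu nth_default.
by apply/eqP; rewrite eqn_leq; apply/andP; split; apply: H.
Qed.

Lemma incr_nth_injl (v v' : seq nat) i : all (fun m => 0 < m) v -> all (fun m => 0 < m) v' ->
  incr_nth v i = incr_nth v' i -> v = v'.
Proof.
move=> h h' e; apply: pos_eq_nth => // j.
by have := congr1 (nth 0 ^~ j) e; rewrite /= !nth_incr_nth; lia.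
Qed.

Lemma incr_nth_injr (v : seq nat) i i' : incr_nth v i = incr_nth v i' -> i = i'.
Proof.
move=> e; have := congr1 (nth 0 ^~ i) e; rewrite /= !nth_incr_nth eqxx.
by case: eqP => //; lia.
Qed.

Lemma rrow_last r x : all (fun y => y <= x) r -> rrow r x = rcons r x.
Proof.
rewrite /rrow; elim: r => //= y r IH /andP[h1 h2].
by rewrite ltnNge h1 /= IH.
Qed.

Lemma find_last r x : all (fun y => y <= x) r -> find (fun y => x < y) r = size r.
Proof. by elim: r => //= y r IH /andP[h1 h2]; rewrite ltnNge h1 /= IH. Qed.

Lemma set_nthK r k x y : k < size r -> set_nth 0 (set_nth 0 r k y) k x = set_nth 0 r k x.
Proof. by elim: r k => // z r IH [|k] //= h; rewrite IH. Qed.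

Lemma set_nth_id r k : k < size r -> set_nth 0 r k (nth 0 r k) = r.
Proof. by elim: r k => // z r IH [|k] //= h; rewrite IH. Qed.

(** The letter [y] must have been bumped by the rightmost entry of [r] smaller than [y]. That
    position is not left of the place where [y] landed, and so [y] can be put back without
    destroying dominance. *)
Lemma rev_bump r s' y : sorted leq r -> sorted leq s' -> dom r (rrow s' y) ->
  exists r' x, [/\ sorted leq r', dom r' s', rrow r' x = r, size r' = size r &
    
    find (fun z => x < z) r' < size r' /\ nth 0 r' (find (fun z => x < z) r') = y].
Proof.
move=> hr hs' /domP[d1 d2]; set k' := find (fun z => y < z) s'.
have es j : nth 0 (rrow s' y) j = if j == k' then y else nth 0 s' j by rewrite nth_set_nth.
have ss : size (rrow s' y) = maxn k'.+1 (size s') by rewrite size_set_nth.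
have hk' : k' < size (rrow s' y) by rewrite ss leq_max leqnn.
have rk' : nth 0 r k' < y by have := d2 k' hk'; rewrite es eqxx.
(* Since [y] is positive, [y.-1 < z] means [y <= z]: [f] is the number of entries of [r] smaller
   than [y]. *)
pose f := find (fun z => y.-1 < z) r.
have hf j : j < size r -> (nth 0 r j < y) = (j < f).
  by move=> hj; rewrite -(find_gtP _ hr hj); lia.
have kf : k' < f by rewrite -hf //; lia.
have fr : f <= size r by apply: find_size.
pose k := f.-1; have hk : k < size r by rewrite /k; lia.
have rk : nth 0 r k < y by rewrite hf // /k; lia.
have hle i j : i <= j -> j < size r -> nth 0 r i <= nth 0 r j.
  by move=> h1 h2; apply: (sorted_leq_nth leq_trans leqnn 0 hr) => //; rewrite inE; lia.
exists (set_nth 0 r k y), (nth 0 r k).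
have sz : size (set_nth 0 r k y) = size r by rewrite size_set_nth; apply/maxn_idPr.
have hfind : find (fun z => nth 0 r k < z) (set_nth 0 r k y) = k.
  apply/eqP; rewrite eqn_leq; apply/andP; split.
    rewrite leqNgt; apply/negP => h; have := before_find 0 h.
    by rewrite nth_set_nth /= eqxx rk.
  rewrite leqNgt; apply/negP => h.
  have : has (fun z => nth 0 r k < z) (set_nth 0 r k y) by rewrite has_find sz; lia.
  move/(nth_find 0); rewrite nth_set_nth /=; set i := find _ _ in h *.
  by case: eqP => [e|_]; [lia | rewrite ltnNge hle // ltnW].
split=> //.
- apply/(sortedP 0) => i; rewrite sz !nth_set_nth /= => hi.
  case: (eqVneq i k) => [e|n]; case: (eqVneq i.+1 k) => [e'|n']; try lia.
  + by rewrite leqNgt hf //; move: e; rewrite /k; lia.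
  + by apply: leq_trans (hle i k _ _) (ltnW rk); lia.
  + by apply: hle.
- apply/domP; rewrite sz; split; first by move: d1; rewrite ss; lia.
  move=> j hj; rewrite nth_set_nth /=.
  have hjs : j < size (rrow s' y) by rewrite ss leq_max hj orbT.
  have hgt : k' <= j -> y < nth 0 s' j.
    by move=> h; rewrite ltnNge (find_gtP _ hs' hj) -leqNgt.
  case: (eqVneq j k) => [e|n]; first by apply: hgt; rewrite e /k; lia.
  have := d2 j hjs; rewrite es; case: (eqVneq j k') => [e|//].
  by move=> h; apply: ltn_trans h _; apply: hgt; rewrite e.
- by rewrite /rrow hfind set_nthK // set_nth_id.
- by rewrite hfind sz nth_set_nth /= eqxx.
Qed.

Lemma irowE r T x : irow (r :: T) x =
  if find (fun y => x < y) r < size r then (irow T (nth 0 r (find (fun y => x < y) r))).+1 else 0.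
Proof. by []. Qed.

Lemma rev_ins T i : tab T -> nth 0 (shape T) i.+1 < nth 0 (shape T) i ->
  exists T' x, [/\ tab T', ins T' x = T & irow T' x = i].
Proof.
elim: i T => [|i IH] [|r T] // hT; move: (hT); rewrite tab_cons => /and4P[h1 h2 h3 h4].
- case/lastP: r h1 h2 h3 hT => // r x _ h2 /domP[d1 d2] hT.
  rewrite /= size_rcons => hlt.
  have hx : all (fun y => y <= x) r.
    move: h2; rewrite (sorted_pairwise leq_trans) -cats1 pairwise_cat allrel1r.
    by case/and3P.
  have hr : sorted leq r by move: h2; rewrite (sorted_pairwise leq_trans) -cats1 pairwise_cat -sorted_pairwise => [/and3P[]|]; last exact: leq_trans.
  case: r {hT} d1 d2 hlt hx hr h2 => [|y r] d1 d2 hlt hx hr h2.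
    exists [::], x; split=> //=; case: T h4 hlt {d1 d2} => // s T /and4P[h _ _ _] /=; lia.
  exists ((y :: r) :: T), x; split.
  + rewrite tab_cons hr h4 /= andbT; apply/domP.
    have hs : size (head [::] T) <= (size r).+1 by case: T {h4 d1 d2} hlt.
    split=> // j hj; have := d2 j hj; rewrite nth_rcons.
    by rewrite [size _]/= (leq_trans hj hs).
  + by rewrite insE rrow_last // find_last // ltnn.
  + by rewrite irowE find_last // ltnn.
- move=> /= hlt; have [T' [y [t1 t2 t3]]] := IH T h4 hlt.
  have hs' : sorted leq (head [::] T') by case: T' t1 {t2 t3} => //= s T' /and4P[].
  rewrite -t2 head_ins in h3.
  have [r' [x [p1 p2 p3 p4 [p5 p6]]]] := rev_bump h2 hs' h3.
  exists (r' :: T'), x; split.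
  + by rewrite tab_cons p4 h1 p1 p2.
  + by rewrite insE p3 p5 p6 t2.
  + by rewrite irowE p5 p6 t3.
Qed.

Lemma size_ins_row r x : size (rrow r x) = if find (fun y => x < y) r < size r then size r else (size r).+1.
Proof.
rewrite /rrow size_set_nth; case: ltnP => h; first exact/maxn_idPr.
by have := find_size (fun y => x < y) r; lia.
Qed.

(** Row lengths tell whether a letter was passed on; the rows below tell which letter, and
    sortedness leaves only one position for it. *)
Lemma ins_inj T T' x x' : rsorted T -> rsorted T' -> shape T = shape T' ->
  ins T x = ins T' x' -> T = T' /\ x = x'.
Proof.
elim: T T' x x' => [|r T IH] [|r' T'] x x' //; first by move=> _ _ _ [->].
move=> /andP[sr sT] /andP[sr' sT'] [e1 e2]; rewrite !insE e1 => -[e3 e4].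
have := congr1 size e3; rewrite !size_ins_row e1.
set k := find _ r in e3 e4 *; set k' := find _ r' in e3 e4 *.
case: ltnP e4 => h; case: ltnP => h' e4 //; try lia; move=> _; last first.
  have a1 : k = size r by apply/eqP; rewrite eqn_leq find_size /= ?h ?e1 ?h.
  have a2 : k' = size r' by apply/eqP; rewrite eqn_leq find_size.
  move: e3; rewrite /rrow -/k -/k' a1 a2.
  have R (s : seq nat) z : set_nth 0 s (size s) z = rcons s z by elim: s => //= ? s ->.
  by rewrite !R => /rcons_inj[-> ->]; rewrite e4.
have [eT ey] := IH _ _ _ sT sT' e2 e4.
have x1 : x < nth 0 r k by apply: (nth_find 0 (a := fun y => x < y)); rewrite has_find e1.
have x2 : x' < nth 0 r' k' by apply: (nth_find 0 (a := fun y => x' < y)); rewrite has_find.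
have E j : (if j == k then x else nth 0 r j) = if j == k' then x' else nth 0 r' j.
  by have := congr1 (nth 0 ^~ j) e3; rewrite /= !nth_set_nth.
have ek : k = k'.
  case: (ltngtP k k') => // hlt.
  - have := E k'; rewrite eqxx (gtn_eqF hlt) => e5.
    have : nth 0 r k <= nth 0 r k'.
      by apply: (sorted_leq_nth leq_trans leqnn 0 sr) => //; rewrite ?inE ?e1 // ltnW.
    by rewrite e5 ey leqNgt x2.
  - have := E k; rewrite eqxx (gtn_eqF hlt) => e5.
    have : nth 0 r' k' <= nth 0 r' k.
      by apply: (sorted_leq_nth leq_trans leqnn 0 sr') => //; rewrite ?inE // ltnW.
    by rewrite -e5 -ey leqNgt x1.
have ex : x = x' by have := E k; rewrite eqxx ek eqxx.
split; last by [].
rewrite eT; congr cons; apply: (@eq_from_nth _ 0) => // j _.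
by have := E j; rewrite -ek; case: (eqVneq j k) => [->|//]; rewrite {2}ek ey.
Qed.

Lemma rsk_inj u v : Ptab u = Ptab v -> rw u = rw v -> u = v.
Proof.
elim/last_ind: u v => [|u x IH] v.
  by move=> _ /rw_size /esym /size0nil.
case/lastP: v => [_ /rw_size|v y]; first by rewrite size_rcons.
rewrite !Ptab_rcons !rw_rcons => e /rcons_inj[e1 e2].
have [e3 ->] := ins_inj (Ptab_rsorted u) (Ptab_rsorted v) (rw_shape e1) e.
by rewrite (IH v).
Qed.

Lemma rsk_surj T w : tab T -> shape T = shape (Ptab w) -> exists w', Ptab w' = T /\ rw w' = rw w.
Proof.
elim/last_ind: w T => [|w x IH] T hT; first by case: T hT => // _ _; exists [::].
rewrite Ptab_rcons size_ins; set i := irow _ _ => e.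
have [|T' [y [t1 t2 t3]]] := @rev_ins T i hT.
  rewrite e !nth_incr_nth eqxx (ltn_eqF (ltnSn i)) add0n add1n ltnS.
  exact/tab_shape_dec/Ptab_tab.
have e' : shape T' = shape (Ptab w).
  apply: (@incr_nth_injl _ _ i); try exact/tab_shape_pos/Ptab_tab.
    exact: tab_shape_pos.
  by rewrite -e -t2 size_ins t3.
have [w' [p1 p2]] := IH T' t1 e'.
by exists (rcons w' y); rewrite Ptab_rcons rw_rcons p1 t2 p2 t3 rw_rcons.
Qed.

(** * Reading words *)

Lemma knuth_cat p q u v : knuth_equiv u v -> knuth_equiv (p ++ u ++ q) (p ++ v ++ q).
Proof.
elim=> {u v} [u v h|u|u v _|u v w _ h1 _ h2].
- apply: rst_step; case: h => [] [a [b [x [y [z [h [-> ->]]]]]]]; [left|right];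
  by exists (p ++ a), (b ++ q), x, y, z; rewrite -!catA.
- exact: rst_refl.
- exact: rst_sym.
- exact: rst_trans h1 h2.
Qed.

(** One half of a bump: [x] travels left through the entries behind the letter [y] that it will
    replace. *)
Lemma knuth_bump_right y t x : x < y -> sorted leq (y :: t) ->
  knuth_equiv ((y :: t) ++ [:: x]) (y :: x :: t).
Proof.
elim: t y => [|z t IH] y xy; first by move=> _; exact: rst_refl.
move=> /= /andP[yz hz].
have := IH z (leq_trans xy yz) hz => /(knuth_cat [:: y] [::]); rewrite !cats0 => h.
apply: rst_trans h _; apply: rst_sym; apply: rst_step; right.
by exists [::], t, x, y, z; rewrite xy yz.
Qed.

(** The other half: [y] travels left through the entries not exceeding [x] and arrives behind the
    reading word of the rows below. *)
Lemma knuth_bump_left s y x : all (fun a => a <= x) s -> x < y -> sorted leq s ->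
  knuth_equiv (s ++ [:: y; x]) (y :: s ++ [:: x]).
Proof.
elim: s => [|a s IH] /=; first by move=> *; exact: rst_refl.
move=> /andP[ax hs] xy hp.
have := IH hs xy (path_sorted hp) => /(knuth_cat [:: a] [::]); rewrite !cats0 => h.
apply: rst_trans h _; case: s hs hp {IH} => [|c s] /= hs hp; apply: rst_step; left.
  by exists [::], [::], a, x, y; rewrite ax xy.
case/andP: hp => ac _; case/andP: hs => cx _.
by exists [::], (s ++ [:: x]), a, c, y; rewrite ac (leq_ltn_trans cx xy).
Qed.

Lemma word_of_cons r T : word_of (r :: T) = word_of T ++ r.
Proof. by rewrite /word_of rev_cons flatten_rcons. Qed.

Lemma knuth_ins T x : rsorted T -> knuth_equiv (rcons (word_of T) x) (word_of (ins T x)).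
Proof.
elim: T x => [|r T IH] x; first by move=> _; exact: rst_refl.
move=> /andP[sr sT]; rewrite insE !word_of_cons rrowE.
set i := find _ r; have [h1 h2] := find_sorted_split x sr; rewrite -/i in h1 h2.
case: (ltnP i (size r)) => hi; last first.
  rewrite take_oversize // drop_oversize ?(leq_trans hi) // -cats1 -catA; exact: rst_refl.
set y := nth 0 r i; have ei : drop i r = y :: drop i.+1 r by rewrite (drop_nth 0).
have xy : x < y by move: h2; rewrite ei => /andP[].
have sd : sorted leq (y :: drop i.+1 r) by rewrite -ei drop_sorted.
have st : sorted leq (take i r) by apply: take_sorted.
rewrite -{1}(cat_take_drop i r) ei -cats1 -!catA.
have hA := knuth_cat (word_of T ++ take i r) [::] (knuth_bump_right xy sd).
rewrite !cats0 -!catA /= in hA; apply: rst_trans hA _.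
have hB := knuth_cat (word_of T) (drop i.+1 r) (knuth_bump_left h1 xy st).
rewrite -!catA /= in hB; apply: rst_trans hB _.
have hC := knuth_cat [::] (take i r ++ x :: drop i.+1 r) (IH y sT).
by rewrite /= cat_rcons in hC; rewrite -catA.
Qed.

Lemma knuth_word_Ptab w : knuth_equiv w (word_of (Ptab w)).
Proof.
elim/last_ind: w => [|w x IH]; first exact: rst_refl.
rewrite Ptab_rcons; apply: rst_trans (knuth_ins x (Ptab_rsorted w)).
by rewrite -!cats1; have := knuth_cat [::] [:: x] IH.
Qed.

Lemma Ptab_knuth u v : Ptab u = Ptab v -> knuth_equiv u v.
Proof.
move=> e; apply: rst_trans (knuth_word_Ptab u) _; rewrite e; apply: rst_sym.
exact: knuth_word_Ptab.
Qed.

(* The insertion of the first j letters of a row r lying strictly above the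
   tableau T pushes the first j columns of T down by one. *)
Fixpoint slide (j : nat) (r : seq nat) (T : tableau) : tableau :=
  if T is r1 :: T1 then (take j r ++ drop j r1) :: slide j r1 T1 else [:: take j r].

Definition above (r s : seq nat) : Prop :=
  forall j, j < size r -> j < size s -> nth 0 r j < nth 0 s j.

Lemma dom_above r s : dom r s -> above r s.
Proof. by case/domP=> _ h j _ hj; apply: h. Qed.

Lemma above_cat_find j r r1 : sorted leq r -> above r r1 -> j < size r -> sorted leq r1 ->
  find (fun y => nth 0 r j < y) (take j r ++ drop j r1) = j.
Proof.
move=> sr ha hj sr1; rewrite find_cat.
have -> : has (fun y => nth 0 r j < y) (take j r) = false.
  apply/negbTE; rewrite -all_predC; apply/(all_nthP 0) => i; rewrite size_takel ?(ltnW hj) // => hi /=.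
  rewrite nth_take // -leqNgt; apply: (sorted_leq_nth leq_trans leqnn 0 sr); rewrite ?inE //; lia.
rewrite size_takel ?(ltnW hj) //.
case: (ltnP j (size r1)) => h; last by rewrite drop_oversize ?addn0.
by rewrite (drop_nth 0) //= ha ?addn0.
Qed.

Lemma take_rcons_nth j (r : seq nat) : j < size r -> take j.+1 r = rcons (take j r) (nth 0 r j).
Proof. by move=> h; rewrite (take_nth 0). Qed.

Lemma slide_over j r T : tab T -> size r <= j -> size (head [::] T) <= j ->
  slide j r T = slide j.+1 r T.
Proof.
elim: T r => [|r1 T IH] r /=; first by move=> _ h _; rewrite !take_oversize // ltnW.
move=> /and4P[_ _ /domP[d _] hT] h1 h2.
by rewrite !take_oversize ?(leqW h1) // !drop_oversize ?(leqW h2) // IH // (leq_trans d).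
Qed.

(** The bumping path runs straight down column [j]: the entry displaced from a row plays, for the
    next row, the part of the [j]-th letter of the row above. Where column [j] ends, [slide_over]
    takes care of the rows left. *)
Lemma ins_slide j r T : tab T -> sorted leq r -> above r (head [::] T) -> 0 < j < size r ->
  ins (slide j r T) (nth 0 r j) = slide j.+1 r T.
Proof.
elim: T r j => [|r1 T IH] r j.
  move=> _ sr _ /andP[j0 hj]; rewrite /slide insE.
  have := @above_cat_find j r [::] sr; rewrite /above cats0 => -> //.
  rewrite size_takel ?(ltnW hj) // ltnn take_rcons_nth // rrow_last //.
  apply/(all_nthP 0) => i; rewrite size_takel ?(ltnW hj) // => hi.
  rewrite nth_take //; apply: (sorted_leq_nth leq_trans leqnn 0 sr); rewrite ?inE //; lia.
rewrite tab_cons => /and4P[p1 p2 p3 p4] sr ha /andP[j0 hj].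
rewrite [slide j r _]/= insE (above_cat_find sr ha hj p2) rrowE (above_cat_find sr ha hj p2).
rewrite size_cat size_takel ?(ltnW hj) // size_drop.
have tk : size (take j r) = j by rewrite size_takel // ltnW.
rewrite /= take_size_cat // take_rcons_nth // cat_rcons.
have -> : drop j.+1 (take j r ++ drop j r1) = drop j.+1 r1.
  by rewrite drop_cat tk ltnNge leqnSn /= drop_drop; congr drop; lia.
congr cons; rewrite nth_cat tk ltnn subnn.
case: (ltnP j (size r1)) => h.
  have -> : (j < j + (size r1 - j)) by lia.
  by rewrite nth_drop addn0 IH ?j0 //; exact: dom_above.
have -> : (j < j + (size r1 - j)) = false by lia.
apply: slide_over => //; case/domP: p3 => d _; exact: leq_trans d h.
Qed.

Lemma ins_slide0 r T : tab T -> above r (head [::] T) -> 0 < size r ->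
  ins T (nth 0 r 0) = slide 1 r T.
Proof.
elim: T r => [|r1 T IH] r; first by case: r => //= x r _ _ _; rewrite take0.
rewrite tab_cons => /and4P[p1 p2 p3 p4] ha hr; rewrite insE.
have hx : nth 0 r 0 < nth 0 r1 0 by apply: ha.
case: r hr ha hx => // x r _ ha; case: r1 p1 p2 p3 ha => // y r1 _ p2 p3 ha /= xy.
rewrite /rrow /= xy /= drop0 take0 -(IH (y :: r1)) //; exact: dom_above p3.
Qed.

Lemma foldl_slide j r T : tab T -> sorted leq r -> above r (head [::] T) -> 0 < j <= size r ->
  foldl ins T (take j r) = slide j r T.
Proof.
move=> hT sr ha; elim: j => // j IH /andP[_ hj].
rewrite take_rcons_nth // -cats1 foldl_cat /=.
case: (posnP j) => [->|j0]; first by rewrite take0 ins_slide0 //; lia.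
by rewrite IH ?j0 ?(ltnW hj) // ins_slide // j0.
Qed.

Lemma slide_full j r T : tab (r :: T) -> size r <= j -> slide j r T = r :: T.
Proof.
elim: T r => [|r1 T IH] r; first by move=> _ h; rewrite /= take_oversize.
rewrite tab_cons => /and4P[_ _ /domP[d _] hT] h.
by rewrite /= take_oversize // drop_oversize ?(leq_trans d) // cats0 IH // (leq_trans d).
Qed.

Lemma Ptab_word_of T : tab T -> Ptab (word_of T) = T.
Proof.
elim: T => // r T IH hT; move: (hT); rewrite tab_cons => /and4P[h1 h2 h3 h4].
rewrite word_of_cons PtabE foldl_cat -PtabE IH // -{1}(take_size r) foldl_slide ?slide_full ?h1 //=.
exact: dom_above.
Qed.

Lemma shape_slide j r T r' T' : shape (r :: T) = shape (r' :: T') ->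
  shape (slide j r T) = shape (slide j r' T').
Proof.
elim: T r T' r' => [|r1 T IH] r [|r1' T'] r' //= [e1]; first by rewrite !size_take e1.
move=> e2 e3; rewrite !size_cat !size_take !size_drop e1 e2; congr cons.
by apply: IH; rewrite /= e2 e3.
Qed.

Lemma rowsq_shape T T' l l' : size l = size l' ->
  (forall j, j <= size l -> shape (foldl ins T (take j l)) = shape (foldl ins T' (take j l'))) ->
  rowsq T l = rowsq T' l'.
Proof.
elim: l T T' l' => [|x l IH] T T' [|x' l'] //= [e] h.
have h0 := h 0 isT; rewrite /= in h0.
have h1 := h 1 isT; rewrite /= !take0 /= !size_ins h0 in h1.
rewrite (incr_nth_injr h1); congr cons; apply: IH => // j hj.
by have := h j.+1 hj.
Qed.

(** By [foldl_slide] every intermediate shape depends on the shape of the tableau only, and a chain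
    of shapes determines the rows of the new cells. *)
Lemma rw_word_of T T' : tab T -> tab T' -> shape T = shape T' ->
  rw (word_of T) = rw (word_of T').
Proof.
elim: T T' => [|r T IH] [|r' T'] // hT hT' e.
move: (hT) (hT'); rewrite !tab_cons => /and4P[h1 h2 h3 h4] /and4P[h1' h2' h3' h4'].
rewrite !word_of_cons !rw_cat !Ptab_word_of //; case: (e) => e1 e2.
rewrite (IH T') //; congr cat; apply: rowsq_shape => // j hj.
case: (posnP j) => [->|j0]; first by rewrite !take0.
rewrite !foldl_slide ?j0 //; first exact: shape_slide.
- exact: dom_above.
- by rewrite -e1.
- exact: dom_above.
Qed.

(** Needed for [tau_p] on tableaux: preserving recording tableaux, it must send reading words to
    reading words. *)
Lemma rw_word_of_eq T u : tab T -> rw u = rw (word_of T) -> u = word_of (Ptab u).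
Proof.
move=> hT e; apply: rsk_inj; rewrite ?Ptab_word_of ?Ptab_tab // e.
apply: rw_word_of => //; first exact: Ptab_tab.
by rewrite (rw_shape e) Ptab_word_of.
Qed.

Lemma tab_of_word_of T : tab_of_word (shape T) (word_of T) = T.
Proof. by rewrite /tab_of_word /word_of /shape -map_rev flattenK revK. Qed.

(** * Recording tableaux and dual equivalence *)

(** Undoes a recording step: the entry [k] disappears, together with its row if it stood alone
    there. *)
Definition strip (k : nat) (Q : tableau) : tableau :=
  [seq r <- [seq [seq y <- r | y < k] | r <- Q] | 0 < size r].

Lemma rec_step_id Q k : rec_step Q (shape Q) k = Q.
Proof. by elim: Q => //= q Q ->; rewrite ltnn. Qed.

Lemma strip_id k Q : all (fun r => 0 < size r) Q -> tbelow k Q -> strip k Q = Q.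
Proof.
rewrite /strip; elim: Q => //= q Q IH /andP[h1 h2] /andP[h3 h4].
by rewrite (all_filterP h3) h1 IH.
Qed.

Lemma rec_step_incr Q i k : all (fun r => 0 < size r) Q -> tbelow k Q -> i <= size Q ->
  let Q' := rec_step Q (incr_nth (shape Q) i) k in
  [/\ shape Q' = incr_nth (shape Q) i, strip k Q' = Q,
      all (fun r => 0 < size r) Q' & tbelow k.+1 Q'].
Proof.
elim: Q i => [|q Q IH] [|i] //=.
- by rewrite /strip /tbelow /= ltnn /below ltnSn.
- move=> /andP[h1 h2] /andP[h3 h4] _.
  have h5 : tbelow k.+1 Q by apply: sub_all h4 => r; apply: sub_all => y; apply: ltnW.
  have h6 : all (below k.+1) q by apply: sub_all h3 => y; apply: ltnW.
  rewrite ltnSn rec_step_id /= size_rcons h2 all_rcons h6 h5 /below ltnSn /strip /=.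
  rewrite filter_rcons ltnn (all_filterP h3) h1; split=> //.
  by have := strip_id h2 h4; rewrite /strip => ->.
- move=> /andP[h1 h2] /andP[h3 h4]; rewrite ltnS => hi.
  have h6 : all (below k.+1) q by apply: sub_all h3 => y; apply: ltnW.
  have [e1 e2 e3 e4] := IH i h2 h4 hi.
  rewrite ltnn /= e1 h1 e3 h6 e4; split=> //.
  by rewrite /strip /= (all_filterP h3) h1; congr cons.
Qed.

Lemma rskE w : rsk w = (Ptab w, Qtab w, size w).
Proof.
rewrite /Ptab /Qtab; case e: (rsk w) => [[P Q] k] /=; congr (_, _, _).
suff h pq : (foldl rsk_step pq w).2 = pq.2 + size w by have := h ([::], [::], 0); rewrite -/(rsk w) e.
elim: w {e} pq => [|x w IH] [[P' Q'] k'] /=; first by rewrite addn0.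
by rewrite IH /= addnS.
Qed.

Lemma Qtab_rcons u x :
  Qtab (rcons u x) = rec_step (Qtab u) (shape (Ptab (rcons u x))) (size u).+1.
Proof.
by rewrite {1}/Qtab /rsk -cats1 foldl_cat -/(rsk u) rskE /= cats1 Ptab_rcons.
Qed.

Lemma irow_size T x : irow T x <= size T.
Proof. by elim: T x => //= r T IH x; case: ifP => // _; apply: IH. Qed.

Lemma Qtab_inv w : [/\ shape (Qtab w) = shape (Ptab w), all (fun r => 0 < size r) (Qtab w)
   & tbelow (size w).+1 (Qtab w)].
Proof.
elim/last_ind: w => // w x [h1 h2 h3].
rewrite Qtab_rcons Ptab_rcons size_ins -h1 size_rcons.
have hi : irow (Ptab w) x <= size (Qtab w).
  by have := congr1 size h1; rewrite !size_map => ->; apply: irow_size.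
by have [-> _ -> ->] := rec_step_incr h2 h3 hi.
Qed.

Lemma sumn_incr_nth s i : sumn (incr_nth s i) = (sumn s).+1.
Proof.
elim: s i => [|m s IH] [|i] //=; last by rewrite IH addnS.
by elim: i.
Qed.

Lemma sumn_shape_Ptab w : sumn (shape (Ptab w)) = size w.
Proof.
elim/last_ind: w => // w x IH.
by rewrite Ptab_rcons size_ins size_rcons -IH sumn_incr_nth.
Qed.

Lemma rw_Qtab u v : rw u = rw v -> Qtab u = Qtab v.
Proof.
elim/last_ind: u v => [|u x IH] v.
  by move=> /rw_size /esym /size0nil ->.
case/lastP: v => [/rw_size|v y]; first by rewrite size_rcons.
move=> e; rewrite !Qtab_rcons (rw_shape e); move: e; rewrite !rw_rcons => /rcons_inj[e _].
by rewrite (IH v e) (rw_size e).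
Qed.

Lemma Qtab_rw u v : Qtab u = Qtab v -> rw u = rw v.
Proof.
have hs u' v' : Qtab u' = Qtab v' -> size u' = size v' /\ shape (Ptab u') = shape (Ptab v').
  move=> e; have [h1 _ _] := Qtab_inv u'; have [h2 _ _] := Qtab_inv v'.
  by rewrite -!sumn_shape_Ptab -h1 -h2 e.
elim/last_ind: u v => [|u x IH] v.
  by move=> /hs[/esym/size0nil ->].
case/lastP: v => [/hs[]|v y]; first by rewrite size_rcons.
move=> e; have [e1 e2] := hs _ _ e; move: e1 e; rewrite !size_rcons !Qtab_rcons !Ptab_rcons !size_ins => -[e1].
have [h1 h2 h3] := Qtab_inv u; have [h1' h2' h3'] := Qtab_inv v.
have hi : irow (Ptab u) x <= size (Qtab u).
  by have := congr1 size h1; rewrite !size_map => ->; apply: irow_size.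
have hi' : irow (Ptab v) y <= size (Qtab v).
  by have := congr1 size h1'; rewrite !size_map => ->; apply: irow_size.
have [_ s1 _ _] := rec_step_incr h2 h3 hi; have [_ s2 _ _] := rec_step_incr h2' h3' hi'.
rewrite -h1 -h1' e1 => e; have eQ : Qtab u = Qtab v by rewrite -s1 -s2 e1 e.
rewrite !rw_rcons (IH v eQ); congr rcons.
move: e2; rewrite !Ptab_rcons !size_ins (proj2 (hs _ _ eQ)); exact: incr_nth_injr.
Qed.

(** * Descents and elementary moves determine the recording sequence *)

(* The largest such relation is dual equivalence. *)
Record bisim (X : word -> word -> Prop) : Prop := Bisim {
  bisim_size : forall u v, X u v -> size u = size v;
  bisim_desc : forall u v i, X u v -> i.+1 < size u ->
    (nth 0 u i.+1 < nth 0 u i) = (nth 0 v i.+1 < nth 0 v i);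
  bisim_kmove : forall u v k, X u v -> X (kmove gt2 k u) (kmove gt2 k v) }.

Lemma bisim_rw_eq : bisim (fun u v => rw u = rw v).
Proof.
split=> [u v|u v i e hi|u v k e]; first exact: rw_size.
- by rewrite !rw_desc -?(rw_size e) // e.
- by rewrite !(proj2 (Ptab_kmove _ _)) e.
Qed.

Lemma bisim_kmoves X u v ks : bisim X -> X u v -> X (kmoves u ks) (kmoves v ks).
Proof.
move=> hX; rewrite /kmoves; elim: ks u v => //= k ks IH u v h.
by apply: IH; apply: bisim_kmove.
Qed.

Lemma kmove_rcons g k u x : k + 2 < size u -> kmove g k (rcons u x) = rcons (kmove g k u) x.
Proof.
move=> hk; case: (kmoveP g k u) => [[_ h]|[p [a [b [c [q [<- -> ->]]]]]]]; first by lia.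
by rewrite -!cats1 -!catA /= kmove_split.
Qed.

Lemma kmoves_rcons u x ks : all (fun k => k + 2 < size u) ks ->
  kmoves (rcons u x) ks = rcons (kmoves u ks) x.
Proof.
rewrite /kmoves; elim: ks u => //= k ks IH u /andP[h1 h2].
by rewrite kmove_rcons // IH // size_kmove.
Qed.

Lemma kmoves_filter u ks : kmoves u [seq k <- ks | k + 2 < size u] = kmoves u ks.
Proof.
rewrite /kmoves; elim: ks u => //= k ks IH u; case: ifP => h /=.
  by rewrite -[RHS]IH size_kmove.
by rewrite kmove_short ?IH //; lia.
Qed.

(** Drives the induction on length: a move that fits into the prefix does not involve the last
    letter. *)
Lemma bisim_prefix X : bisim X ->
  bisim (fun u v => exists x y, X (rcons u x) (rcons v y)).
Proof.
move=> hX; split=> [u v [x [y h]]|u v i [x [y h]] hi|u v k [x [y h]]].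
- by have := bisim_size hX h; rewrite !size_rcons => -[].
- have := bisim_size hX h; rewrite !size_rcons => -[e].
  have := bisim_desc (i := i) hX h; rewrite !size_rcons !nth_rcons -e hi (ltnW hi).
  by apply; apply: ltnW.
- have := bisim_size hX h; rewrite !size_rcons => -[e].
  case: (ltnP (k + 2) (size u)) => hk; last first.
    by exists x, y; rewrite !kmove_short //; lia.
  exists x, y; rewrite -!kmove_rcons -?e //; exact: bisim_kmove.
Qed.

Lemma bisim_flip X : bisim X -> bisim (fun u v => X v u).
Proof.
move=> [h1 h2 h3]; split=> [u v h|u v i h hi|u v k h]; first by rewrite (h1 _ _ h).
- by rewrite (h2 _ _ i h) // (h1 _ _ h).
- exact: h3.
Qed.

Lemma irow_addable w z m : irow (Ptab w) z = m.+1 ->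
  nth 0 (shape (Ptab w)) m.+1 < nth 0 (shape (Ptab w)) m.
Proof.
move=> hm; have := tab_shape_dec m (Ptab_tab (rcons w z)).
by rewrite Ptab_rcons size_ins hm !nth_incr_nth eqxx (gtn_eqF (ltnSn m)) add0n add1n.
Qed.

(* If the new cell of the second word were strictly lower, some removable
   corner of the common shape would separate the two cells; moving the last
   letter of the prefix to that corner makes the last descents disagree. *)
Lemma bisim_irow_le X u x v y : bisim X -> X (rcons u x) (rcons v y) -> rw u = rw v ->
  irow (Ptab v) y <= irow (Ptab u) x.
Proof.
move=> hX h e; rewrite leqNgt; apply/negP => hlt.
have [d hd] : exists d, irow (Ptab v) y = d.+1 by exists (irow (Ptab v) y).-1; rewrite prednK //; apply: leq_ltn_trans hlt.
have hd' : irow (Ptab u) x <= d by rewrite hd ltnS in hlt.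
have := irow_addable hd; rewrite -(rw_shape e) => /(rev_ins (Ptab_tab u))[T' [b [t1 t2 t3]]].
have eP : Ptab (rcons (word_of T') b) = Ptab u by rewrite Ptab_rcons Ptab_word_of.
have [ks hks] := knuth_kmoves (Ptab_knuth (esym eP)).
(* Positions near the end of [u] have no effect on [u], but would involve [x] in the longer word;
   they are dropped. *)
have h' := bisim_kmoves [seq k <- ks | k + 2 < size u] hX h.
have hf : all (fun k => k + 2 < size u) [seq k <- ks | k + 2 < size u] by apply: filter_all.
move: h'; rewrite kmoves_rcons // kmoves_rcons -?(rw_size e) // kmoves_filter (rw_size e) kmoves_filter.
rewrite -hks; set v' := kmoves v ks => h'.
have e' : rw (rcons (word_of T') b) = rw v' by rewrite hks; apply: bisim_kmoves bisim_rw_eq e.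
have ev : Ptab v' = Ptab v by rewrite Ptab_kmoves.
case/lastP: v' h' e' ev => [_ /rw_size|v1 b']; first by rewrite size_rcons.
move=> h' e' ev; have := rw_size e'; rewrite !size_rcons => -[es].
have := bisim_desc (i := size v1) hX h'.
rewrite !size_rcons !nth_rcons !size_rcons es !ltnn !eqxx !ltnSn /= => /(_ isT).
move: e'; rewrite !rw_rcons => /rcons_inj[_]; rewrite Ptab_word_of // t3 => e1.
rewrite -(irow_lt b' y (Ptab_rsorted v1)) -Ptab_rcons ev hd -e1 ltnSn.
rewrite -(irow_lt b x (tab_rsorted t1)) t2 t3.
by rewrite ltnNge hd'.
Qed.

Lemma bisim_rw X u v : bisim X -> X u v -> rw u = rw v.
Proof.
elim/last_ind: u v X => [|u x IH] v X hX h.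
  by have := bisim_size hX h; move/esym/size0nil => ->.
case/lastP: v h => [|v y] h; first by have := bisim_size hX h; rewrite size_rcons.
have e : rw u = rw v.
  by apply: (IH v _ (bisim_prefix hX)); exists x, y.
rewrite !rw_rcons e; congr rcons; apply/eqP; rewrite eqn_leq.
by rewrite (bisim_irow_le hX h e) (bisim_irow_le (bisim_flip hX) h (esym e)).
Qed.

Lemma kmove_map g g' f k w : (forall x y, x \in w -> y \in w -> g (f x) (f y) = g' x y) ->
  kmove g k (map f w) = map f (kmove g' k w).
Proof.
move=> h; case: (kmoveP g' k w) => [[-> hk]|[p [a [b [c [q [<- ew ->]]]]]]].
  by rewrite kmove_short // size_map.
rewrite ew in h *; rewrite !map_cat /= -(size_map f p) kmove_split; congr (_ ++ (_ ++ _)).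
have [ia ib ic] : [/\ a \in p ++ [:: a, b, c & q], b \in p ++ [:: a, b, c & q] &
  c \in p ++ [:: a, b, c & q]] by split; rewrite mem_cat !inE eqxx ?orbT.
by rewrite /kt !h //; case: ifP => // _; case: ifP.
Qed.

Lemma rw_shift o w : rw (map (addn o) w) = rw w.
Proof.
pose X u v := u = map (addn o) v.
apply: (@bisim_rw X) => //; split=> [u v ->|u v i ->|u v k ->].
- by rewrite size_map.
- by rewrite size_map => hi; rewrite !(nth_map 0) ?(ltnW hi) // ltn_add2l.
- by apply: kmove_map => x y _ _; rewrite /gt2 ltn_add2l.
Qed.

(** * Reverse complementation preserves equality of recording sequences *)

(* Truncated subtraction: meaningful only for words with letters at most N. *)
Definition star (N : nat) (w : word) : word := rev (map (fun x => N - x) w).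

Lemma size_star N w : size (star N w) = size w.
Proof. by rewrite size_rev size_map. Qed.

Lemma starK N w : all (fun x => x <= N) w -> star N (star N w) = w.
Proof.
move=> h; rewrite /star map_rev revK -map_comp -[RHS]map_id; apply/eq_in_map => x hx /=.
by rewrite subKn // (allP h).
Qed.

Lemma star_le N w : all (fun x => x <= N) (star N w).
Proof. by rewrite /star all_rev all_map; apply/allP => x _ /=; apply: leq_subr. Qed.

Lemma star_kmove N k w : all (fun x => x <= N) w -> k + 2 < size w ->
  kmove gt2 k (star N w) = star N (kmove gt2 (size w - 3 - k) w).
Proof.
move=> hw hk; case: (kmoveP gt2 (size w - 3 - k) w) => [[_ h]|[p [a [b [c [q [hp ew ->]]]]]]]; first lia.
have hq : k = size (rev (map (fun x => N - x) q)).
  have := congr1 size ew; rewrite size_cat /= size_rev size_map; lia.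
have /and3P[ha hb hc] : [&& a <= N, b <= N & c <= N].
  by move: hw; rewrite ew all_cat /= => /and5P[_ -> -> -> _].
rewrite ew /star !map_cat /= !rev_cat !rev_cons -!cats1 -!catA /= hq kmove_split.
congr (_ ++ _); congr (_ ++ _).
rewrite /kt /gt2; case: (ltnP b a); case: (ltnP c b); case: (ltnP c a) => h1 h2 h3 /=;
 repeat (case: ifP => /=); move=> *; try done; lia.
Qed.

(** Reversing both positions and letters keeps descents, in mirrored position, and carries moves to
    moves; so the images of words with equal [rw] form a relation to which [bisim_rw] applies. *)
Lemma star_rw N N' u v : all (fun x => x <= N) u -> all (fun x => x <= N') v ->
  rw u = rw v -> rw (star N u) = rw (star N' v).
Proof.
pose X u' v' := exists u v, [/\ u' = star N u, v' = star N' v, all (fun x => x <= N) u,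
  all (fun x => x <= N') v & rw u = rw v].
move=> hu hv e; apply: (@bisim_rw X); last by exists u, v.
split=> [_ _ [{hu}u [{hv}v [-> -> _ _ {}e]]]|_ _ i [{hu}u [{hv}v [-> -> hu hv {}e]]]|_ _ k [{hu}u [{hv}v [-> -> hu hv {}e]]]].
- by rewrite !size_star (rw_size e).
- rewrite size_star => hi; have es := rw_size e.
  have H M w : all (fun x => x <= M) w -> i.+1 < size w ->
    (nth 0 (star M w) i.+1 < nth 0 (star M w) i) =
    (nth 0 w (size w - i.+2).+1 < nth 0 w (size w - i.+2)).
    move=> hw hi'; rewrite /star !nth_rev size_map ?(ltnW hi') //.
    have -> : size w - i.+1 = (size w - i.+2).+1 by lia.
    have h1 : (size w - i.+2).+1 < size w by lia.
    rewrite !(nth_map 0) //; last by lia.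
    have /= a1 := allP hw _ (mem_nth 0 h1); have /= a2 := allP hw _ (mem_nth 0 (ltnW h1)); lia.
  rewrite !H -?es //; apply: (bisim_desc bisim_rw_eq) => //; lia.
- case: (ltnP (k + 2) (size u)) => hk; last first.
    exists u, v; rewrite !kmove_short ?size_star -?(rw_size e); first (by split); lia.
  exists (kmove gt2 (size u - 3 - k) u), (kmove gt2 (size u - 3 - k) v).
  rewrite !star_kmove -?(rw_size e) //; split=> //.
  + by rewrite (perm_all _ (perm_kmove _ _ _)).
  + by rewrite (perm_all _ (perm_kmove _ _ _)).
  + by apply: (bisim_kmove bisim_rw_eq).
Qed.

(** * Reverse complement and substitution on a letter interval *)

Lemma star_knuth N u v : all (fun x => x <= N) u -> knuth_equiv u v ->
  knuth_equiv (star N u) (star N v).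
Proof.
move=> hu /knuth_kmoves[ks ->]; rewrite /kmoves.
elim: ks u hu => /= [|k ks IH] u hu; first exact: rst_refl.
apply: rst_trans (IH _ _); last by rewrite (perm_all _ (perm_kmove _ _ _)).
case: (ltnP (k + 2) (size u)) => hk; last by rewrite kmove_short; [exact: rst_refl|lia].
have := star_kmove hu (k := size u - 3 - k); rewrite (_ : _ - _ - (_ - _ - _) = k); last lia.
by move=> <-; [apply: rst_sym; exact: kmove_knuth|lia].
Qed.

(** The superstandard (Yamanouchi) tableau of shape [la] with smallest letter [o]; for constant [la]
    it is one of the tableaux Y_i. *)
Fixpoint ytab (o : nat) (la : seq nat) : tableau :=
  if la is m :: la' then nseq m o :: ytab o.+1 la' else [::].

Lemma shape_ytab o la : shape (ytab o la) = la.
Proof. by elim: la o => //= m la IH o; rewrite size_nseq IH. Qed.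

Lemma sorted_nseq m (o : nat) : sorted leq (nseq m o).
Proof. by case: m => //= m; elim: m => //= m ->; rewrite leqnn. Qed.

Lemma tab_ytab o la : all (fun m => 0 < m) la -> sorted geq la -> tab (ytab o la).
Proof.
elim: la o => // m la IH o /andP[h1 h2] h3.
rewrite -[ytab _ _]/(nseq m o :: ytab o.+1 la) tab_cons size_nseq h1 sorted_nseq IH ?(path_sorted h3) //= andbT.
apply/domP; case: la {IH h2} h3 => [|m' la] //= /andP[h3 _]; rewrite !size_nseq; split=> // j hj.
by rewrite !nth_nseq hj (leq_trans hj h3).
Qed.

Lemma tab_shape_sorted T : tab T -> sorted geq (shape T).
Proof. by rewrite -tab_is_tableau => /and4P[]. Qed.

Lemma foldl_ins_tab T w : tab T -> tab (foldl ins T w).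
Proof. by elim: w T => //= x w IH T hT; apply/IH/ins_tab. Qed.

Lemma shape_slide_le m r T : m <= size r -> all (leq m) (shape T) ->
  shape (slide m r T) = rcons (shape T) m.
Proof.
elim: T r => [|r1 T IH] r e /=; first by rewrite size_takel ?e.
by move=> /andP[h1 h2]; rewrite size_cat size_takel ?e // size_drop subnKC // IH.
Qed.

(** Each constant row is smaller than the whole first row of the current tableau and pushes as many
    columns down as it has letters; it is no longer than any row present, so the shape grows by a
    new last row. *)
Lemma shape_insert_ytab M o la T : tab T -> all (fun y => M - o < y) (head [::] T) ->
  all (fun m => 0 < m) la -> sorted geq (shape T ++ la) -> o + size la <= M ->
  shape (foldl ins T (flatten [seq map (fun x => M - x) r | r <- ytab o la])) = shape T ++ la.
Proof.
elim: la o T => [|m la IH] o T hT ha hp hs hM; first by rewrite /= cats0.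
rewrite [ytab _ _]/= map_cons [flatten _]/= foldl_cat map_nseq.
set r := nseq m (M - o).
have /andP[m0 hp'] := hp; have sr : size r = m by rewrite size_nseq.
have e : foldl ins T r = slide m r T.
  rewrite -{1}(take_size r) sr foldl_slide ?sr ?m0 ?leqnn //; first exact: sorted_nseq.
  by move=> j; rewrite sr => hj h; rewrite nth_nseq hj; apply: (all_nthP 0 ha).
have es : shape (foldl ins T r) = rcons (shape T) m.
  rewrite e shape_slide_le ?sr //.
  move: hs; rewrite sorted_pairwise; last by move=> x y z h1 h2; apply: leq_trans h2 h1.
  rewrite pairwise_cat => /and3P[+ _ _]; rewrite allrel_consr => /andP[+ _].
  by apply: sub_all.
rewrite IH ?foldl_ins_tab // ?es ?cat_rcons //; last by rewrite addSn -addnS.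
have hlt : M - o.+1 < M - o by move: hM; rewrite /=; lia.
rewrite e; case: T ha {hT e es hs} => [|r1 T] ha /=.
  by apply/allP => y /mem_take /nseqP[-> _].
rewrite all_cat; apply/andP; split; first by apply/allP => y /mem_take /nseqP[-> _].
by apply/allP => y /mem_drop hy; apply: ltn_trans hlt _; apply: (allP ha).
Qed.

Lemma star_word_of N T : star N (word_of T) = flatten [seq rev (map (fun x => N - x) r) | r <- T].
Proof.
elim: T => // r T IH.
by rewrite word_of_cons /star map_cat rev_cat -/(star N (word_of T)) IH.
Qed.

Lemma exists_le (w : seq nat) : exists N, all (fun x => x <= N) w.
Proof.
have [M [_ h]] := ex_below [::] w; exists M.
by apply: sub_all h => y; apply: ltnW.
Qed.

Lemma sub_all_le N N' (w : seq nat) : N <= N' -> all (fun x => x <= N) w -> all (fun x => x <= N') w.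
Proof. by move=> h; apply: sub_all => y h'; apply: leq_trans h' h. Qed.

(** By [star_rw] the left side depends on [rw w] only, so [w] may be replaced by a word with
    superstandard insertion tableau, for which the shape is computed directly. *)
Lemma shape_star N w : all (fun x => x <= N) w -> shape (Ptab (star N w)) = shape (Ptab w).
Proof.
move=> hw; set la := shape (Ptab w).
have hT := Ptab_tab w.
have hY : tab (ytab 1 la) by apply: tab_ytab; [apply: tab_shape_pos|apply: tab_shape_sorted].
have [y [e1 e2]] := rsk_surj hY (shape_ytab 1 la).
have [M0 hM0] := exists_le y.
(* The second summand keeps the letters [M - 1], [M - 2], ... strictly decreasing under truncated
   subtraction. *)
pose M := M0 + (size la).+1; have hM : all (fun x => x <= M) y by apply: sub_all_le hM0; rewrite /M; lia.
rewrite (rw_shape (star_rw hw hM (esym e2))).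
have := knuth_word_Ptab y; rewrite e1 => hk.
rewrite (knuth_Ptab (star_knuth hM hk)) star_word_of PtabE.
have -> : [seq rev [seq M - x | x <- r] | r <- ytab 1 la] = [seq [seq M - x | x <- r] | r <- ytab 1 la].
  elim: (la) 1 => //= m l IH o; rewrite IH; congr cons.
  rewrite map_nseq; apply: (@eq_from_nth _ 0); rewrite size_rev // => j.
  by rewrite size_nseq => hj; rewrite nth_rev size_nseq // !nth_nseq hj; case: ifP => //; lia.
rewrite shape_insert_ytab //; first exact: tab_shape_pos.
- exact: tab_shape_sorted.
- by rewrite /M; lia.
Qed.

Lemma star_cons N x v : star N (x :: v) = rcons (star N v) (N - x).
Proof. by rewrite /star /= rev_cons. Qed.

Lemma star_cat N u v : star N (u ++ v) = star N v ++ star N u.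
Proof. by rewrite /star map_cat rev_cat. Qed.

(** This takes the place of column insertion: a front letter is the last letter of the reverse
    complement. *)
Lemma shape_cons N x v : all (fun y => y <= N) (x :: v) ->
  shape (Ptab (x :: v)) = incr_nth (shape (Ptab v)) (irow (Ptab (star N v)) (N - x)).
Proof.
move=> h; rewrite -(shape_star h) star_cons Ptab_rcons size_ins; congr incr_nth.
by rewrite shape_star //; case/andP: h.
Qed.

Lemma rw_star_inj N N' u v : all (fun x => x <= N) u -> all (fun x => x <= N') v ->
  rw (star N u) = rw (star N' v) -> rw u = rw v.
Proof.
by move=> hu hv /(star_rw (star_le N u) (star_le N' v)); rewrite !starK.
Qed.

Lemma rw_cons_eq x v x' v' : rw v = rw v' -> shape (Ptab (x :: v)) = shape (Ptab (x' :: v')) ->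
  rw (x :: v) = rw (x' :: v').
Proof.
move=> e es; have [N hN] := exists_le (x :: v); have [N' hN'] := exists_le (x' :: v').
apply: (rw_star_inj hN hN'); rewrite !star_cons !rw_rcons.
have /andP[_ hv] := hN; have /andP[_ hv'] := hN'.
rewrite (star_rw hv hv' e); congr rcons.
by move: es; rewrite (shape_cons hN) (shape_cons hN') (rw_shape e); apply: incr_nth_injr.
Qed.

Lemma rw_rcons_eq x v x' v' : rw v = rw v' -> shape (Ptab (rcons v x)) = shape (Ptab (rcons v' x')) ->
  rw (rcons v x) = rw (rcons v' x').
Proof.
move=> e; rewrite !Ptab_rcons !size_ins !rw_rcons e (rw_shape e) => /incr_nth_injr.
by move=> ->.
Qed.

Lemma rw_gt2 s x y t s' x' y' t' : size s = size s' ->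
  rw (s ++ x :: y :: t) = rw (s' ++ x' :: y' :: t') -> gt2 x y = gt2 x' y'.
Proof.
move=> es e; have := bisim_desc bisim_rw_eq (i := size s) e.
have -> : (size s).+1 < size (s ++ x :: y :: t) by rewrite size_cat /=; lia.
move=> /(_ isT); rewrite !nth_cat -es ltnn subnn subSnn.
by have -> : ((size s).+1 < size s) = false by lia.
Qed.

(** * Replacing the subword on an interval of letters *)

Section Substitution.
Variable B : pred nat.

Definition convex : Prop := forall x y z, x <= y <= z -> B x -> B z -> B y.

Definition agree (u v : word) : bool :=
  all2 (fun x y => (B x == B y) && (B x || (x == y))) u v.

Definition subst_rw (u v : word) : Prop := agree u v /\ rw (filter B u) = rw (filter B v).

Lemma agree_size u v : agree u v -> size u = size v.
Proof. by rewrite /agree all2E => /andP[/eqP]. Qed.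

Lemma agree_cat u1 u2 v1 v2 : size u1 = size v1 ->
  agree (u1 ++ u2) (v1 ++ v2) = agree u1 v1 && agree u2 v2.
Proof.
by elim: u1 v1 => [|x u1 IH] [|y v1] //= [e]; rewrite IH // andbA.
Qed.

Lemma agree_filter_size u v : agree u v -> size (filter B u) = size (filter B v).
Proof.
elim: u v => [|x u IH] [|y v] //= /andP[/andP[/eqP <- _] /IH h].
by case: (B x) => //=; rewrite h.
Qed.

Lemma agree_split p a b c q v : agree (p ++ a :: b :: c :: q) v ->
  exists p' a' b' c' q', [/\ v = p' ++ a' :: b' :: c' :: q', size p' = size p,
    agree p p', agree [:: a; b; c] [:: a'; b'; c'] & agree q q'].
Proof.
move=> h; have hs := agree_size h; move: h.
have e1 : size (take (size p) v) = size p by rewrite size_takel // -hs size_cat leq_addr.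
rewrite -{1}(cat_take_drop (size p) v) agree_cat // => /andP[h1 h2].
case e2: (drop (size p) v) h2 => [|a' [|b' [|c' q']]]; rewrite /agree /= ?andbF //.
move=> /and4P[ha hb hc hq].
exists (take (size p) v), a', b', c', q'; rewrite -e2 cat_take_drop; split=> //.
by rewrite /agree /= ha hb hc.
Qed.

Lemma convex_lt a b b' : convex -> ~~ B a -> B b -> B b' -> (b < a) = (b' < a) /\ (a < b) = (a < b').
Proof.
move=> hB ha hb hb'.
have n1 : ~ (b <= a <= b') by move=> h; move: ha; rewrite (hB _ _ _ h hb hb').
have n2 : ~ (b' <= a <= b) by move=> h; move: ha; rewrite (hB _ _ _ h hb' hb).
lia.
Qed.

Lemma filter_all_true (s : word) : all B s -> filter B s = s.
Proof. by move/all_filterP. Qed.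

Lemma all_kt g a b c : all B (kt g a b c) = all B [:: a; b; c].
Proof. exact: (perm_all _ (perm_kt g a b c)). Qed.

Lemma agree_all u v : agree u v -> all B u = all B v.
Proof. by elim: u v => [|x u IH] [|y v] //= /andP[/andP[/eqP -> _] /IH ->]. Qed.

Lemma all_agree u v : size u = size v -> all B u -> all B v -> agree u v.
Proof. by elim: u v => [|x u IH] [|y v] //= [e] /andP[-> h1] /andP[-> h2]; apply: IH. Qed.

(** A move exchanges two letters in the presence of a third one weakly between them. If the two were
    in [B], so would be the third; hence a move not inside [B] leaves the [B]-subword alone. *)
Lemma filter_kt a b c : convex -> ~~ all B [:: a; b; c] ->
  filter B (kt gt2 a b c) = filter B [:: a; b; c].
Proof.
move=> hB; rewrite /kt /gt2.
have key x y z : B x -> B z -> B y = false -> ~ (x <= y <= z).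
  by move=> hx hz hy h; move: hy; rewrite (hB _ _ _ h hx hz).
case: ifP => // h1; case: ifP => h2 /=; case Ea: (B a); case Eb: (B b); case Ec: (B c) => //= _.
- have := key a c b Ea Eb Ec; have := key b c a Eb Ea Ec; lia.
- have := key b a c Eb Ec Ea; have := key c a b Ec Eb Ea; lia.
Qed.

Lemma filter_kmove k w : convex ->
  filter B (kmove gt2 k w) = filter B w \/ exists k', filter B (kmove gt2 k w) = kmove gt2 k' (filter B w).
Proof.
move=> hB; case: (kmoveP gt2 k w) => [[-> _]|[p [a [b [c [q [_ -> ->]]]]]]]; first by left.
case E: (all B [:: a; b; c]).
  right; exists (size (filter B p)); rewrite !filter_cat (filter_all_true (s := kt _ _ _ _)) ?all_kt //.
  rewrite -[a :: b :: c :: q]/([:: a; b; c] ++ q) filter_cat (filter_all_true E) /=.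
  by rewrite kmove_split.
left; rewrite !filter_cat filter_kt ?E //.
by rewrite -[a :: b :: c :: q]/([:: a; b; c] ++ q) filter_cat.
Qed.

Lemma knuth_filter u v : convex -> knuth_equiv u v -> knuth_equiv (filter B u) (filter B v).
Proof.
move=> hB /knuth_kmoves[ks ->]; rewrite /kmoves.
elim: ks u => /= [|k ks IH] u; first exact: rst_refl.
apply: rst_trans (IH _); apply: rst_sym.
by case: (filter_kmove k u hB) => [->|[k' ->]]; [exact: rst_refl|exact: kmove_knuth].
Qed.

Lemma agree_gt2 a a' b b' : convex -> (B a == B a') && (B a || (a == a')) ->
  (B b == B b') && (B b || (b == b')) -> ~~ (B a && B b) -> gt2 a b = gt2 a' b'.
Proof.
move=> hB /andP[/eqP ea oa] /andP[/eqP eb ob]; rewrite /gt2.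
case Ea: (B a) oa; case Eb: (B b) ob => //= ob oa _.
- rewrite -(eqP ob); have := @convex_lt b a a' hB; rewrite Eb Ea -ea Ea => /(_ isT isT isT) [_ ->] //.
- rewrite -(eqP oa); have := @convex_lt a b b' hB; rewrite Eb Ea -eb Eb => /(_ isT isT isT) [-> _] //.
- by rewrite (eqP oa) (eqP ob).
Qed.

(** A move on three letters of [B] is a move of the [B]-subwords. Otherwise all comparisons inside
    the triple agree in both words: two letters of [B] are neighbours in the subwords, where
    descents agree, and a letter outside an interval compares alike with all its members. *)
Lemma bisim_subst : convex -> bisim subst_rw.
Proof.
move=> hB; split.
- by move=> u v [/agree_size].
- move=> u v i [h1 h2] hi; have es := agree_size h1.
  have hi' : i.+1 < size v by rewrite -es.
  rewrite -(cat_take_drop i u) -(cat_take_drop i v) in h1 h2.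
  have e1 : size (take i u) = size (take i v) by rewrite !size_takel; lia.
  rewrite agree_cat // in h1; case/andP: h1 => h1.
  rewrite (drop_nth 0 (ltnW hi)) (drop_nth 0 hi) (drop_nth 0 (ltnW hi')) (drop_nth 0 hi') in h2 *.
  set x := nth 0 u i in h2 *; set y := nth 0 u i.+1 in h2 *.
  set x' := nth 0 v i in h2 *; set y' := nth 0 v i.+1 in h2 *.
  rewrite -/(gt2 x y) -/(gt2 x' y') => /and3P[hx hy _].
  case E: (B x && B y); last by apply: agree_gt2 => //; rewrite E.
  have [/andP[/eqP ex _] /andP[/eqP ey _]] := (hx, hy).
  move: E h2; rewrite !filter_cat /= -ex -ey => /andP[-> ->]; apply: rw_gt2.
  exact: agree_filter_size.
- move=> u v k [h1 h2].
  case: (kmoveP gt2 k u) => [[e hk]|[p [a [b [c [q [hp eu ->]]]]]]].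
    by rewrite e kmove_short -?(agree_size h1).
  rewrite eu in h1 h2; have [p' [a' [b' [c' [q' [ev hp' a1 a2 a3]]]]]] := agree_split h1.
  rewrite ev in h1 h2 *; rewrite -hp -hp' kmove_split.
  have ef (s t : word) x y z : filter B (s ++ x :: y :: z :: t) = filter B s ++ filter B [:: x; y; z] ++ filter B t.
    by rewrite -[x :: _]/([:: x; y; z] ++ t) !filter_cat.
  rewrite !ef in h2; rewrite /subst_rw !filter_cat !agree_cat ?size_kt // a1 a3 andbT /=.
  case E: (all B [:: a; b; c]).
    have E' : all B [:: a'; b'; c'] by rewrite -(agree_all a2).
    split; first by apply: all_agree; rewrite ?all_kt // !size_kt.
    rewrite !(filter_all_true (s := kt _ _ _ _)) ?all_kt //.
    rewrite (filter_all_true E) (filter_all_true E') /= in h2.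
    rewrite -!kmove_split (agree_filter_size a1); exact: (bisim_kmove bisim_rw_eq).
  have E' : ~~ all B [:: a'; b'; c'] by rewrite -(agree_all a2) E.
  rewrite !filter_kt ?E //; split=> //.
  have /= /and4P[ha hb hc _] := a2.
  have D : [/\ gt2 a b = gt2 a' b', gt2 b c = gt2 b' c' & gt2 a c = gt2 a' c'].
    have es := agree_filter_size a1.
    have [/andP[/eqP ea _] [/andP[/eqP eb _] /andP[/eqP ec _]]] := (ha, (hb, hc)).
    move: E h2; rewrite /= -ea -eb -ec; case Ea: (B a); case Eb: (B b); case Ec: (B c) => //= _ h2; split;
     first [by apply: (agree_gt2 hB ha hb); rewrite ?Ea ?Eb ?Ec | by apply: (agree_gt2 hB hb hc); rewrite ?Ea ?Eb ?Ec
       | by apply: (agree_gt2 hB ha hc); rewrite ?Ea ?Eb ?Ec | exact: rw_gt2 es h2].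
  case: D => d1 d2 d3; rewrite /kt d1 d2 d3.
  by case: ifP => _; [|case: ifP => _]; rewrite /agree /= ?ha ?hb ?hc.
Qed.
End Substitution.

(** * Parenthesis matching *)

Lemma kmove_catl g k u v : k + 2 < size u -> kmove g k (u ++ v) = kmove g k u ++ v.
Proof.
move=> hk; case: (kmoveP g k u) => [[_ h]|[p [a [b [c [q [<- -> ->]]]]]]]; first by lia.
by rewrite -!catA /= kmove_split.
Qed.

Lemma kmove_catr g k u v : kmove g (size u + k) (u ++ v) = u ++ kmove g k v.
Proof.
case: (kmoveP g k v) => [[-> h]|[p [a [b [c [q [<- -> ->]]]]]]].
  by rewrite kmove_short // size_cat; lia.
by rewrite catA -size_cat kmove_split -catA.
Qed.

Lemma kmove_catr1 g a x b m :
  kmove g (size a + m.+1) (a ++ x :: b) = a ++ x :: kmove g m b.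
Proof.
have -> : size a + m.+1 = size (rcons a x) + m by rewrite size_rcons addSnnS.
by rewrite -!cat_rcons kmove_catr.
Qed.

(* Letters r.+1 open and letters r close; None records an unmatched r. *)
Definition bstep (r : nat) (d : option nat) (x : nat) : option nat :=
  if d is Some d then
    if x == r.+1 then Some d.+1
    else if x == r then (if d is d'.+1 then Some d' else None) else Some d
  else None.

Definition brun (r : nat) : option nat -> word -> option nat := foldl (bstep r).

Definition bal (r : nat) (w : word) : bool := brun r (Some 0) w == Some 0.

Lemma brun_cat r d u v : brun r d (u ++ v) = brun r (brun r d u) v.
Proof. exact: foldl_cat. Qed.

Lemma brun_cons r d x w : brun r d (x :: w) = brun r (bstep r d x) w.
Proof. by []. Qed.

Lemma brun_None r w : brun r None w = None.
Proof. by elim: w. Qed.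

Lemma brun_neutral r d x : x != r -> x != r.+1 -> bstep r d x = d.
Proof. by case: d => //= d /negPf-> /negPf->. Qed.

Lemma bstep_swap r d x y : [|| (x != r) && (x != r.+1), (y != r) && (y != r.+1) | x == y] ->
  bstep r (bstep r d x) y = bstep r (bstep r d y) x.
Proof.
case/or3P=> [/andP[h1 h2]|/andP[h1 h2]|/eqP->] //; by rewrite !(brun_neutral _ h1 h2).
Qed.

(** Steps commute unless the exchanged letters are [r] and [r.+1]. Then the third letter is [r] if
    it follows them and [r.+1] if it precedes them, and both orders end at the same depth. *)
Lemma brun_kt r d a b c : brun r d (kt gt2 a b c) = brun r d [:: a; b; c].
Proof.
case: d => [d|]; last by rewrite !brun_None.
have n : (r == r.+1) = false by lia.
have B3 x y z : brun r (Some d) [:: x; y; z] = bstep r (bstep r (bstep r (Some d) x) y) z by [].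
rewrite /kt; case: ifP => // h1; case: ifP => h2; rewrite !B3.
- have [h|h3] := boolP [|| (a != r) && (a != r.+1), (b != r) && (b != r.+1) | a == b].
    by rewrite (bstep_swap _ h).
  have e : c = r /\ ((a = r /\ b = r.+1) \/ (a = r.+1 /\ b = r)).
    by move: h1 h2 h3; rewrite /gt2; lia.
  by case: e => -> [[-> ->]|[-> ->]]; case: d {B3} => [|d]; rewrite /= ?eqxx ?n /= ?eqxx ?n /= ?eqxx ?n.
- have [h|h3] := boolP [|| (b != r) && (b != r.+1), (c != r) && (c != r.+1) | b == c].
    by rewrite (bstep_swap _ h).
  have e : a = r.+1 /\ ((b = r /\ c = r.+1) \/ (b = r.+1 /\ c = r)).
    by move: h1 h2 h3; rewrite /gt2; lia.
  by case: e => -> [[-> ->]|[-> ->]]; rewrite /= ?eqxx ?n /= ?eqxx ?n /= ?eqxx ?n.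
Qed.

Lemma brun_kmove r d k w : brun r d (kmove gt2 k w) = brun r d w.
Proof.
case: (kmoveP gt2 k w) => [[-> //]|[p [a [b [c [q [_ -> ->]]]]]]].
by rewrite !brun_cat brun_kt -!brun_cat.
Qed.

Lemma bal_knuth r u v : knuth_equiv u v -> bal r u = bal r v.
Proof.
case/knuth_kmoves=> ks ->; rewrite /kmoves; elim: ks u => //= k ks IH u.
by rewrite -IH /bal brun_kmove.
Qed.

Lemma bal_cons_neq r x w : bal r (x :: w) -> x != r.
Proof.
rewrite /bal brun_cons /=; case: (eqVneq x r) => // ->.
by rewrite (ltn_eqF (ltnSn r)) brun_None.
Qed.

Lemma bal_rcons_neq r x w : bal r (rcons w x) -> x != r.+1.
Proof.
rewrite /bal -cats1 brun_cat brun_cons /=; case: (brun r _ w) => //= d.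
by case: (eqVneq x r.+1).
Qed.

Lemma bal_cat r u v : bal r u -> bal r v -> bal r (u ++ v).
Proof. by rewrite /bal brun_cat => /eqP ->. Qed.

Lemma bal_neutral_cons r x w : x != r -> x != r.+1 -> bal r (x :: w) = bal r w.
Proof. by move=> h1 h2; rewrite /bal brun_cons brun_neutral. Qed.

Lemma bal_neutral_rcons r x w : x != r -> x != r.+1 -> bal r (rcons w x) = bal r w.
Proof. by move=> h1 h2; rewrite /bal -cats1 brun_cat brun_cons brun_neutral. Qed.

Lemma bal_swap r p x y q : [|| (x != r) && (x != r.+1), (y != r) && (y != r.+1) | x == y] ->
  bal r (p ++ x :: y :: q) = bal r (p ++ y :: x :: q).
Proof. by move=> h; rewrite /bal !brun_cat !brun_cons (bstep_swap _ h). Qed.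

Lemma bal_pair r b : bal r (r.+1 :: r :: b) = bal r b.
Proof. by rewrite /bal !brun_cons /= !eqxx /= (ltn_eqF (ltnSn r)) eqxx. Qed.

(** The crystal raising operator on a word whose only unmatched letter is one [r.+1]; on such a word
    [s_r] does the same. *)
Definition raising (r : nat) (u v : word) : Prop :=
  exists a b, [/\ bal r a, bal r b, u = a ++ r.+1 :: b & v = a ++ r :: b].

(** Balancedness forbids [r] right after the distinguished letter and [r.+1] right before it, so its
    comparisons with its neighbours do not depend on whether it is [r] or [r.+1]. The exception is a
    triple formed with an adjacent matched pair [r.+1], [r]: there the two moves differ, but both
    let the distinguished letter pass to the other side of the pair. *)
Lemma raising_kmove r u v k : raising r u v -> raising r (kmove gt2 k u) (kmove gt2 k v).
Proof.
case=> a [b [ha hb -> ->]].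
have nr : (r == r.+1) = false by lia.
case: (ltnP (k + 2) (size a)) => hk1.
  exists (kmove gt2 k a), b; rewrite !kmove_catl //; split=> //.
  by rewrite /bal brun_kmove.
case: (ltnP (size a) k) => hk2.
  have -> : k = size a + (k - size a).-1.+1 by lia.
  exists a, (kmove gt2 (k - size a).-1 b); rewrite !kmove_catr1; split=> //.
  by rewrite /bal brun_kmove.
have [/eqP ek|n1] := boolP (k == size a).
  rewrite ek -(addn0 (size a)) !kmove_catr.
  case: b hb => [|b1 [|b2 b]] hb; try by exists a; eexists; split; last reflexivity.
  have n1 := bal_cons_neq hb.
  rewrite /kmove /=.
  case: (eqVneq b2 r) => [e2|n2].
    have e1 : b1 = r.+1.
      move: hb; rewrite /bal !brun_cons e2 /= (negPf n1).
      by case: (eqVneq b1 r.+1) => //= _; rewrite nr eqxx brun_None.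
    exists (a ++ [:: r.+1; r]), b; rewrite e1 e2 -!catA; split.
    - by apply: bal_cat => //; rewrite bal_pair.
    - by move: hb; rewrite e1 e2 bal_pair.
    - by rewrite /kt /gt2 ltnn ltnSn.
    - by rewrite /kt /gt2 ltnn ltnSn ltnNge leqnSn.
  have eg1 : gt2 r.+1 b1 = gt2 r b1 by rewrite /gt2; lia.
  have eg2 : gt2 r.+1 b2 = gt2 r b2 by rewrite /gt2; lia.
  rewrite /kt eg1 eg2; case: ifP => h1; first by exists a, [:: b1, b2 & b].
  case: ifP => h2.
    have n3 : b1 != r.+1 by move: h1 h2 eg1 eg2; rewrite /gt2; lia.
    exists (rcons a b1), (b2 :: b); rewrite bal_neutral_rcons // !cat_rcons; split=> //.
    by rewrite -(bal_neutral_cons _ n1 n3).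
  exists a, [:: b2, b1 & b]; split=> //.
  rewrite -(@bal_swap r [::] b1 b2) //; move: h1 h2 eg1 eg2 n1 n2; rewrite /gt2; lia.
case/lastP: a ha hk1 hk2 n1 => [|a p] ha; first by rewrite /=; lia.
rewrite size_rcons => hk1 hk2 n1.
have np := bal_rcons_neq ha.
have [/eqP ek|n2] := boolP (k == size a).
  rewrite ek !cat_rcons -(addn0 (size a)) !kmove_catr.
  case: b hb => [|b1 b] hb; first by exists (rcons a p), [::]; rewrite !cat_rcons.
  have nb := bal_cons_neq hb; rewrite /kmove /=.
  have eg1 : gt2 p r.+1 = gt2 p r by rewrite /gt2; lia.
  have eg2 : gt2 r.+1 b1 = gt2 r b1 by rewrite /gt2; lia.
  rewrite /kt eg1 eg2; case: ifP => h1; first by exists (rcons a p), (b1 :: b); rewrite !cat_rcons.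
  case: ifP => h2.
    have np' : p != r by move: h1 h2 eg1 eg2; rewrite /gt2; lia.
    exists a, [:: p, b1 & b]; rewrite (bal_neutral_cons _ np' np); split=> //.
    by rewrite -(bal_neutral_rcons a np' np).
  have nb' : b1 != r.+1 by move: h1 h2 eg1 eg2 np nb; rewrite /gt2; lia.
  exists (rcons (rcons a p) b1), b; rewrite bal_neutral_rcons // !cat_rcons; split=> //.
  by rewrite -(bal_neutral_cons _ nb nb').
case/lastP: a ha hk1 hk2 n1 n2 => [|a p'] ha; first by rewrite /=; lia.
rewrite size_rcons => hk1 hk2 n1 n2.
have ek : k = size a by lia.
rewrite ek !cat_rcons -(addn0 (size a)) !kmove_catr /kmove /=.
case: (eqVneq p' r.+1) => [e1|np'].
  have bs : bstep r (bstep r (brun r (Some 0) a) r.+1) p = Some 0.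
    by move: ha; rewrite /bal -!cats1 !brun_cat !brun_cons e1 => /eqP.
  have e2 : p = r.
    move: bs; case: (brun r (Some 0) a) => //= d; rewrite eqxx /= (negPf np).
    by case: (eqVneq p r).
  have ha' : bal r a.
    move: bs; rewrite /bal e2; case: (brun r (Some 0) a) => //= d; rewrite eqxx /= nr eqxx.
    by case=> ->.
  exists a, [:: r.+1, r & b]; rewrite e1 e2; split=> //.
  - by rewrite bal_pair.
  - by rewrite /kt /gt2 ltnn ltnSn ltnNge leqnSn.
  - by rewrite /kt /gt2 ltnn ltnSn.
have eg1 : gt2 p r.+1 = gt2 p r by rewrite /gt2; lia.
have eg2 : gt2 p' r.+1 = gt2 p' r by rewrite /gt2; lia.
rewrite /kt eg1 eg2; case: ifP => h1; first by exists (rcons (rcons a p') p), b; rewrite !cat_rcons.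
case: ifP => h2.
  exists (rcons (rcons a p) p'), b; rewrite !cat_rcons; split=> //.
  move: ha; rewrite -!cats1 -!catA (@bal_swap r a) //.
  move: h1 h2 eg1 eg2; rewrite /gt2; lia.
have np2 : p != r by move: h1 h2 eg1 eg2; rewrite /gt2; lia.
exists (rcons a p'), (p :: b); rewrite bal_neutral_cons // !cat_rcons; split=> //.
by rewrite -(bal_neutral_rcons _ np2 np).
Qed.

Lemma bisim_raising r : bisim (raising r).
Proof.
split=> [u v [a [b [_ _ -> ->]]]|u v i [a [b [ha hb -> ->]]] hi|u v k]; last exact: raising_kmove.
  by rewrite !size_cat.
rewrite !nth_cat; case: (ltnP i.+1 (size a)) => h1; first by rewrite (ltnW h1).
case: (ltnP i (size a)) => h2.
  have e : i = (size a).-1 by lia.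
  have -> : i.+1 - size a = 0 by lia.
  case/lastP: a {hi h1} ha h2 e => [|a p] ha; rewrite ?size_rcons // => h2 /= ->.
  by have := bal_rcons_neq ha; rewrite nth_rcons ltnn eqxx; lia.
rewrite subSn //; case e: (i - size a) => [|m] //=.
case: b hb hi => [|b1 b] hb hi; first by move: hi; rewrite size_cat /=; lia.
by have := bal_cons_neq hb; rewrite /=; lia.
Qed.

Lemma raising_rw r u v : raising r u v -> rw u = rw v.
Proof. exact: bisim_rw (bisim_raising r). Qed.

Lemma raising_kmoves r u v ks : raising r u v -> raising r (kmoves u ks) (kmoves v ks).
Proof. exact: bisim_kmoves (bisim_raising r). Qed.

(** * Lattice words and rectangles *)

(* The lattice condition, read from the right, for the letters above o. *)
Definition yam (o : nat) (w : word) : Prop :=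
  forall j r, o < r -> count_mem r.+1 (drop j w) <= count_mem r (drop j w).

Lemma yam_suffix o u v : yam o (u ++ v) -> yam o v.
Proof. by move=> h j r hr; have := h (size u + j) r hr; rewrite addnC -drop_drop drop_size_cat. Qed.

Lemma yam_count o w r : yam o w -> o < r -> count_mem r.+1 w <= count_mem r w.
Proof. by move=> h hr; have := h 0 r hr; rewrite drop0. Qed.

Lemma yam_cat o u v : yam o v -> (forall j r, j <= size u -> o < r ->
  count_mem r.+1 (drop j u ++ v) <= count_mem r (drop j u ++ v)) -> yam o (u ++ v).
Proof.
move=> hv hu j r hr; rewrite drop_cat; case: ltnP => h; first exact/hu/hr/ltnW.
exact: hv.
Qed.

Lemma yam_kmove o k w : yam o w -> yam o (kmove gt2 k w).
Proof.
case: (kmoveP gt2 k w) => [[-> //]|[p [a [b [c [q [_ -> ->]]]]]]] h.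
have hq : yam o q by apply: yam_suffix (p ++ [:: a; b; c]) _ _; rewrite -catA.
have h1 : yam o (a :: b :: c :: q) by apply: yam_suffix h.
have h2 : yam o (b :: c :: q) by apply: (@yam_suffix o [:: a]).
have h3 : yam o (c :: q) by apply: (@yam_suffix o [:: b]).
have hp s : perm_eq s (a :: b :: c :: q) -> forall j r, j <= size p -> o < r ->
  count_mem r.+1 (drop j p ++ s) <= count_mem r (drop j p ++ s).
  move=> hs j r hj hr; rewrite !count_cat !(permP hs) -!count_cat.
  have -> : drop j p ++ [:: a, b, c & q] = drop j (p ++ [:: a, b, c & q]).
    rewrite drop_cat; case: ltnP => // hj'; have -> : j = size p by lia.
    by rewrite drop_size subnn drop0.
  exact: h.
apply: yam_cat; last by apply: hp; rewrite (perm_cat2r q (kt gt2 a b c) [:: a; b; c]) perm_kt.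
have step x s : yam o s -> (forall r, o < r -> count_mem r.+1 (x :: s) <= count_mem r (x :: s)) -> yam o (x :: s).
  move=> hs hx; apply: (@yam_cat o [:: x]) => // -[|[|j]] r //= _ hr; last exact: yam_count hs hr.
  exact: hx.
have P1 r := yam_count (r := r) h1; have P2 r := yam_count (r := r) h2.
have P3 r := yam_count (r := r) h3; have P4 r := yam_count (r := r) hq.
rewrite /kt /gt2; case: ifP => // e1; case: ifP => e2 /=.
- apply: (step); last first.
    by move=> r hr; have := P1 r hr; rewrite /=; lia.
  apply: (step) => // r hr; have := P1 r hr; have := P2 r hr; have := P3 r hr; have := P4 r hr.
  by rewrite /=; lia.
- apply: (step); last first.
    by move=> r hr; have := P1 r hr; rewrite /=; lia.
  apply: (step); last by move=> r hr; have := P2 r hr; rewrite /=; lia.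
  apply: (step) => // r hr; have := P1 r hr; have := P2 r hr; have := P3 r hr; have := P4 r hr.
  by rewrite /=; lia.
Qed.

Lemma yam_knuth o u v : knuth_equiv u v -> yam o u -> yam o v.
Proof.
case/knuth_kmoves=> ks ->; rewrite /kmoves; elim: ks u => //= k ks IH u h.
by apply: IH; apply: yam_kmove.
Qed.

(** As [tab], but with empty rows allowed: restricting a tableau to a set of letters may empty rows,
    and row indices must be kept. *)
Fixpoint qtab (T : tableau) : bool :=
  if T is r :: T' then [&& sorted leq r, dom r (head [::] T') & qtab T'] else true.

Lemma tab_qtab T : tab T -> qtab T.
Proof. by elim: T => //= r T IH /and4P[_ -> -> /IH]. Qed.

(** The last letter of the top row ends the reading word and is maximal in its row; the lattice
    condition makes it [o.+1], so the row is constant. Column-strictness then raises the bound for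
    the rows below. *)
Lemma yam_rows o T : qtab T -> all (fun y => o < y) (head [::] T) -> yam o (word_of T) ->
  T = ytab o.+1 (shape T).
Proof.
elim: T o => //= r T IH o /and3P[h1 h2 h3] ho; rewrite word_of_cons => hy.
have hr : r = nseq (size r) o.+1.
  have hyr := yam_suffix hy.
  case/lastP: r h1 ho hyr {h2 hy} => // r l h1 ho hyr.
  have el : l = o.+1.
    have ol : o < l by apply: (allP ho); rewrite mem_rcons inE eqxx.
    apply/eqP; rewrite eqn_leq ol andbT leqNgt; apply/negP => hl.
    have := hyr (size r) l.-1; rewrite -cats1 drop_size_cat // (prednK (leq_ltn_trans (leq0n _) ol)) /= eqxx.
    lia.
  apply/all_pred1P/allP => y; rewrite mem_rcons inE => hy'.
  have h4 : o < y by apply: (allP ho); rewrite mem_rcons.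
  rewrite /= eqn_leq h4 andbT -el; case/orP: hy' => [/eqP->//|hy'].
  move: h1; rewrite (sorted_pairwise leq_trans) -cats1 pairwise_cat allrel1r => /and3P[h1 _ _].
  exact: (allP h1).
rewrite {1}hr; congr cons; apply: IH => //.
  apply/(all_nthP 0) => j hj; have /domP[d1 d2] := h2; have := d2 j hj.
  by rewrite hr nth_nseq (leq_trans hj d1).
move=> j s hs; case: (ltnP j (size (word_of T))) => hj; last by rewrite drop_oversize.
have := hy j s (ltnW hs); rewrite drop_cat hj !count_cat hr !count_nseq /=.
have -> : (o.+1 == s.+1) = false by lia.
have -> : (o.+1 == s) = false by lia.
by rewrite !mul0n !addn0.
Qed.

Lemma count_ytab_lt o o' la : o < o' -> count_mem o (word_of (ytab o' la)) = 0.
Proof.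
elim: la o' => //= m la IH o' ho.
by rewrite word_of_cons count_cat count_nseq IH 1?ltnW //= (gtn_eqF ho).
Qed.

Lemma count_ytab o la k : count_mem (o + k) (word_of (ytab o la)) = nth 0 la k.
Proof.
elim: la o k => [|m la IH] o k; first by rewrite nth_nil.
rewrite /= word_of_cons count_cat count_nseq /=; case: k => [|k] /=.
  rewrite addn0 eqxx mul1n.
  by rewrite count_ytab_lt.
rewrite -(IH o.+1 k) addSnnS; have -> : (o == o + k.+1) = false by lia.
by rewrite mul0n addn0.
Qed.

Lemma yam_Ptab w : yam 0 w -> all (fun x => 0 < x) w -> Ptab w = ytab 1 (shape (Ptab w)).
Proof.
move=> h hp; apply: yam_rows; first exact/tab_qtab/Ptab_tab.
  have := knuth_perm (knuth_word_Ptab w) => hper.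
  move: hp; rewrite (perm_all _ hper); case: (Ptab w) => // r T.
  by rewrite word_of_cons all_cat => /andP[].
exact: yam_knuth (knuth_word_Ptab w) h.
Qed.

(** The word of Y_i for a rectangle with [m] rows and [c] columns whose letters start at [o.+1]. *)
Definition rectw (o m c : nat) : word := word_of (ytab o.+1 (nseq m c)).

Definition blk (o m : nat) : pred nat := fun x => (o < x) && (x <= o + m).

Lemma count_rectw o m c r : count_mem r (rectw o m c) = if blk o m r then c else 0.
Proof.
rewrite /rectw /blk; case: (ltnP o r) => h /=.
  have {1}-> : r = o.+1 + (r - o.+1) by lia.
  rewrite count_ytab nth_nseq; case: ifP; case: ifP => //; lia.
by rewrite count_ytab_lt.
Qed.

Lemma brun_open r d w : r \notin w -> brun r (Some d) w = Some (d + count_mem r.+1 w).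
Proof.
elim: w d => [|x w IH] d; first by rewrite /= addn0.
rewrite inE negb_or => /andP[hx hw]; rewrite brun_cons /= [x == r]eq_sym (negPf hx).
by case: eqP => _; rewrite IH //=; congr Some; lia.
Qed.

Lemma brun_close r d c : brun r (Some (c + d)) (nseq c r) = Some d.
Proof.
elim: c d => //= c IH d; rewrite eqxx; have -> : (r == r.+1) = false by lia.
exact: IH.
Qed.

Lemma brun_count r d e w : brun r (Some d) w = Some e -> d + count_mem r.+1 w = e + count_mem r w.
Proof.
elim: w d => [|x w IH] d; first by move=> [->].
have n : (r.+1 == r) = false by lia.
rewrite brun_cons /=; case: (eqVneq x r.+1) => [ex|n1].
  by move/IH; rewrite /=; lia.
case: (eqVneq x r) => [ex|n2]; last by move/IH; rewrite /=; lia.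
by case: d => [|d]; rewrite ?brun_None // => /IH; rewrite /=; lia.
Qed.

Lemma bal_rectw o m c r : o < r < o + m -> bal r (rectw o m c).
Proof.
rewrite /rectw; elim: m o => [|m IH] o; first by rewrite addn0; lia.
rewrite [nseq _ _]/= [ytab _ _]/= word_of_cons => h.
rewrite /bal brun_cat; case: (eqVneq r o.+1) => [er|n].
  have hr : r \notin word_of (ytab o.+2 (nseq m c)).
    apply/count_memPn; rewrite -/(rectw o.+1 m c) count_rectw /blk; case: ifP => //; lia.
  rewrite brun_open // -/(rectw o.+1 m c) count_rectw add0n /blk ifT; last by lia.
  by rewrite -er -{1}[c]addn0 brun_close.
have /eqP -> : bal r (word_of (ytab o.+2 (nseq m c))) by apply: IH; lia.
apply/eqP; elim: c {IH} => // c IHc.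
by rewrite [nseq _ _]/= brun_cons brun_neutral ?IHc //; lia.
Qed.

Section RectWord.
Variables (o m c : nat) (w : word).
Hypothesis hw : knuth_equiv w (rectw o m c).

Lemma rectw_count r : count_mem r w = if blk o m r then c else 0.
Proof. by rewrite (permP (knuth_perm hw)) count_rectw. Qed.

Lemma rectw_all : all (blk o m) w.
Proof.
apply/allP => x hx; have := rectw_count x; case: ifP => // _.
by move/eqP; rewrite -leqn0 leqNgt -has_count has_pred1 hx.
Qed.

Lemma rectw_bal r : o < r < o + m -> bal r w.
Proof. by move=> h; rewrite (bal_knuth r hw) bal_rectw. Qed.

(** A balanced word closes in each suffix at least as much as it opens there; beyond the block
    [r.+1] does not occur. *)
Lemma rectw_yam : yam o w.
Proof.
move=> j r hr; case: (ltnP r (o + m)) => h; last first.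
  have -> : count_mem r.+1 (drop j w) = 0; last by [].
  apply/count_memPn; apply/negP => /mem_drop /(allP rectw_all); rewrite /blk; lia.
have := @rectw_bal r; rewrite hr h => /(_ isT) /eqP.
rewrite -{1}(cat_take_drop j w) brun_cat; case: (brun r (Some 0) (take j w)) => [d|]; last by rewrite brun_None.
by move/brun_count; lia.
Qed.
End RectWord.

(** A larger last letter [x] would be an unmatched opening one for the pair [x.-1], [x]. *)
Lemma rectw_last o m c u x : knuth_equiv (rcons u x) (rectw o m c) -> x = o.+1.
Proof.
move=> h; have := allP (rectw_all h) x; rewrite mem_rcons inE eqxx => /(_ isT) /andP[h1 h2].
apply/eqP; rewrite eqn_leq h1 andbT leqNgt; apply/negP => hl.
have hb : bal x.-1 (rcons u x) by apply: (rectw_bal h); lia.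
by have := bal_rcons_neq hb; lia.
Qed.

Lemma rectw_first o m c v y : knuth_equiv (y :: v) (rectw o m c) -> y = o + m.
Proof.
move=> h; have := allP (rectw_all h) y; rewrite inE eqxx => /(_ isT) /andP[h1 h2].
apply/eqP; rewrite eqn_leq h2 leqNgt; apply/negP => hl.
have hb : bal y (y :: v) by apply: (rectw_bal h); lia.
by have := bal_cons_neq hb; lia.
Qed.

(** * Tableaux for two rectangles *)

Lemma rectwS o m c : rectw o m.+1 c = rectw o.+1 m c ++ nseq c o.+1.
Proof. by rewrite /rectw /= word_of_cons. Qed.

Lemma rectwS_top o m c : rectw o m.+1 c = nseq c (o + m.+1) ++ rectw o m c.
Proof.
elim: m o => [|m IH] o; first by rewrite rectwS /rectw /= cats0 addn1.
by rewrite rectwS IH [in RHS]rectwS catA addSnnS.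
Qed.

Lemma star_nseq N c x : star N (nseq c x) = nseq c (N - x).
Proof.
rewrite /star map_nseq; apply: (@eq_from_nth _ 0); rewrite size_rev // => j.
by rewrite size_nseq => hj; rewrite nth_rev size_nseq // !nth_nseq hj; case: ifP => //; lia.
Qed.

(** The constant sends the top letter [o + m] of the block to [o'.+1]. *)
Lemma star_rectw o m c o' : star (o + m + o').+1 (rectw o m c) = rectw o' m c.
Proof.
elim: m o => [|m IH] o; first by rewrite /rectw.
rewrite rectwS star_cat star_nseq rectwS_top; congr (nseq _ _ ++ _); first by lia.
by rewrite -(IH o.+1); congr (star _ _); lia.
Qed.

Lemma filter_star B N w : filter B (star N w) = star N (filter (fun x => B (N - x)) w).
Proof. by rewrite /star filter_rev filter_map. Qed.

Definition LRw (e1 m1 e2 m2 : nat) (w : word) : Prop :=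
  [/\ all (blk 0 (e1 + e2)) w, knuth_equiv (filter (blk 0 e1) w) (rectw 0 e1 m1) &
      knuth_equiv (filter (blk e1 e2) w) (rectw e1 e2 m2)].

Lemma blk_convex o m : convex (blk o m).
Proof. by rewrite /convex /blk => x y z; lia. Qed.

Lemma LRw_knuth e1 m1 e2 m2 u v : knuth_equiv u v -> LRw e1 m1 e2 m2 u -> LRw e1 m1 e2 m2 v.
Proof.
move=> h [h1 h2 h3]; split.
- by rewrite -(perm_all _ (knuth_perm h)).
- by apply: rst_trans h2; apply: rst_sym; apply: knuth_filter => //; apply: blk_convex.
- by apply: rst_trans h3; apply: rst_sym; apply: knuth_filter => //; apply: blk_convex.
Qed.

Lemma LRw_le e1 m1 e2 m2 w : LRw e1 m1 e2 m2 w -> all (fun x => x <= (e1 + e2).+1) w.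
Proof. by case=> h _ _; apply: sub_all h => x; rewrite /blk; lia. Qed.

Lemma LRw_star e1 m1 e2 m2 w : LRw e1 m1 e2 m2 w ->
  LRw e2 m2 e1 m1 (star (e1 + e2).+1 w).
Proof.
move=> h; have hle := LRw_le h; case: h => h1 h2 h3.
have hf (B : pred nat) : all (fun x => x <= (e1 + e2).+1) (filter B w).
  by apply/allP => x; rewrite mem_filter => /andP[_ hx]; apply: (allP hle).
split.
- rewrite /star all_rev all_map; apply: sub_all h1 => x; rewrite /blk /=; lia.
- rewrite filter_star (eq_in_filter (a2 := blk e1 e2)).
    by rewrite -(star_rectw e1 e2 m2 0) addn0; apply: star_knuth.
  by move=> x hx; have := allP h1 _ hx; rewrite /blk; lia.
- rewrite filter_star (eq_in_filter (a2 := blk 0 e1)).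
    by rewrite -(star_rectw 0 e1 m1 e2) add0n; apply: star_knuth.
  by move=> x hx; have := allP h1 _ hx; rewrite /blk; lia.
Qed.

Lemma word_of_filter B T : filter B (word_of T) = word_of (map (filter B) T).
Proof. by elim: T => //= r T IH; rewrite !word_of_cons filter_cat IH. Qed.

Lemma word_of_cat T1 T2 : word_of (T1 ++ T2) = word_of T2 ++ word_of T1.
Proof. by rewrite /word_of rev_cat flatten_cat. Qed.

Lemma sorted_filter_le e r : sorted leq r ->
  filter (fun x => x <= e) r = take (find (fun y => e < y) r) r /\
  filter (fun x => e < x) r = drop (find (fun y => e < y) r) r.
Proof.
move=> sr; have [h1 h2] := find_sorted_split e sr.
set k := find _ _ in h1 h2 *.
have E p : filter p r = filter p (take k r) ++ filter p (drop k r) by rewrite -filter_cat cat_take_drop.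
rewrite !E.
have -> : filter (leq^~ e) (take k r) = take k r by apply/all_filterP.
have -> : filter [eta leq e.+1] (drop k r) = drop k r by apply/all_filterP.
have -> : filter (leq^~ e) (drop k r) = [::].
  by apply/eqP; rewrite -[_ == _]negbK -has_filter; apply/hasPn => x hx; rewrite -ltnNge; apply: (allP h2).
have -> : filter [eta leq e.+1] (take k r) = [::].
  by apply/eqP; rewrite -[_ == _]negbK -has_filter; apply/hasPn => x hx; rewrite -leqNgt; apply: (allP h1).
by rewrite cats0.
Qed.

Lemma sorted_cat_le e r : sorted leq r ->
  r = filter (fun x => x <= e) r ++ filter (fun x => e < x) r.
Proof. by move=> sr; have [-> ->] := sorted_filter_le e sr; rewrite cat_take_drop. Qed.

Lemma qtabP T : reflect (all (sorted leq) T /\ forall i, dom (nth [::] T i) (nth [::] T i.+1)) (qtab T).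
Proof.
elim: T => [|r T IH] /=; first by apply: ReflectT; split=> // i; rewrite !nth_nil.
apply: (iffP and3P) => [[h2 h3 /IH[h5 h6]]|[/andP[h3 h4] h5]].
  by rewrite h2; split=> // -[|i] //=; rewrite nth0.
split=> //; first by have := h5 0; rewrite /= nth0.
by apply/IH; split=> // i; apply: (h5 i.+1).
Qed.

Lemma dom_filter_le e r s : sorted leq r -> sorted leq s -> dom r s ->
  dom (filter (fun x => x <= e) r) (filter (fun x => x <= e) s).
Proof.
move=> sr ss /domP[d1 d2]; apply/domP.
have [-> _] := sorted_filter_le e sr; have [-> _] := sorted_filter_le e ss.
set k := find _ r; set k' := find _ s.
have hk : k <= size r by apply: find_size. have hk' : k' <= size s by apply: find_size.
have lt j : j < k' -> j < k.
  move=> hj; have js : j < size s by lia.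
  have := d2 j js; move: (hj); rewrite -(find_gtP e ss js) -(find_gtP e sr (leq_trans js d1)); lia.
have kk : k' <= k by rewrite leqNgt; apply/negP => h; have := lt _ h; rewrite ltnn.
rewrite !size_takel //; split=> // j hj; rewrite !nth_take //; last exact: lt.
by apply: d2; apply: leq_trans hj hk'.
Qed.

Lemma nth_sorted (T : tableau) k : all (sorted leq) T -> sorted leq (nth [::] T k).
Proof.
move=> h; case: (ltnP k (size T)) => hk; last by rewrite nth_default.
by apply: (allP h); apply: mem_nth.
Qed.

Lemma qtab_filter_le e T : qtab T -> qtab (map (filter (fun x => x <= e)) T).
Proof.
move=> /qtabP[h1 h2]; apply/qtabP; split.
  by rewrite all_map; apply: sub_all h1 => r hr /=; apply: sorted_filter => //; exact: leq_trans.
move=> i; have N k : nth [::] [seq [seq x <- r | x <= e] | r <- T] k = [seq x <- nth [::] T k | x <= e].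
  case: (ltnP k (size T)) => hk; first by rewrite (nth_map [::]).
  by rewrite !nth_default ?size_map.
by rewrite !N; apply: dom_filter_le => //; apply: nth_sorted.
Qed.

Lemma nth_ytab o la k : nth [::] (ytab o la) k = nseq (nth 0 la k) (o + k).
Proof.
elim: la o k => [|m la IH] o k; first by rewrite !nth_nil.
by case: k => [|k] /=; rewrite ?addn0 // IH addSnnS.
Qed.

Lemma nth_shape (T : tableau) k : nth 0 (shape T) k = size (nth [::] T k).
Proof.
case: (ltnP k (size T)) => hk; first by rewrite (nth_map [::]).
by rewrite !nth_default ?size_map.
Qed.

Lemma dom_catl (a b r s : seq nat) : size a = size b -> dom (a ++ r) (b ++ s) -> dom r s.
Proof.
move=> e /domP[d1 d2]; apply/domP; split; first by move: d1; rewrite !size_cat e leq_add2l.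
move=> j hj; have := d2 (size b + j); rewrite size_cat ltn_add2l => /(_ hj).
by rewrite -{1}e !nth_cat !ltnNge !leq_addr /= !addKn.
Qed.

(** * The two pieces of the second block around the first rectangle *)

Section LRTableau.
Variables (e1 m1 e2 m2 : nat) (T : tableau).
Hypotheses (hT : tab T) (hLR : LRw e1 m1 e2 m2 (word_of T)).

Let hi k := filter (fun x => e1 < x) (nth [::] T k).

Lemma LR_letters x : x \in word_of T -> 0 < x <= e1 + e2.
Proof. by case: hLR => h _ _ /(allP h). Qed.

(** The restriction to the first block has a lattice reading word, hence is superstandard, and its
    content is known. *)
Lemma LR_low k : filter (fun x => x <= e1) (nth [::] T k) = nseq (if k < e1 then m1 else 0) k.+1.
Proof.
pose T1 := map (filter (fun x => x <= e1)) T.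
have hw : word_of T1 = filter (blk 0 e1) (word_of T).
  rewrite -word_of_filter; apply: eq_in_filter => x /LR_letters; rewrite /blk; lia.
have hk : knuth_equiv (word_of T1) (rectw 0 e1 m1) by rewrite hw; case: hLR.
have e : T1 = ytab 1 (shape T1).
  apply: yam_rows; first exact/qtab_filter_le/tab_qtab.
    have := rectw_all hk; case: T1 {hk hw} => // r T' ; rewrite word_of_cons all_cat => /andP[_].
    by apply: sub_all => x /andP[].
  exact: rectw_yam hk.
have es : nth 0 (shape T1) k = if k < e1 then m1 else 0.
  by rewrite -(count_ytab 1) -e (rectw_count hk) /blk add0n add1n.
have -> : [seq x <- nth [::] T k | x <= e1] = nth [::] T1 k.
  case: (ltnP k (size T)) => h; first by rewrite (nth_map [::]).
  by rewrite !nth_default ?size_map.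
by rewrite e nth_ytab es add1n.
Qed.

Lemma LR_row k : nth [::] T k = nseq (if k < e1 then m1 else 0) k.+1 ++ hi k.
Proof.
by rewrite -LR_low; apply: sorted_cat_le; apply: nth_sorted; case/tabP: hT.
Qed.

(** [U] is the part of the second block below the first rectangle, [V] the part to the right of
    it. *)
Let U := drop e1 T.
Let V := map (filter (fun x => e1 < x)) (take e1 T).

Lemma nth_V k : nth [::] V k = if k < e1 then hi k else [::].
Proof.
have st : size (take e1 T) = minn e1 (size T) by rewrite size_take_min.
rewrite /V; case: (ltnP k e1) => hk; last by rewrite nth_default // size_map st geq_min hk.
case: (ltnP k (size T)) => h; first by rewrite (nth_map [::]) ?nth_take // st leq_min hk.
by rewrite /hi !(nth_default [::]) // size_map st geq_min h orbT.
Qed.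

Lemma LR_high_word : filter (blk e1 e2) (word_of T) = word_of U ++ word_of V.
Proof.
have -> : filter (blk e1 e2) (word_of T) = filter (fun x => e1 < x) (word_of T).
  by apply: eq_in_filter => x /LR_letters; rewrite /blk; lia.
rewrite -{1}(cat_take_drop e1 T) word_of_cat filter_cat !word_of_filter; congr (word_of _ ++ _).
apply: (@eq_from_nth _ [::]); rewrite size_map // => k hk.
rewrite (nth_map [::]) // nth_drop LR_row ltnNge leq_addr /=.
by rewrite /hi filter_id.
Qed.

Lemma LR_V : V = ytab e1.+1 (shape V).
Proof.
apply: yam_rows.
- apply/qtabP; split.
    rewrite /V all_map; apply/allP => r hr; apply: sorted_filter; first exact: leq_trans.
    by have /tabP[_ h _] := hT; apply: (allP h); apply: mem_take hr.
  move=> k; rewrite !nth_V; case: (ltnP k.+1 e1) => hk; last by apply/domP; split.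
  rewrite (ltnW hk); have /tabP[_ _ /(_ k)] := hT.
  rewrite !LR_row hk (ltnW hk); apply: dom_catl; by rewrite !size_nseq.
- rewrite -nth0 nth_V /hi; case: ifP => // _; exact: filter_all.
- have [_ _ h3] := hLR; have := rectw_yam h3; rewrite LR_high_word; exact: yam_suffix.
Qed.

(** Dual to [LR_V]: [U] is read before [V], so its reverse complement is a suffix of a lattice
    word. *)
Lemma LR_U : Ptab (star (e1 + e2).+1 (word_of U)) = ytab 1 (shape U).
Proof.
have hU : tab U.
  have /tabP[h1 h2 h3] := hT; apply/tabP; split.
  - by apply/allP => r /mem_drop; apply: (allP h1).
  - by apply/allP => r /mem_drop; apply: (allP h2).
  - by move=> i; rewrite !nth_drop addnS.
have hle : all (fun x => x <= (e1 + e2).+1) (word_of U).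
  have := LRw_le hLR; rewrite -{1}(cat_take_drop e1 T) word_of_cat all_cat; by case/andP.
have es : shape (Ptab (star (e1 + e2).+1 (word_of U))) = shape U.
  by rewrite shape_star // Ptab_word_of.
have [_ h3 _] := LRw_star hLR.
have e : filter (blk 0 e2) (star (e1 + e2).+1 (word_of T)) = star (e1 + e2).+1 (word_of V) ++ star (e1 + e2).+1 (word_of U).
  rewrite filter_star -star_cat -LR_high_word; congr star.
  by apply: eq_in_filter => x /LR_letters; rewrite /blk; lia.
rewrite e in h3; rewrite yam_Ptab ?es //.
- exact: yam_suffix (rectw_yam h3).
- have := rectw_all h3; rewrite all_cat => /andP[_]; by apply: sub_all => x /andP[].
Qed.
End LRTableau.

Lemma shape_drop e (T : tableau) : shape (drop e T) = drop e (shape T).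
Proof. by rewrite /shape map_drop. Qed.

Lemma tab_drop e T : tab T -> tab (drop e T).
Proof.
move=> /tabP[h1 h2 h3]; apply/tabP; split.
- by apply/allP => r /mem_drop; apply: (allP h1).
- by apply/allP => r /mem_drop; apply: (allP h2).
- by move=> i; rewrite !nth_drop addnS.
Qed.

Lemma tab_shape_le T i j : tab T -> i <= j -> nth 0 (shape T) j <= nth 0 (shape T) i.
Proof.
move=> hT /subnKC <-; elim: (j - i) => [|m IH]; first by rewrite addn0.
by rewrite addnS; apply: leq_trans IH; apply: tab_shape_dec.
Qed.

Lemma count_star N l w : all (fun x => x <= N) w -> l <= N ->
  count_mem l (star N w) = count_mem (N - l) w.
Proof.
move=> hw hl; rewrite /star count_rev count_map; apply: eq_in_count => x hx /=.
have := allP hw _ hx; lia.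
Qed.

Section LRShape.
Variables (e1 m1 e2 m2 : nat) (T : tableau).
Hypotheses (hT : tab T) (hLR : LRw e1 m1 e2 m2 (word_of T)).

Let la k := nth 0 (shape T) k.
Let V := map (filter (fun x => e1 < x)) (take e1 T).

Lemma LR_size_V k : nth 0 (shape V) k = if k < e1 then la k - m1 else 0.
Proof.
rewrite nth_shape /V nth_V; case: ifP => // hk.
by rewrite /la nth_shape [in RHS](LR_row hT hLR k) hk size_cat size_nseq addKn.
Qed.

Lemma LR_row_explicit k : k < e1 -> nth [::] T k = nseq m1 k.+1 ++ nseq (la k - m1) (e1 + k.+1).
Proof.
move=> hk; have := LR_size_V k; rewrite hk => e.
rewrite {1}(LR_row hT hLR k) hk; congr (_ ++ _).
have hV : V = ytab e1.+1 (shape V) := LR_V hT hLR.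
by have := nth_V e1 T k; rewrite hk -/V hV nth_ytab e addSnnS => ->.
Qed.

Lemma LR_ge k : k < e1 -> m1 <= la k.
Proof. by move=> hk; rewrite /la nth_shape (LR_row hT hLR k) hk size_cat size_nseq leq_addr. Qed.

Lemma count_U k : k <= e1 + e2 -> count_mem (e1 + e2 - k) (word_of (drop e1 T)) = la (e1 + k).
Proof.
move=> hk; have hU := LR_U hT hLR.
have hle : all (fun x => x <= (e1 + e2).+1) (word_of (drop e1 T)).
  have := LRw_le hLR; rewrite -{1}(cat_take_drop e1 T) word_of_cat all_cat; by case/andP.
have := permP (knuth_perm (knuth_word_Ptab (star (e1 + e2).+1 (word_of (drop e1 T))))) (pred1 k.+1).
rewrite hU count_star //.
rewrite subSS => ->; rewrite -(add1n k) count_ytab shape_drop nth_drop //.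
Qed.

(** Counts the letter [e1 + l.+1]: in [V] it fills the part of row [l], in [U] it occurs as often as
    the paired row is long. *)
Lemma LR_sum l : l < e2 ->
  (if l < e1 then la l - m1 else 0) + la (e1 + e2 - l.+1) = m2.
Proof.
move=> hl; have [_ _ h3] := hLR.
have := rectw_count h3 (e1 + l.+1); rewrite (LR_high_word hT hLR) count_cat.
have -> : blk e1 e2 (e1 + l.+1) by rewrite /blk; lia.
have hV : V = ytab e1.+1 (shape V) := LR_V hT hLR.
rewrite -/V hV -addSnnS count_ytab LR_size_V => <-.
rewrite addnC; congr (_ + _).
have -> : e1 + e2 - l.+1 = e1 + (e2 - l.+1) by lia.
rewrite -count_U; last by lia.
by congr (count_mem _ _); lia.
Qed.

Lemma LR_middle l : e2 <= l < e1 -> la l = m1.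
Proof.
move=> /andP[h1 h2]; have [_ _ h3] := hLR.
have := rectw_count h3 (e1 + l.+1); rewrite (LR_high_word hT hLR) count_cat.
have -> : blk e1 e2 (e1 + l.+1) = false by rewrite /blk; lia.
have hV : V = ytab e1.+1 (shape V) := LR_V hT hLR.
rewrite -/V hV -addSnnS count_ytab LR_size_V h2.
by have := LR_ge h2; lia.
Qed.

Lemma LR_rows l : e1 + e2 <= l -> la l = 0.
Proof.
move=> hl; have -> : l = e1 + (l - e1) by lia.
have hU := LR_U hT hLR.
have hle : all (fun x => x <= (e1 + e2).+1) (word_of (drop e1 T)).
  have := LRw_le hLR; rewrite -{1}(cat_take_drop e1 T) word_of_cat all_cat; by case/andP.
have := permP (knuth_perm (knuth_word_Ptab (star (e1 + e2).+1 (word_of (drop e1 T))))) (pred1 (l - e1).+1).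
rewrite hU -(add1n (l - e1)) count_ytab shape_drop nth_drop -/(la _) => <-.
apply/count_memPn; apply/negP; rewrite /star mem_rev => /mapP[x hx].
have : x \in word_of T by rewrite -(cat_take_drop e1 T) word_of_cat mem_cat hx.
move=> /(LR_letters hLR) h1.
have : e1 < x.
  have : x \in filter (blk e1 e2) (word_of T) by rewrite (LR_high_word hT hLR) mem_cat hx.
  by rewrite mem_filter => /andP[/andP[]].
lia.
Qed.

(** Otherwise row [e1.-1] would have [e1 + e1] in the first column beyond the rectangle, and the
    entry below it would exceed [e1 + e2]. *)
Lemma LR_narrow : 0 < e1 -> e2 <= e1 -> la e1 <= m1.
Proof.
move=> e1p h; rewrite leqNgt; apply/negP => hlt.
have /tabP[_ _ hd] := hT; have /domP[d1 d2] := hd e1.-1.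
rewrite (prednK e1p) -!nth_shape -/(la _) in d1 d2.
have := d2 m1 hlt.
rewrite LR_row_explicit; last by lia.
rewrite nth_cat size_nseq ltnn subnn nth_nseq subn_gt0 (leq_trans hlt) // prednK //.
have : nth 0 (nth [::] T e1) m1 \in word_of T.
  apply/flattenP; exists (nth [::] T e1).
    rewrite mem_rev; apply: mem_nth; rewrite ltnNge; apply/negP => hs.
    by move: hlt; rewrite /la nth_default ?size_map.
  by apply: mem_nth; rewrite -nth_shape.
move=> /(LR_letters hLR); lia.
Qed.
End LRShape.

(** Both pieces depend on their shapes only: [V] is superstandard, and the reverse complement of the
    word of [U] has a superstandard insertion tableau and a recording sequence fixed by the
    shape. *)
Lemma LR_unique e1 m1 e2 m2 T T' : tab T -> tab T' ->
  LRw e1 m1 e2 m2 (word_of T) -> LRw e1 m1 e2 m2 (word_of T') ->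
  shape T = shape T' -> T = T'.
Proof.
move=> hT hT' h h' es.
have eU : word_of (drop e1 T) = word_of (drop e1 T').
  have hle S : LRw e1 m1 e2 m2 (word_of S) -> all (fun x => x <= (e1 + e2).+1) (word_of (drop e1 S)).
    by move=> /LRw_le; rewrite -{1}(cat_take_drop e1 S) word_of_cat all_cat; case/andP.
  rewrite -(starK (hle _ h)) -(starK (hle _ h')); congr star; apply: rsk_inj.
    by rewrite (LR_U hT h) (LR_U hT' h') !shape_drop es.
  apply: star_rw; [exact: hle h|exact: hle h'|].
  by apply: rw_word_of; rewrite ?tab_drop // !shape_drop es.
rewrite -(cat_take_drop e1 T) -(cat_take_drop e1 T'); congr (_ ++ _); last first.
  by rewrite -(Ptab_word_of (tab_drop e1 hT)) eU Ptab_word_of // tab_drop.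
have sz : size T = size T' by have := congr1 size es; rewrite !size_map.
apply: (@eq_from_nth _ [::]); rewrite !size_take_min sz // => k.
rewrite leq_min => /andP[hk _]; rewrite !nth_take //.
by rewrite (LR_row_explicit hT h hk) (LR_row_explicit hT' h' hk) es.
Qed.

Definition LRshape (e1 m1 e2 m2 : nat) (la : seq nat) : Prop :=
  exists T, [/\ tab T, LRw e1 m1 e2 m2 (word_of T) & shape T = la].

Lemma LRshape_word e1 m1 e2 m2 w : LRw e1 m1 e2 m2 w -> LRshape e1 m1 e2 m2 (shape (Ptab w)).
Proof.
move=> h; exists (Ptab w); split; rewrite ?Ptab_tab //.
exact: LRw_knuth (knuth_word_Ptab w) h.
Qed.

Lemma LRshape_sym e1 m1 e2 m2 la : LRshape e1 m1 e2 m2 la -> LRshape e2 m2 e1 m1 la.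
Proof.
case=> T [hT h <-]; rewrite -(Ptab_word_of hT) -(shape_star (LRw_le h)).
exact/LRshape_word/LRw_star.
Qed.

(** Complementarity forces the two added cells into paired rows. [LR_narrow] keeps the lower one
    within [m1] columns, and [LR_ge] and complementarity put the upper one beyond both widths. *)
Lemma LRshape_covers_wlog e1 m1 e2 m2 nu i i' : e2 <= e1 -> 0 < e1 -> 0 < m1 ->
  LRshape e1 m1 e2 m2 (incr_nth nu i) -> LRshape e1 m1 e2 m2 (incr_nth nu i') -> i < i' ->
  maxn m1 m2 <= nth 0 nu i /\ nth 0 nu i' < maxn m1 m2.
Proof.
move=> he e1p m1p [T [hT h es]] [T' [hT' h' es']] hi.
have E k : nth 0 (shape T) k = (i == k) + nth 0 nu k by rewrite es nth_incr_nth.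
have E' k : nth 0 (shape T') k = (i' == k) + nth 0 nu k by rewrite es' nth_incr_nth.
(* From row [e2] on the length is prescribed either outright or by a paired row above [i], which
   neither cell touches. *)
have i1 : i < e2.
  rewrite ltnNge; apply/negP => c1.
  case: (ltnP i e1) => c2.
    have := LR_middle hT h (l := i); have := LR_middle hT' h' (l := i).
    rewrite c1 c2 => /(_ isT) a1 /(_ isT) a2; have := E i; have := E' i; rewrite a1 a2 eqxx; lia.
  case: (ltnP i (e1 + e2)) => c3; last first.
    by have := LR_rows hT h c3; rewrite E eqxx.
  have hl : e1 + e2 - i.+1 < e2 by lia.
  have hl' : e1 + e2 - i.+1 < e1 by lia.
  have := LR_sum hT h hl; have := LR_sum hT' h' hl.
  have -> : e1 + e2 - (e1 + e2 - i.+1).+1 = i by lia.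
  rewrite hl' !E !E' eqxx; lia.
have hie : i < e1 by lia.
have := LR_sum hT h i1; have := LR_sum hT' h' i1; rewrite hie !E !E' eqxx.
have := LR_ge hT' h' hie; rewrite E'.
have := LR_narrow hT' h' e1p he; have := tab_shape_le hT' (_ : e1 <= e1 + e2 - i.+1).
have -> : e1 <= e1 + e2 - i.+1 by lia.
move=> /(_ isT); rewrite !E'.
have [<-|n] := eqVneq i' (e1 + e2 - i.+1); last by lia.
lia.
Qed.

(** A cell added in row [i] lies strictly right of column [maxn m1 m2] exactly when [nth 0 nu i] is
    at least that number. *)
Lemma LRshape_covers e1 m1 e2 m2 nu i i' : 0 < e1 -> 0 < m1 -> 0 < e2 -> 0 < m2 ->
  LRshape e1 m1 e2 m2 (incr_nth nu i) -> LRshape e1 m1 e2 m2 (incr_nth nu i') -> i != i' ->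
  (nth 0 nu i < maxn m1 m2) != (nth 0 nu i' < maxn m1 m2).
Proof.
move=> e1p m1p e2p m2p h h' n.
wlog he : e1 m1 e2 m2 e1p m1p e2p m2p h h' / e2 <= e1.
  move=> H; case: (leqP e2 e1) => c; first by apply: (H e1 m1 e2 m2).
  by rewrite maxnC; apply: (H e2 m2 e1 m1) => //; [apply: LRshape_sym|apply: LRshape_sym|apply: ltnW].
case: (ltngtP i i') n => // c _.
- have [] := LRshape_covers_wlog he e1p m1p h h' c; lia.
- have [] := LRshape_covers_wlog he e1p m1p h' h c; lia.
Qed.

(** * The map chi for two rectangles *)

(* Bumping routes move weakly to the left. *)
Lemma ins_col T x : tab T ->
  nth 0 (shape T) (irow T x) <= find (fun y => x < y) (head [::] T).
Proof.
elim: T x => [|r T IH] x //; rewrite tab_cons => /and4P[h1 h2 /domP[d1 d2] h4].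
rewrite irowE; case: ltnP => hk //=.
apply: leq_trans (IH _ h4) _; set k := find _ r in hk *; set y := nth 0 r k.
have hs : sorted leq (head [::] T) by case: T h4 {IH d1 d2} => //= s T /and4P[].
case: (ltnP k (size (head [::] T))) => h; last exact: leq_trans (find_size _ _) h.
by rewrite leqNgt -(find_gtP y hs h) -ltnNge; apply: d2.
Qed.

Lemma find_min_count x r : sorted leq r -> all (leq x) r -> find (fun y => x < y) r <= count_mem x r.
Proof.
elim: r => //= y r IH hp /andP[hy hr]; case: ltnP => // h.
have -> : y = x by lia.
by rewrite eqxx add1n ltnS; apply: IH => //; apply: path_sorted hp.
Qed.

(** A minimal letter enters the first row directly behind its copies, and the bumping route does not
    move right from there. *)
Lemma min_col u x : all (leq x) u -> nth 0 (shape (Ptab u)) (irow (Ptab u) x) <= count_mem x u.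
Proof.
move=> hu; apply: leq_trans (ins_col x (Ptab_tab u)) _.
have hp := knuth_perm (knuth_word_Ptab u).
rewrite (permP hp); have : all (leq x) (word_of (Ptab u)) by rewrite -(perm_all _ hp).
have := Ptab_rsorted u; case: (Ptab u) => [|r T] //= /andP[sr _].
rewrite word_of_cons all_cat count_cat => /andP[_ hr].
by apply: leq_trans (find_min_count sr hr) (leq_addl _ _).
Qed.

Definition blk2 (e1 e2 : nat) (b : bool) : pred nat := if b then blk 0 e1 else blk e1 e2.

(* The relation between w and chi w that survives restriction to two
   consecutive blocks. *)
Definition chi2 (e1 m1 e2 m2 : nat) (w z : word) : Prop :=
  exists b u x v y, let B := blk2 e1 e2 b in
  [/\ w = rcons u x /\ z = y :: v, LRw e1 m1 e2 m2 w /\ LRw e1 m1 e2 m2 z,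
      B x /\ B y & subst_rw B u v].

Lemma blk2_convex e1 e2 b : convex (blk2 e1 e2 b).
Proof. by case: b; apply: blk_convex. Qed.

Lemma agree_inj B u u' v : agree B u v -> agree B u' v -> filter B u = filter B u' -> u = u'.
Proof.
elim: v u u' => [|z v IH] [|x u] [|x' u'] //= /andP[/andP[/eqP e1 o1] h1] /andP[/andP[/eqP e2 o2] h2].
rewrite e1 e2; rewrite e1 in o1; rewrite e2 in o2; case: (B z) o1 o2 => /=.
  by move=> _ _ [-> /(IH _ _ h1 h2) ->].
by move=> /eqP -> /eqP -> /(IH _ _ h1 h2) ->.
Qed.

Lemma LRw_blk2 e1 m1 e2 m2 w b : LRw e1 m1 e2 m2 w ->
  knuth_equiv (filter (blk2 e1 e2 b) w) (if b then rectw 0 e1 m1 else rectw e1 e2 m2).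
Proof. by case: b => -[]. Qed.

(** The first letter of [z] reveals the block. The subword of [w] on this block is recovered from
    its rectangular insertion tableau and its recording sequence; the other letters are
    unchanged. *)
Lemma chi2_inj e1 m1 e2 m2 w w' z : chi2 e1 m1 e2 m2 w z -> chi2 e1 m1 e2 m2 w' z -> w = w'.
Proof.
move=> [b [u [x [v [y [[-> ez] [hw hz] [hx hy] [ha hr]]]]]]].
move=> [b' [u' [x' [v' [y' [[-> ez'] [hw' _] [hx' hy'] [ha' hr']]]]]]].
move: ez'; rewrite ez => -[ey ev]; subst y' v'.
have eb : b' = b by move: hy hy'; rewrite /blk2 /blk; case: b {hx ha hr} => //; case: b' {hx' ha' hr'} => //; lia.
subst b'; have k := LRw_blk2 b hw; have k' := LRw_blk2 b hw'.
rewrite !filter_rcons hx hx' in k k'.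
have eP : Ptab (rcons (filter (blk2 e1 e2 b) u) x) = Ptab (rcons (filter (blk2 e1 e2 b) u') x').
  by rewrite (knuth_Ptab k) (knuth_Ptab k').
have eR := rw_rcons_eq (etrans hr (esym hr')) (congr1 shape eP).
have /rcons_inj[ef ->] := rsk_inj eP eR.
by rewrite (agree_inj ha ha' ef).
Qed.

Section Chi2.
Variables (e1 m1 e2 m2 : nat).
Hypotheses (e1p : 0 < e1) (m1p : 0 < m1) (e2p : 0 < e2) (m2p : 0 < m2).

Definition new_row (z : word) (nu : seq nat) (j : nat) : Prop := shape (Ptab z) = incr_nth nu j.

Lemma chi2_split w z : chi2 e1 m1 e2 m2 w z -> exists u x v y j,
  [/\ w = rcons u x, z = y :: v, rw u = rw v & new_row z (shape (Ptab u)) j].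
Proof.
move=> [b [u [x [v [y [[-> ->] [hw hz] [hx hy] hs]]]]]].
have e : rw u = rw v := bisim_rw (bisim_subst (@blk2_convex e1 e2 b)) hs.
exists u, x, v, y, (irow (Ptab (star (e1 + e2).+1 v)) ((e1 + e2).+1 - y)); split=> //.
by rewrite /new_row (rw_shape e); apply: shape_cons; apply: LRw_le hz.
Qed.

Lemma chi2_hi u x z j : chi2 e1 m1 e2 m2 (rcons u x) z ->
  new_row z (shape (Ptab u)) j ->
  maxn m1 m2 <= nth 0 (shape (Ptab u)) (irow (Ptab u) x) ->
  nth 0 (shape (Ptab u)) j < maxn m1 m2.
Proof.
move=> [b [u' [x' [v [y [[/rcons_inj[<- <-] ->] [hw hz] [hx hy] hs]]]]]] hj hmax.
have e : rw u = rw v := bisim_rw (bisim_subst (@blk2_convex e1 e2 b)) hs.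
have k := LRw_blk2 b hw; have k' := LRw_blk2 b hz.
rewrite filter_rcons hx in k; rewrite /= hy in k'.
have [hall _ _] := hw; move: hall; rewrite all_rcons => /andP[_ hall].
case: b hx hy hs k k' => /= hx hy hs k k'.
  (* In the first block [x] is 1, and [u] contains [m1 - 1] copies of it: by [min_col] the new cell
     is too far left. *)
  have ex := rectw_last k; subst x.
  have := rectw_count k 1; rewrite /blk add0n e1p /= -cats1 count_cat /= count_filter.
  have -> : count (predI (pred1 1) (blk 0 e1)) u = count_mem 1 u.
    by apply: eq_count => t /=; rewrite /blk; case: eqP => // ->; rewrite e1p.
  have : all (leq 1) u by apply: sub_all hall => t /andP[].
  move=> /min_col; lia.
(* In the second block [y] becomes the minimal letter 1 of the reverse complement, and [v] contains
   [m2 - 1] copies of it. *)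
have ey := rectw_first k'; subst y.
have hle := LRw_le hz.
move: hj; rewrite /new_row (shape_cons hle) -(rw_shape e) => /incr_nth_injr <-.
have /andP[_ hlev] := hle.
have -> : (e1 + e2).+1 - (e1 + e2) = 1 by lia.
have := rectw_count k' (e1 + e2); rewrite /blk leqnn /= eqxx count_filter.
have -> : count (predI (pred1 (e1 + e2)) (blk e1 e2)) v = count_mem (e1 + e2) v.
  by apply: eq_count => t /=; rewrite /blk; case: eqP => // ->; lia.
have -> : e1 < e1 + e2 by lia.
rewrite /= => hc.
have hv1 : all (leq 1) (star (e1 + e2).+1 v).
  have [hz' _ _] := hz; move: hz' => /= /andP[_ hz'].
  by rewrite /star all_rev all_map; apply: sub_all hz' => t; rewrite /blk /=; lia.
have := min_col hv1; rewrite shape_star // -(rw_shape e) count_star //.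
have -> : (e1 + e2).+1 - 1 = e1 + e2 by lia.
by move=> hle2; apply: leq_trans (leq_maxr _ _); rewrite -hc add1n ltnS.
Qed.

(** Take a word whose prefix is recorded like [u] and whose last cell is in row [h]. By [chi2_hi]
    its image adds a cell in a low column, which must be the cell in row [i]. The two images then
    have equal shapes and recordings, hence are equal, and injectivity identifies two words with
    different last cells. Existence of images is a hypothesis here, supplied later by
    [chi2_exists]. *)
Lemma chi2_lo u x z i h :
  (forall u x, LRw e1 m1 e2 m2 (rcons u x) -> exists z, chi2 e1 m1 e2 m2 (rcons u x) z) ->
  chi2 e1 m1 e2 m2 (rcons u x) z ->
  new_row z (shape (Ptab u)) i -> i = irow (Ptab u) x ->
  LRshape e1 m1 e2 m2 (incr_nth (shape (Ptab u)) h) ->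
  nth 0 (shape (Ptab u)) i < maxn m1 m2 -> maxn m1 m2 <= nth 0 (shape (Ptab u)) h -> False.
Proof.
move=> hex hchi hz ei [T [hT hLR es]] hi hh.
have [|T1 [x1 [t1 t2 t3]]] := @rev_ins T h hT.
  rewrite es !nth_incr_nth eqxx (ltn_eqF (ltnSn h)) add0n add1n ltnS.
  exact/tab_shape_dec/Ptab_tab.
have es1 : shape T1 = shape (Ptab u).
  apply: (@incr_nth_injl _ _ h); try exact/tab_shape_pos/Ptab_tab.
    exact: tab_shape_pos.
  by rewrite -es -t2 size_ins t3.
have [u1 [p1 p2]] := rsk_surj t1 es1.
have eP : Ptab (rcons u1 x1) = T by rewrite Ptab_rcons p1.
have hw1 : LRw e1 m1 e2 m2 (rcons u1 x1).
  by apply: LRw_knuth hLR; apply: Ptab_knuth; rewrite Ptab_word_of.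
have [z1 hchi1] := hex _ _ hw1.
have [a1 [a2 [v1 [y1 [j1 [/rcons_inj[<- _] ez1 ev1 hj1]]]]]] := chi2_split hchi1.
have [b1 [b2 [v [y [j [/rcons_inj[<- _] ez ev _]]]]]] := chi2_split hchi.
have hlo : nth 0 (shape (Ptab u)) j1 < maxn m1 m2.
  by rewrite -(rw_shape p2); apply: chi2_hi hchi1 hj1 _; rewrite p1 t3 es1.
rewrite /new_row (rw_shape p2) in hj1.
have hLz (w' z' : word) : chi2 e1 m1 e2 m2 w' z' -> LRw e1 m1 e2 m2 z'.
  by move=> [? [? [? [? [? [_ [_ ?] _ _]]]]]].
have ej : j1 = i.
  apply/eqP; case: eqP => // /eqP n.
  have s1 := LRshape_word (hLz _ _ hchi1); have s2 := LRshape_word (hLz _ _ hchi).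
  rewrite hj1 in s1; rewrite hz in s2.
  by have := LRshape_covers e1p m1p e2p m2p s1 s2 n; rewrite hlo hi.
subst j1.
have eS : shape (Ptab z1) = shape (Ptab z) by rewrite hj1 hz.
have eT : Ptab z1 = Ptab z.
  apply: (@LR_unique e1 m1 e2 m2); rewrite ?Ptab_tab //.
  - exact: LRw_knuth (knuth_word_Ptab z1) (hLz _ _ hchi1).
  - exact: LRw_knuth (knuth_word_Ptab z) (hLz _ _ hchi).
have eR : rw z1 = rw z.
  rewrite ez1 ez in eS *; apply: rw_cons_eq => //.
  by rewrite -ev1 -ev.
have ezz := rsk_inj eT eR; rewrite ezz in hchi1.
have /rcons_inj[eu ex] := chi2_inj hchi hchi1.
by move: hi; rewrite ei eu ex p1 t3 es1 ltnNge hh.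
Qed.
End Chi2.

(** If the two new cells differed, one would lie right of the critical column and one not. A last
    cell to the right forces both new cells to the left. A last cell to the left coincides with the
    left one of the new cells, and [chi2_lo] refutes the other, which is an admissible cover for
    both orders of the rectangles. *)
Lemma chi2_rw e1 m1 e2 m2 w z w' z' :
  0 < e1 -> 0 < m1 -> 0 < e2 -> 0 < m2 ->
  (forall u x, LRw e1 m1 e2 m2 (rcons u x) -> exists z, chi2 e1 m1 e2 m2 (rcons u x) z) ->
  (forall u x, LRw e2 m2 e1 m1 (rcons u x) -> exists z, chi2 e2 m2 e1 m1 (rcons u x) z) ->
  chi2 e1 m1 e2 m2 w z -> chi2 e2 m2 e1 m1 w' z' -> rw w = rw w' -> rw z = rw z'.
Proof.
move=> e1p m1p e2p m2p hex hex' h h' e.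
have [u [x [v [y [j [ew ez ev hj]]]]]] := chi2_split h.
have [u' [x' [v' [y' [j' [ew' ez' ev' hj']]]]]] := chi2_split h'.
subst w z w' z'; move: e; rewrite !rw_rcons => /rcons_inj[eu ei].
have hs := rw_shape eu; set nu := shape (Ptab u) in hj hs *; rewrite -hs in hj'.
have hL a1 n1 a2 n2 (t s : word) : chi2 a1 n1 a2 n2 t s -> LRw a1 n1 a2 n2 t /\ LRw a1 n1 a2 n2 s.
  by move=> [? [? [? [? [? [_ ? _ _]]]]]].
have [l1 l2] := hL _ _ _ _ _ _ h; have [l1' l2'] := hL _ _ _ _ _ _ h'.
have si := LRshape_word l1; rewrite Ptab_rcons size_ins -/nu in si.
have sj := LRshape_word l2; rewrite hj in sj.
have sj' := LRshape_word l2'; rewrite hj' in sj'.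
have sj1 := LRshape_sym sj'; have sj1' := LRshape_sym sj.
suff ejj : j = j'.
  by apply: rw_cons_eq; [rewrite -ev -ev'|rewrite hj hj' ejj].
apply/eqP; case: eqP => // /eqP n.
have cov := LRshape_covers e1p m1p e2p m2p.
have c1 := cov _ _ _ sj sj1 n.
set i := irow (Ptab u) x in si ei.
case: (leqP (maxn m1 m2) (nth 0 nu i)) => hi.
  have lo1 := chi2_hi e1p m1p e2p m2p h hj hi.
  have := chi2_hi e2p m2p e1p m1p h' (j := j'); rewrite /new_row -hs -ei maxnC => /(_ hj' hi) lo2.
  by move: c1; rewrite lo1 lo2.
case: (ltnP (nth 0 nu j) (maxn m1 m2)) c1 => hjl; case: (ltnP (nth 0 nu j') (maxn m1 m2)) => hjl' // _.
- have eij : j = i.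
    apply/eqP; case: eqP => // /eqP nij.
    by have := cov _ _ _ sj si nij; rewrite hjl hi.
  by case: (chi2_lo e1p m1p e2p m2p hex h hj eij sj1 hjl hjl').
- have eij : j' = i.
    apply/eqP; case: eqP => // /eqP nij.
    by have := cov _ _ _ sj1 si nij; rewrite hjl' hi.
  have := @chi2_lo e2 m2 e1 m1 e2p m2p e1p m1p u' x' _ j' j hex' h'.
  by rewrite /new_row -hs maxnC => /(_ hj' (etrans eij ei) sj1' hjl' hjl).
Qed.

(** * The operators s_r and the map chi *)

Lemma scan_bal r a b i s st ur : brun r (Some (size s)) a = Some 0 ->
  scan r (a ++ b) i (s ++ st) ur = scan r b (i + size a) st ur.
Proof.
elim: a i s => [|y a IH] i s; first by case: s => //= _; rewrite addn0.
rewrite brun_cons /=; case: eqP => _.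
  by move=> h; rewrite -cat_cons IH // addSnnS.
case: eqP => _; last by move=> h; rewrite IH // addSnnS.
by case: s => [|z s] /=; [rewrite brun_None|move=> h; rewrite IH // addSnnS].
Qed.

Lemma sr_bal r u : bal r u -> sr r u = u.
Proof.
move=> /eqP h; rewrite /sr.
have := @scan_bal r u [::] 0 [::] [::] [::] h; rewrite !cats0 /= => ->.
by rewrite -[RHS](mkseq_nth 0).
Qed.

Lemma sr_raise r a b : bal r a -> bal r b -> sr r (a ++ r.+1 :: b) = a ++ r :: b.
Proof.
move=> /eqP ha /eqP hb; rewrite /sr.
have -> : scan r (a ++ r.+1 :: b) 0 [::] [::] = ([:: size a], [::]).
  rewrite -[X in scan _ _ _ X _](cat0s [::]) scan_bal //= eqxx add0n.
  by rewrite -(cats0 b) -[X in scan _ _ _ X _](cat0s [:: size a]) scan_bal.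
apply: (@eq_from_nth _ 0); rewrite size_map size_iota !size_cat // => i hi.
rewrite (nth_map 0) ?size_iota // nth_iota // add0n inE.
case: eqP => [->|/eqP n]; first by rewrite /= ltnn nth_cat ltnn subnn.
rewrite !nth_cat; case: ltnP => // h.
by have -> : i - size a = (i - size a).-1.+1 by lia.
Qed.

Lemma sr_single r : sr r [:: r] = [:: r.+1].
Proof. by rewrite /sr /= (ltn_eqF (ltnSn r)) eqxx /=. Qed.

Lemma foldr_sr_id u gs : all (fun r => bal r u) gs -> foldr sr u gs = u.
Proof. by elim: gs => //= r gs IH /andP[h /IH ->]; apply: sr_bal. Qed.

Lemma bal_filter (B : pred nat) r w : B r -> B r.+1 -> bal r (filter B w) = bal r w.
Proof.
move=> h1 h2; rewrite /bal; congr (_ == _); elim: w (Some 0) => // x w IH d.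
rewrite [filter _ _]/=; case: ifP => hx; rewrite ?brun_cons ?IH // brun_neutral //.
  by apply/eqP => ex; move: hx; rewrite ex h1.
by apply/eqP => ex; move: hx; rewrite ex h2.
Qed.

Lemma filter_split_cons (B : pred nat) u a y b : filter B u = a ++ y :: b ->
  exists a' b', [/\ u = a' ++ y :: b', filter B a' = a & filter B b' = b].
Proof.
elim: u a => [|x u IH] a /=; first by case: a.
case: ifP => hx; last first.
  by move=> /IH[a' [b' [-> e1 e2]]]; exists (x :: a'), b'; rewrite /= hx.
case: a => [|z a] /= [ez e]; first by exists [::], u; rewrite ez.
by have [a' [b' [-> e1 e2]]] := IH _ e; exists (x :: a'), b'; rewrite /= hx ez e1.
Qed.

Lemma agree_refl B u : agree B u u.
Proof. by elim: u => //= x u ->; rewrite !eqxx orbT. Qed.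

Lemma agree_trans B u v w : agree B u v -> agree B v w -> agree B u w.
Proof.
elim: u v w => [|x u IH] [|y v] [|z w] //= /andP[/andP[/eqP e1 o1] h1] /andP[/andP[/eqP e2 o2] h2].
rewrite (IH _ _ h1 h2) andbT e1 e2 eqxx /=; rewrite e1 e2 in o1; rewrite e2 in o2.
by case: (B z) o1 o2 => //= /eqP -> /eqP ->.
Qed.

(** Letters outside [B] are neutral for the matching, so [s_r] can be computed on the subword of the
    block. *)
Lemma sr_raising (B : pred nat) r u v : B r -> B r.+1 -> raising r (filter B u) v ->
  agree B u (sr r u) /\ filter B (sr r u) = v.
Proof.
move=> h1 h2 [a [b [ha hb /filter_split_cons[a' [b' [-> e1 e2]]] ->]]].
rewrite sr_raise; try by rewrite -(bal_filter _ h1 h2) ?e1 ?e2.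
rewrite agree_cat // agree_refl /= agree_refl h1 h2 eqxx /=; split=> //.
by rewrite filter_cat /= h1 e1 e2.
Qed.

(* The word of the rectangular tableau on the letters o+1, ..., o+m with its
   corner cell removed and the letter o+1 used one time less. *)
Fixpoint defw (o m c : nat) : word :=
  match m with
  | 0 => [::]
  | m'.+1 => defw o.+1 m' c ++ nseq c.-1 o.+1 ++ (if m' is 0 then [::] else [:: o.+2])
  end.

Lemma rcons_nseq n (x : nat) : rcons (nseq n x) x = nseq n.+1 x.
Proof. by elim: n => //= n ->. Qed.

Lemma rectw0 o c : rectw o 0 c = [::].
Proof. by []. Qed.

Lemma defw_rcons o m c : 0 < c -> 0 < m ->
  knuth_equiv (rcons (defw o m c) o.+1) (rectw o m c).
Proof.
move=> hc; elim: m o => // -[_ o _|m IH o _].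
  by rewrite rectwS rectw0 /= cats0 rcons_nseq prednK //; exact: rst_refl.
rewrite rectwS -[defw _ _ _]/(defw o.+1 m.+1 c ++ nseq c.-1 o.+1 ++ [:: o.+2]).
have hs : all (fun a => a <= o.+1) (nseq c.-1 o.+1) by apply/allP => x /nseqP[-> _].
have h1 := knuth_cat (defw o.+1 m.+1 c) [::] (knuth_bump_left hs (ltnSn o.+1) (sorted_nseq _ _)).
rewrite !cats0 !cats1 rcons_nseq prednK // in h1.
have h2 := knuth_cat [::] (nseq c o.+1) (IH o.+1 isT); rewrite !cat0s cat_rcons in h2.
move: (defw o.+1 m.+1 c) h1 h2 => D h1 h2.
by rewrite -cats1 -!catA; apply: rst_trans h1 _; exact: h2.
Qed.

Lemma all_defw o m c : all (fun x => o < x) (defw o m c).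
Proof.
elim: m o => //= m IH o; rewrite !all_cat; apply/and3P; split.
- by apply: sub_all (IH o.+1) => x; apply: ltnW.
- by apply/allP => x /nseqP[-> _].
- by case: m {IH} => //= _; rewrite ltnW.
Qed.

Lemma count_defw o m c : count_mem o.+1 (defw o m.+1 c) = c.-1.
Proof.
rewrite /= !count_cat count_nseq /= eqxx mul1n.
have -> : count_mem o.+1 (defw o.+1 m c) = 0.
  by apply/count_memPn; apply/negP => /(allP (all_defw o.+1 m c)); rewrite ltnn.
case: m => [|m] /=; first by rewrite addn0.
by rewrite (gtn_eqF (ltnSn o.+1)) !addn0.
Qed.

Lemma bal_low o m c r : o + m < r -> bal r (rectw o m c).
Proof.
move=> h; rewrite /bal brun_open; last first.
  by apply/count_memPn; rewrite count_rectw /blk; case: ifP => //; lia.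
by rewrite count_rectw /blk; case: ifP => //; lia.
Qed.

(** One link of the chain from [defw] to the rectangular word without its first letter: after [d]
    steps the lowest [d] letters form a full rectangle and the deficient letter is [(o + d).+1]. *)
Lemma raising_defw o d m c : 0 < c ->
  raising (o + d).+1 (defw (o + d) m.+2 c ++ rectw o d c)
                     (defw (o + d.+1) m.+1 c ++ rectw o d.+1 c).
Proof.
move=> hc; exists (defw (o + d.+1) m.+1 c ++ nseq c.-1 (o + d).+1), (rectw o d c); split.
- rewrite /bal brun_cat addnS brun_open; last first.
    by apply/negP => /(allP (all_defw _ _ _)); rewrite ltnn.
  by rewrite count_defw add0n -{1}[c.-1]addn0 brun_close.
- by apply: bal_low.
- by rewrite -[defw _ m.+2 c]/(defw (o + d).+1 m.+1 c ++ nseq c.-1 (o + d).+1 ++ [:: (o + d).+2]) addnS -!catA.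
- rewrite rectwS_top -!catA; congr (_ ++ _); rewrite addnS -{2}(prednK hc) -rcons_nseq cat_rcons //.
Qed.

Lemma defw_top o m c : 0 < c -> 
  (o + m.+1) :: (defw (o + m) 1 c ++ rectw o m c) = rectw o m.+1 c.
Proof. by case: c => // c _; rewrite rectwS_top /= cats0 addnS. Qed.

Lemma Ptab_rectw o m c : 0 < c -> Ptab (rectw o m c) = ytab o.+1 (nseq m c).
Proof.
move=> hc; apply: Ptab_word_of; apply: tab_ytab; first by apply/allP => x /nseqP[->].
by apply/(sortedP 0) => i; rewrite size_nseq => hi; rewrite !nth_nseq hi (ltnW hi) /=.
Qed.

Lemma rectw_corner_row u x o m c : 0 < c -> knuth_equiv (rcons u x) (rectw o m.+1 c) ->
  irow (Ptab u) x = m.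
Proof.
move=> hc /knuth_Ptab e; have := congr1 shape e; rewrite Ptab_rcons size_ins Ptab_rectw // shape_ytab.
set i := irow _ _ => es.
have N k : (i == k) + nth 0 (shape (Ptab u)) k = if k < m.+1 then c else 0.
  by rewrite -nth_incr_nth es nth_nseq.
case: (ltngtP i m) => // h.
- have := N i; have := N i.+1; have := tab_shape_dec i (Ptab_tab u).
  by rewrite eqxx (ltn_eqF (ltnSn i)) !ltnS h (ltnW h) /=; lia.
- by have := N i; rewrite eqxx ltnS leqNgt h /=; lia.
Qed.

(** A rectangle has only one removable corner, so removing the last letter undoes the same insertion
    for every word of this class. *)
Lemma rectw_corner_knuth u x o m c : 0 < c -> 0 < m -> knuth_equiv (rcons u x) (rectw o m c) ->
  knuth_equiv (defw o m c) u.
Proof.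
case: m => // m hc _ h; have h' := @defw_rcons o m.+1 c hc isT.
have r1 := rectw_corner_row hc h; have r2 := rectw_corner_row hc h'.
apply: Ptab_knuth.
have eP : Ptab (rcons (defw o m.+1 c) o.+1) = Ptab (rcons u x).
  by rewrite (knuth_Ptab h) (knuth_Ptab h').
have := congr1 shape eP; rewrite !Ptab_rcons !size_ins r1 r2 => es.
have {}es := incr_nth_injl (tab_shape_pos (Ptab_tab _)) (tab_shape_pos (Ptab_tab _)) es.
rewrite !Ptab_rcons in eP.
by have [] := ins_inj (Ptab_rsorted _) (Ptab_rsorted _) es eP.
Qed.

(** * The letter blocks of a sequence of rectangles *)

Lemma Ytab_ytab R i : Ytab R i = ytab (offs R i).+1 (nseq (rect R i).1 (rect R i).2).
Proof.
rewrite /Ytab; move: (offs R i) (rect R i) => o [m c] /=.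
suff H k : [seq nseq c (o + j) | j <- iota k m] = ytab (o + k) (nseq m c) by rewrite H addn1.
by elim: m k => //= m IH k; rewrite IH addnS.
Qed.

Lemma word_Ytab R i : word_of (Ytab R i) = rectw (offs R i) (rect R i).1 (rect R i).2.
Proof. by rewrite Ytab_ytab. Qed.

Lemma inA_blk R i : inA R i = blk (offs R i) (rect R i).1.
Proof. by []. Qed.

Lemma offsS R i : i < size R -> offs R i.+1 = offs R i + (rect R i).1.
Proof.
move=> hi; rewrite /offs (take_nth 0) ?size_map // sumn_rcons; congr (_ + _).
by rewrite (nth_map (0, 0)).
Qed.

Lemma offs_default R i : size R <= i -> offs R i = ntot R.
Proof. by move=> h; rewrite /offs take_oversize // size_map. Qed.

Lemma offs_le R i j : i <= j -> offs R i <= offs R j.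
Proof.
move=> /subnKC <-; elim: (j - i) => [|m IH]; first by rewrite addn0.
rewrite addnS; apply: leq_trans IH _.
case: (ltnP (i + m) (size R)) => h; first by rewrite offsS // leq_addr.
by rewrite !offs_default // (leq_trans h).
Qed.

Lemma inA_disjoint R i j x : i < size R -> j < size R -> inA R i x -> inA R j x -> i = j.
Proof.
move=> hi hj; rewrite /inA -!offsS // => /andP[h1 h2] /andP[h3 h4].
case: (ltngtP i j) => // h; first by have := offs_le R h; lia.
by have := offs_le R h; lia.
Qed.

Lemma inA_exists R x : 0 < x <= ntot R -> exists2 i, i < size R & inA R i x.
Proof.
move=> /andP[h1 h2].
have : exists n, x <= offs R n by exists (size R); rewrite offs_default.
case/ex_minnP => -[|i] hi hmin; first by move: hi; rewrite /offs take0 /=; lia.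
have hlt : offs R i < x by rewrite ltnNge; apply/negP => /hmin; rewrite ltnn.
have hs : i < size R.
  by rewrite ltnNge; apply/negP => h; move: hlt hi; rewrite !offs_default ?(leqW h) //; lia.
by exists i => //; rewrite /inA -offsS // hi hlt.
Qed.

Lemma agree_filter_disjoint (B C : pred nat) u v : agree B u v -> (forall x, B x -> ~~ C x) ->
  filter C u = filter C v.
Proof.
move=> + h; elim: u v => [|x u IH] [|y v] //= /andP[/andP[/eqP e o] /IH ->].
case Ex: (B x) e o => e o; last by rewrite (eqP o).
by rewrite (negPf (h x Ex)) (negPf (h y (esym e))).
Qed.

(* What chi does to a word ux with x in the i-th block. *)
Definition chispec (R : rects) (i : nat) (w z : word) : Prop :=
  exists u x v y, [/\ w = rcons u x /\ z = y :: v, inA R i x /\ inA R i y,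
    subst_rw (inA R i) u v & inW R z].

(** The contribution of one block to [w0gens]. Since [foldr] starts at the end of the list, a run
    [j], ..., [1] applies [s_1] first. *)
Definition blockgens (o m : nat) : seq nat :=
  flatten [seq [seq o + k | k <- rev (iota 1 j)] | j <- iota 1 m.-1].

Lemma blockgens_mem o m r : r \in blockgens o m -> o < r < o + m.
Proof.
move=> /flattenP[gs /mapP[j]]; rewrite mem_iota => hj -> /mapP[k]; rewrite mem_rev mem_iota => hk ->.
lia.
Qed.

Lemma iota1S m : iota 1 m.+1 = iota 1 m ++ [:: m.+1].
Proof. by rewrite -{1}[m.+1]addn1 iotaD add1n. Qed.

Lemma blockgensS o m : 0 < m ->
  blockgens o m.+1 = blockgens o m ++ [seq o + k | k <- rev (iota 1 m)].
Proof.
case: m => // m _; rewrite /blockgens -[m.+2.-1]/(m.+1) -[m.+1.-1]/m [in LHS]iota1S.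
by rewrite map_cat flatten_cat [flatten [seq _ | j <- [:: m.+1]]]/= cats0.
Qed.

Section Block.
Variables (o m c : nat) (u : word) (x : nat).
Let B := blk o m.
Hypotheses (cp : 0 < c) (mp : 0 < m) (hx : B x).
Hypothesis hk : knuth_equiv (filter B (rcons u x)) (rectw o m c).

Lemma block_letter : x = o.+1.
Proof. by move: hk; rewrite filter_rcons hx => /rectw_last. Qed.

Lemma block_chain : exists ks, forall d, d < m ->
  let v := foldr sr u [seq o + k | k <- rev (iota 1 d)] in
  [/\ agree B u v, filter B v = kmoves (defw (o + d) (m - d) c ++ rectw o d c) ks &
      rw (filter B u) = rw (filter B v)].
Proof.
have := hk; rewrite filter_rcons hx => h.
have [ks eks] := knuth_kmoves (rectw_corner_knuth cp mp h); exists ks.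
elim=> [|d IH] hd v.
  rewrite /v /= agree_refl addn0 subn0 rectw0 cats0; split=> //.
have [h1 h2 h3] := IH (ltnW hd).
have ev : v = sr (o + d.+1) (foldr sr u [seq o + k | k <- rev (iota 1 d)]).
  by rewrite /v iota1S rev_cat.
set v0 := foldr sr u _ in h1 h2 h3 ev.
have hr : raising (o + d.+1) (filter B v0) (kmoves (defw (o + d.+1) (m - d.+1) c ++ rectw o d.+1 c) ks).
  rewrite h2; apply: raising_kmoves.
  have -> : m - d = (m - d.+1).-1.+2 by lia.
  have {2}-> : m - d.+1 = (m - d.+1).-1.+1 by lia.
  by rewrite {1}addnS; apply: raising_defw.
have b1 : B (o + d.+1) by rewrite /B /blk; lia.
have b2 : B (o + d.+1).+1 by rewrite /B /blk; lia.
have [g1 g2] := sr_raising b1 b2 hr.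
rewrite ev; split=> //; first exact: agree_trans h1 g1.
by rewrite h3 g2; apply: raising_rw hr.
Qed.

(** The run applied first already produces the result: preceded by [o + m] it is a word of the
    rectangle, hence balanced for the remaining generators, which concern smaller letters and fix
    it. *)
Lemma block_word : let v := foldr sr u (blockgens o m) in
  [/\ agree B u v, rw (filter B u) = rw (filter B v) &
   knuth_equiv (o + m :: filter B v) (rectw o m c)].
Proof.
have [ks h] := block_chain.
have hm : m.-1 < m by lia.
have [h1 h2 h3] := h m.-1 hm; set v1 := foldr sr u _ in h1 h2 h3.
have hK : knuth_equiv (o + m :: filter B v1) (rectw o m c).
  have em : m = m.-1.+1 by lia.
  rewrite h2; have -> : m - m.-1 = 1 by lia.
  rewrite {1 4}em -(defw_top o m.-1 cp).
  by have := knuth_cat [:: o + m.-1.+1] [::] (kmoves_knuth (defw (o + m.-1) 1 c ++ rectw o m.-1 c) ks); rewrite !cats0.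
have e : foldr sr u (blockgens o m) = v1.
  rewrite /v1; case: (posnP m.-1) => [e0|m0].
    by have -> : m = 1 by lia.
  have {1}-> : m = m.-1.+1 by lia.
  rewrite blockgensS // foldr_cat -/v1; apply: foldr_sr_id.
  apply/allP => r /blockgens_mem hr.
  rewrite -(bal_filter (B := B)); try by rewrite /B /blk; lia.
  have hb : bal r (o + m :: filter B v1) by apply: (rectw_bal hK); lia.
  by rewrite bal_neutral_cons in hb; [exact: hb|lia|lia].
by rewrite e.
Qed.

Lemma block_single : foldr sr [:: x] (blockgens o m) = [:: o + m].
Proof.
rewrite block_letter.
have h d : d < m -> foldr sr [:: o.+1] [seq o + k | k <- rev (iota 1 d)] = [:: o + d.+1].
  elim: d => [|d IH] hd; first by rewrite /= addn1.
  by rewrite iota1S rev_cat /= IH ?(ltnW hd) // sr_single -addnS.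
case: (posnP m.-1) => [e0|m0].
  have -> : m = 1 by lia.
  by rewrite /= addn1.
have -> : m = m.-1.+1 by lia.
rewrite blockgensS // foldr_cat h; last by lia.
apply: foldr_sr_id; apply/allP => r /blockgens_mem hr.
by rewrite bal_neutral_cons //; lia.
Qed.
End Block.

Lemma foldr_sr_flatten_id (u : word) (gss : seq (seq nat)) : (forall gs r, gs \in gss -> r \in gs -> bal r u) ->
  foldr sr u (flatten gss) = u.
Proof.
move=> h; apply: foldr_sr_id; apply/allP => r /flattenP[gs h1 h2]; exact: h h1 h2.
Qed.

Lemma w0act_block R i u : i < size R ->
  (forall j r, j < size R -> j != i -> offs R j < r < offs R j + (rect R j).1 ->
     bal r u /\ bal r (foldr sr u (blockgens (offs R i) (rect R i).1))) ->
  w0act R u = foldr sr u (blockgens (offs R i) (rect R i).1).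
Proof.
move=> hi h; rewrite /w0act /w0gens.
have -> : iota 0 (size R) = iota 0 i ++ i :: iota i.+1 (size R - i.+1).
  by rewrite -{1}(subnKC hi) addSnnS iotaD add0n; congr (_ ++ _); rewrite -cat1s.
rewrite map_cat flatten_cat /= !foldr_cat.
rewrite (_ : foldr sr u (flatten [seq _ | i0 <- iota i.+1 _]) = u); last first.
  apply: foldr_sr_flatten_id => gs r /mapP[j]; rewrite mem_iota => hj -> /blockgens_mem hr.
  have [hj1 hj2] : j < size R /\ j != i by lia.
  by have [] := h j r hj1 hj2 hr.
apply: foldr_sr_flatten_id => gs r /mapP[j]; rewrite mem_iota => hj -> /blockgens_mem hr.
have [hj1 hj2] : j < size R /\ j != i by lia.
  by have [] := h j r hj1 hj2 hr.
Qed.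

Lemma inW_filter R w i : inW R w -> i < size R ->
  knuth_equiv (filter (inA R i) w) (rectw (offs R i) (rect R i).1 (rect R i).2).
Proof. by move=> [_ h] /h; rewrite word_Ytab. Qed.

(** Only the block of [x] is affected: on every other block [u] has the full rectangular subword,
    which is balanced, and the single letter [x] is neutral. *)
Lemma chi_spec R u x : (forall i, i < size R -> 0 < (rect R i).1 /\ 0 < (rect R i).2) ->
  inW R (rcons u x) -> exists2 i, i < size R & chispec R i (rcons u x) (chi R (rcons u x)).
Proof.
move=> hR hW; have [hall _] := hW.
have hx : 0 < x <= ntot R by apply: (allP hall); rewrite mem_rcons inE eqxx.
have [i hi hxi] := inA_exists hx; exists i => //.
have [mp cp] := hR i hi.
set o := offs R i; set m := (rect R i).1 in mp; set c := (rect R i).2 in cp.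
have hk := inW_filter hW hi; rewrite -/o -/m -/c in hk.
have [b1 b2 b3] := block_word cp mp hxi hk; set v := foldr sr u _ in b1 b2 b3.
have bs := block_single cp mp hxi hk.
have hdis j y : j < size R -> j != i -> inA R i y -> ~~ inA R j y.
  by move=> hj n h1; apply/negP => h2; move: n; rewrite (inA_disjoint hj hi h2 h1) eqxx.
have hfil j : j < size R -> j != i -> filter (inA R j) u = filter (inA R j) v.
  by move=> hj n; apply: agree_filter_disjoint b1 _ => y hy; apply: hdis.
have hchi : chi R (rcons u x) = (o + m) :: v.
  rewrite /chi rev_rcons revK (@w0act_block R i u) //; last first.
    move=> j r hj n hr.
    have r1 : inA R j r by rewrite /inA; lia.
    have r2 : inA R j r.+1 by rewrite /inA; lia.
    rewrite -/o -/m -/v -(bal_filter u r1 r2) -(bal_filter v r1 r2) -hfil //.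
    have -> : filter (inA R j) u = filter (inA R j) (rcons u x).
      by rewrite filter_rcons (negPf (hdis j x hj n hxi)).
    by have := rectw_bal (inW_filter hW hj) hr.
  rewrite (@w0act_block R i [:: x]) ?bs // => j r hj n hr.
  have r1 : inA R j r by rewrite /inA; lia.
  have r2 : inA R j r.+1 by rewrite /inA; lia.
  rewrite ?bs.
  have ho : inA R i (o + m) by rewrite /inA -/o -/m; lia.
  have d1 := hdis _ _ hj n hxi; have d2 := hdis _ _ hj n ho.
  by split; rewrite bal_neutral_cons //; apply/eqP => e; rewrite e ?r1 ?r2 // in d1 d2.
rewrite hchi; exists u, x, v, (o + m).
have hy : inA R i (o + m) by rewrite /inA -/o -/m; lia.
split=> //; split.
  apply/andP; split.
    by have := offs_le R (ltnW hi : i <= size R); have := offs_le R hi; rewrite offsS // -/o -/m (offs_default (leqnn (size R))); lia.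
  apply/allP => y hyv; case hyi : (inA R i y).
    move: hyi; rewrite /inA; have := offs_le R hi; rewrite offsS // (offs_default (leqnn (size R))); lia.
  have : y \in filter (predC (inA R i)) v by rewrite mem_filter /= hyi.
  rewrite -(@agree_filter_disjoint (inA R i) _ u) //; last by move=> t /= ->.
  by rewrite mem_filter => /andP[_ h]; apply: (allP hall); rewrite mem_rcons inE h orbT.
move=> j hj; rewrite word_Ytab; have [->|n] := eqVneq j i.
  by rewrite /= hy; exact: b3.
rewrite /= (negPf (hdis _ _ hj n hy)) -hfil //.
have := inW_filter hW hj; rewrite filter_rcons (negPf (hdis _ _ hj n hxi)) //.
Qed.

(** * Rectangle switching *)

Lemma inW_knuth R u v : knuth_equiv u v -> inW R u -> inW R v.
Proof.
move=> h [h1 h2]; split; first by rewrite -(perm_all _ (knuth_perm h)).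
move=> i hi; apply: rst_trans (h2 i hi); apply: rst_sym; apply: knuth_filter => //.
exact: blk_convex.
Qed.

Lemma inW2_LRw r1 r2 w : inW [:: r1; r2] w <-> LRw r1.1 r1.2 r2.1 r2.2 w.
Proof.
have e : ntot [:: r1; r2] = r1.1 + r2.1 by rewrite /ntot /= addn0.
have k0 : knuth_equiv (filter (inA [:: r1; r2] 0) w) (word_of (Ytab [:: r1; r2] 0)) =
  knuth_equiv (filter (blk 0 r1.1) w) (rectw 0 r1.1 r1.2) by rewrite word_Ytab.
have k1 : knuth_equiv (filter (inA [:: r1; r2] 1) w) (word_of (Ytab [:: r1; r2] 1)) =
  knuth_equiv (filter (blk r1.1 r2.1) w) (rectw r1.1 r2.1 r2.2).
  by rewrite word_Ytab inA_blk /offs /= addn0.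
split=> [[h1 h2]|[h1 h2 h3]]; split.
- by move: h1; rewrite e.
- by rewrite -k0; apply: h2.
- by rewrite -k1; apply: h2.
- by rewrite e.
- by move=> [|[|i]] // _; rewrite ?k0 ?k1.
Qed.

Lemma inLRT2_LRw r1 r2 T : inLRT [:: r1; r2] T <-> tab T /\ LRw r1.1 r1.2 r2.1 r2.2 (word_of T).
Proof. by rewrite /inLRT tab_is_tableau inW2_LRw. Qed.

(** Discharges both choices: the tableau exists by [LRshape_sym], and the word by [rsk_surj]. *)
Lemma tau2W_spec r1 r2 w : LRw r1.1 r1.2 r2.1 r2.2 w ->
  LRw r2.1 r2.2 r1.1 r1.2 (tau2W r1 r2 w) /\ rw (tau2W r1 r2 w) = rw w.
Proof.
move=> h.
have hT : exists T', shape T' = shape (Ptab w) /\ inLRT [:: r2; r1] T'.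
  have [T' [h1 h2 h3]] := LRshape_sym (LRshape_word h).
  by exists T'; split=> //; apply/inLRT2_LRw.
have [s1 /inLRT2_LRw[s2 s3]] := epsilon_spec (inhabits (Ptab w)) _ hT.
rewrite -/(tau2T r1 r2 (Ptab w)) in s1 s2 s3.
have hw : exists w', Ptab w' = tau2T r1 r2 (Ptab w) /\ Qtab w' = Qtab w.
  have [w' [h1 h2]] := rsk_surj s2 s1; exists w'; split=> //; exact: rw_Qtab.
have [t1 /Qtab_rw t2] := epsilon_spec (inhabits w) _ hw.
rewrite -/(tau2W r1 r2 w) in t1 t2; split=> //.
by apply: LRw_knuth s3; apply: Ptab_knuth; rewrite t1 Ptab_word_of.
Qed.

Lemma LRw_rw_inj e1 m1 e2 m2 w w' : LRw e1 m1 e2 m2 w -> LRw e1 m1 e2 m2 w' -> rw w = rw w' -> w = w'.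
Proof.
move=> h h' e; apply: rsk_inj => //; apply: (@LR_unique e1 m1 e2 m2); rewrite ?Ptab_tab //.
- exact: LRw_knuth (knuth_word_Ptab w) h.
- exact: LRw_knuth (knuth_word_Ptab w') h'.
- exact: rw_shape.
Qed.

Lemma fill_spec B w v : size v = count B w -> all B v ->
  agree B w (fill B w v) /\ filter B (fill B w v) = v.
Proof.
elim: w v => [|x w IH] v /=; first by move/size0nil => ->.
case hx : (B x) => /=; last first.
  by rewrite add0n => h1 h2; have [a1 a2] := IH v h1 h2; rewrite hx a1 a2 !eqxx.
case: v => // y v [h1] /= /andP[hy h2]; have [-> e] := IH v h1 h2.
by rewrite hy e.
Qed.

Lemma agree_filter_inj B w z z' : agree B w z -> agree B w z' -> filter B z = filter B z' -> z = z'.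
Proof.
elim: w z z' => [|x w IH] [|y z] [|y' z'] //= /andP[/andP[/eqP e1 o1] h1] /andP[/andP[/eqP e2 o2] h2].
rewrite -e1 -e2; case: (B x) o1 o2 => /=.
  by move=> _ _ [-> /(IH _ _ h1 h2) ->].
by move=> /eqP <- /eqP <- /(IH _ _ h1 h2) ->.
Qed.

Lemma agree_sym B u v : agree B u v -> agree B v u.
Proof.
elim: u v => [|x u IH] [|y v] //= /andP[/andP[/eqP e o] /IH ->].
by rewrite e eqxx /= andbT; rewrite e in o; rewrite eq_sym.
Qed.

Lemma agree_sub (A B : pred nat) u v : (forall x, A x -> B x) -> agree A u v -> agree B u v.
Proof.
move=> h; elim: u v => [|x u IH] [|y v] //= /andP[/andP[/eqP e o] /IH ->]; rewrite andbT.
move: o; case hx : (A x) => /= o; last by rewrite (eqP o) !eqxx orbT.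
by rewrite (h x hx) (h y) // -e.
Qed.

(** Fourth side of a square: [A]-substitutions lead from [u] to [v] and from [u'] to [v'], a
    [B]-substitution from [u] to [u']. Disjointness lets the latter pass to [v] and [v'], provided
    their [A]-subwords agree. *)
Lemma agree_disjoint_step (A B : pred nat) u v u' v' : (forall x, A x -> ~~ B x) ->
  agree A u v -> agree B u u' -> agree A u' v' -> filter A v = filter A v' -> agree B v v'.
Proof.
move=> dis; elim: u v u' v' => [|x u IH] [|y v] [|x' u'] [|y' v'] //=.
move=> /andP[/andP[/eqP e1 o1] h1] /andP[/andP[/eqP e2 o2] h2] /andP[/andP[/eqP e3 o3] h3].
have {}IH := IH v u' v' h1 h2 h3.
rewrite -e1 -e3; case Ax : (A x).
  have Bx := negbTE (dis x Ax); rewrite Bx /= in o2; rewrite -(eqP o2) Ax => -[-> /IH ->].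
  by rewrite !eqxx orbT.
rewrite Ax /= in o1; rewrite -(eqP o1); case Bx : (B x).
  have Ax' : A x' = false by apply/negP => /dis; rewrite -e2 Bx.
  by rewrite Ax' /= in o3 *; move=> /IH ->; rewrite -(eqP o3) -e2 Bx.
rewrite Bx /= in o2; rewrite -(eqP o2) Ax => /IH ->.
by rewrite -(eqP o2) Ax /= in o3; rewrite -(eqP o3) Bx !eqxx.
Qed.

(** * Switching two adjacent rectangles in a longer sequence *)

Definition blkB (L : rects) (r1 r2 : nat * nat) : pred nat := blk (ntot L) (r1.1 + r2.1).

Definition subw (L : rects) (r1 r2 : nat * nat) (w : word) : word :=
  [seq x - ntot L | x <- w & blkB L r1 r2 x].

(* z is the image of w under the switching of the adjacent rectangles r1, r2. *)
Definition switched (L : rects) (r1 r2 : nat * nat) (w z : word) : Prop :=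
  [/\ agree (blkB L r1 r2) w z, LRw r2.1 r2.2 r1.1 r1.2 (subw L r1 r2 z) &
      rw (subw L r1 r2 z) = rw (subw L r1 r2 w)].

Lemma blkB_sym L r1 r2 : blkB L r1 r2 = blkB L r2 r1.
Proof. by rewrite /blkB addnC. Qed.

Lemma subw_sym L r1 r2 : subw L r1 r2 = subw L r2 r1.
Proof. by rewrite /subw blkB_sym. Qed.

Lemma map_shiftK o w : all (fun x => o < x) w -> map (addn o) (map (subn^~ o) w) = w.
Proof.
move=> h; rewrite -map_comp -[RHS]map_id; apply/eq_in_map => x hx /=.
by rewrite subnKC // ltnW //; apply: (allP h).
Qed.

Lemma rw_unshift o w : all (fun x => o < x) w -> rw (map (subn^~ o) w) = rw w.
Proof. by move=> h; rewrite -(rw_shift o) map_shiftK. Qed.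

Lemma knuth_unshift o u v : all (fun x => o < x) u -> knuth_equiv u v ->
  knuth_equiv (map (subn^~ o) u) (map (subn^~ o) v).
Proof.
move=> hu /knuth_kmoves[ks ->]; rewrite /kmoves; elim: ks u hu => /= [|k ks IH] u hu.
  exact: rst_refl.
apply: rst_trans (IH _ _); last by rewrite (perm_all _ (perm_kmove _ _ _)).
rewrite -(@kmove_map gt2) ; first by apply: rst_sym; apply: kmove_knuth.
move=> x y hx hy; have /= := allP hu _ hx; have /= := allP hu _ hy; rewrite /gt2; lia.
Qed.

Lemma rectw_unshift o k m c : map (subn^~ o) (rectw (o + k) m c) = rectw k m c.
Proof.
elim: m k => // m IH k; rewrite !rectwS map_cat map_nseq -!addnS IH.
by congr (_ ++ nseq _ _); lia.
Qed.

Section Switch.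
Variables (L M : rects) (r1 r2 : nat * nat).
Let R := L ++ r1 :: r2 :: M.
Let R' := L ++ r2 :: r1 :: M.
Let B := blkB L r1 r2.
Let o := ntot L.
Let p := (size L).+1.

Lemma filter_gt w : all (fun x => o < x) (filter B w).
Proof. by apply/allP => x; rewrite mem_filter => /andP[/andP[]]. Qed.

Lemma rw_subw w : rw (subw L r1 r2 w) = rw (filter B w).
Proof. exact: rw_unshift (filter_gt w). Qed.

Lemma subw_unshift w : map (addn o) (subw L r1 r2 w) = filter B w.
Proof. exact: map_shiftK (filter_gt w). Qed.

Lemma rectL : rect R (size L) = r1.
Proof. by rewrite /rect /R nth_cat ltnn subnn /=. Qed.

Lemma rectL1 : rect R (size L).+1 = r2.
Proof. by rewrite /rect /R nth_cat ltnNge leqnSn subSnn /=. Qed.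

Lemma tauRE : tauR p R = R'.
Proof.
rewrite /tauR rectL1 /p -[(size L).+1.-1]/(size L) rectL /R take_size_cat //.
rewrite drop_cat ltnNge (leq_trans (leqnSn _) (leqnSn _)) /=.
have -> : (size L).+2 - size L = 2 by lia.
by rewrite /= drop0.
Qed.

Lemma offsL : offs R (size L) = o.
Proof. by rewrite /offs /R /etas map_cat take_size_cat // size_map. Qed.

Lemma sizeR : size R = (size L + size M).+2.
Proof. by rewrite size_cat /= !addnS. Qed.

Lemma sizeL : size L < size R.
Proof. by rewrite sizeR; lia. Qed.

Lemma sizeL1 : (size L).+1 < size R.
Proof. by rewrite sizeR; lia. Qed.

Lemma offsL1 : offs R (size L).+1 = o + r1.1.
Proof. by rewrite offsS ?sizeL // offsL rectL. Qed.

Lemma tauWE w : tauW p R w =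
  fill B w [seq x + o | x <- tau2W r1 r2 (subw L r1 r2 w)].
Proof.
rewrite /tauW /p rectL rectL1 offsL /subw /B /blkB.
have e : (fun x => (o < x) && (x <= o + r1.1 + r2.1)) =1 blk (ntot L) (r1.1 + r2.1).
  by move=> x; rewrite /blk addnA.
rewrite (eq_filter e).
have ef u : fill (fun x => (o < x) && (x <= o + r1.1 + r2.1)) w u = fill (blk (ntot L) (r1.1 + r2.1)) w u.
  by elim: w u => //= x w IH u; rewrite !IH; have /= -> := e x.
exact: ef.
Qed.

Lemma inA_B b x : inA R (if b then size L else (size L).+1) x -> B x.
Proof. by rewrite /inA; case: b; rewrite ?offsL ?offsL1 ?rectL ?rectL1 /B /blkB /blk -/o; lia. Qed.

Lemma inA_blk2 b x : B x -> blk2 r1.1 r2.1 b (x - o) = inA R (if b then size L else (size L).+1) x.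
Proof. by rewrite /inA; case: b; rewrite ?offsL ?offsL1 ?rectL ?rectL1 /B /blkB /blk2 /blk -/o; lia. Qed.

Lemma filter_subw b w : filter (blk2 r1.1 r2.1 b) (subw L r1 r2 w) =
  map (subn^~ o) (filter (inA R (if b then size L else (size L).+1)) w).
Proof.
rewrite /subw filter_map -filter_predI; congr map; apply: eq_filter => x /=.
case hB : (B x); last by rewrite -/B hB andbF; apply/esym/negbTE/negP => /inA_B; rewrite hB.
by rewrite -/B hB andbT -/o inA_blk2.
Qed.

Lemma inW_subw w : inW R w -> LRw r1.1 r1.2 r2.1 r2.2 (subw L r1 r2 w).
Proof.
move=> hW; split.
- rewrite /subw all_map; apply/allP => x; rewrite mem_filter /blkB /blk -/o /= => /andP[h _]; lia.
- have := filter_subw true w; rewrite /blk2 => ->.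
  have h := inW_filter hW sizeL; rewrite offsL rectL in h.
  have hg : all (fun x => o < x) [seq x <- w | inA R (size L) x].
    by have := rectw_all h; apply: sub_all => x /andP[].
  have := knuth_unshift hg h.
  suff -> : map (subn^~ o) (rectw o r1.1 r1.2) = rectw 0 r1.1 r1.2 by [].
  by rewrite -{2}[o]addn0 rectw_unshift.
- have := filter_subw false w; rewrite /blk2 => ->.
  have h := inW_filter hW sizeL1; rewrite offsL1 rectL1 in h.
  have hg : all (fun x => o < x) [seq x <- w | inA R (size L).+1 x].
    by have := rectw_all h; apply: sub_all => x /andP[h1 _]; lia.
  have := knuth_unshift hg h.
  suff -> : map (subn^~ o) (rectw (o + r1.1) r2.1 r2.2) = rectw r1.1 r2.1 r2.2 by [].
  exact: rectw_unshift.
Qed.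
End Switch.

Lemma knuth_shift o u v : knuth_equiv u v -> knuth_equiv (map (addn o) u) (map (addn o) v).
Proof.
move=> /knuth_kmoves[ks ->]; rewrite /kmoves; elim: ks u => /= [|k ks IH] u; first exact: rst_refl.
apply: rst_trans (IH _); rewrite -(@kmove_map gt2); first by apply: rst_sym; apply: kmove_knuth.
by move=> x y _ _; rewrite /gt2 ltn_add2l.
Qed.

Lemma rectw_shift o k m c : map (addn o) (rectw k m c) = rectw (o + k) m c.
Proof.
elim: m k => // m IH k; rewrite !rectwS map_cat map_nseq IH.
by rewrite !addnS.
Qed.

Lemma agree_all_pred (B P : pred nat) u v : agree B u v -> (forall x, B x -> P x) -> all P u -> all P v.
Proof.
move=> + h; elim: u v => [|x u IH] [|y v] //= /andP[/andP[/eqP e o] /IH hv] /andP[hx /hv ->].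
rewrite andbT; move: o; case Bx : (B x) => /= o; last by rewrite -(eqP o).
by apply: h; rewrite -e.
Qed.

Section SwapIndex.
Variables (L M : rects) (r1 r2 : nat * nat).
Let R := L ++ r1 :: r2 :: M.
Let R' := L ++ r2 :: r1 :: M.

Lemma rect_other j : j != size L -> j != (size L).+1 -> rect R' j = rect R j.
Proof.
move=> h1 h2; rewrite /rect /R /R' !nth_cat; case: ltnP => // h3.
by have -> : j - size L = (j - size L).-2.+2 by lia.
Qed.

Lemma offs_other j : j != (size L).+1 -> offs R' j = offs R j.
Proof.
move=> h1; rewrite /offs /R /R' /etas !map_cat !take_cat size_map; case: ltnP => // h2.
rewrite !sumn_cat; congr (_ + _).
case e: (j - size L) => [|[|k]] //=; first by lia.
by rewrite addnCA.
Qed.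

Lemma ntot_swap : ntot R' = ntot R.
Proof. by rewrite /ntot /R /R' /etas !map_cat !sumn_cat /= [r2.1 + _]addnCA. Qed.

Lemma inA_other j : j != size L -> j != (size L).+1 -> inA R' j =1 inA R j.
Proof. by move=> h1 h2 x; rewrite /inA offs_other // rect_other. Qed.

Lemma inA_other_B j x : j < size R -> j != size L -> j != (size L).+1 -> inA R j x -> ~~ blkB L r1 r2 x.
Proof.
move=> hj h1 h2 hx; apply/negP => hB.
have n b : inA R (if b then size L else (size L).+1) x -> False.
  case: b => h.
    by move: h1; rewrite (inA_disjoint hj (sizeL L M r1 r2) hx h) eqxx.
  by move: h2; rewrite (inA_disjoint hj (sizeL1 L M r1 r2) hx h) eqxx.
have := n true; have := n false; rewrite /inA /R offsL offsL1 rectL rectL1.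
by move: hB; rewrite /blkB /blk => hB; case: (leqP x (ntot L + r1.1)) => c a1 a2; [apply: a2|apply: a1]; lia.
Qed.

Lemma inW_switched w z : inW R w -> switched L r1 r2 w z -> inW R' z.
Proof.
move=> hW [h1 h2 h3]; have [hall _] := hW; split.
  rewrite ntot_swap; apply: agree_all_pred h1 _ hall => x.
  rewrite /blkB /blk /R /ntot /etas map_cat sumn_cat /=; lia.
move=> j; have es : size R' = size R by rewrite !size_cat.
rewrite es => hj; rewrite word_Ytab.
have up b : knuth_equiv (filter (blk2 r2.1 r1.1 b) (subw L r1 r2 z)) (if b then rectw 0 r2.1 r2.2 else rectw r2.1 r1.1 r1.2) ->
   knuth_equiv (filter (inA R' (if b then size L else (size L).+1)) z)
     (if b then rectw (ntot L) r2.1 r2.2 else rectw (ntot L + r2.1) r1.1 r1.2).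
  rewrite subw_sym (filter_subw L M r2 r1) => /(knuth_shift (ntot L)).
  rewrite map_shiftK; last first.
    by apply/allP => x; rewrite mem_filter => /andP[/inA_B /andP[]].
  by case: b; rewrite rectw_shift ?addn0.
have [ej|n1] := eqVneq j (size L).
  have := up true; rewrite ej /R' offsL rectL; apply.
  exact: (LRw_blk2 true h2).
have [ej|n2] := eqVneq j (size L).+1.
  have := up false; rewrite ej /R' offsL1 rectL1; apply.
  exact: (LRw_blk2 false h2).
rewrite offs_other // rect_other // (eq_filter (inA_other n1 n2)).
rewrite -(@agree_filter_disjoint (blkB L r1 r2) _ w) //; first exact: inW_filter.
by move=> x; apply: contraL; apply: inA_other_B.
Qed.
End SwapIndex.

Lemma size_subw L r1 r2 w : size (subw L r1 r2 w) = count (blkB L r1 r2) w.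
Proof. by rewrite size_map size_filter. Qed.

(** From here on [tauW] is handled through the relation [switched], which characterizes it by
    [switched_inj]. *)
Lemma tauW_switched L M r1 r2 w : let R := L ++ r1 :: r2 :: M in inW R w ->
  switched L r1 r2 w (tauW (size L).+1 R w).
Proof.
move=> R hW; have [h1 h2] := tau2W_spec (inW_subw hW); rewrite tauWE.
set s := tau2W _ _ _ in h1 h2 *; set t := [seq x + ntot L | x <- s].
have ht : t = map (addn (ntot L)) s by apply: eq_map => x; rewrite addnC.
have [] := @fill_spec (blkB L r1 r2) w t.
- by rewrite size_map (rw_size h2) size_subw.
- rewrite ht all_map; have [h _ _] := h1; apply: sub_all h => x; rewrite /blkB /blk /=; lia.
set z := fill _ _ _ => a1 a2.
have es : subw L r1 r2 z = s.
  rewrite /subw a2 ht -map_comp -[RHS]map_id; apply: eq_map => x /=; rewrite addnC addnK //.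
by split; rewrite ?es.
Qed.

Lemma switched_inj L r1 r2 w z z' : switched L r1 r2 w z -> switched L r1 r2 w z' -> z = z'.
Proof.
move=> [a1 a2 a3] [b1 b2 b3]; apply: agree_filter_inj a1 b1 _.
by rewrite -!subw_unshift (LRw_rw_inj a2 b2) // a3 b3.
Qed.

Lemma switched_sym L M r1 r2 w z : inW (L ++ r1 :: r2 :: M) w -> switched L r1 r2 w z -> switched L r2 r1 z w.
Proof.
move=> hW [h1 h2 h3]; split.
- by rewrite blkB_sym; apply: agree_sym.
- by rewrite subw_sym; apply: inW_subw hW.
- by rewrite subw_sym.
Qed.

Lemma tauW_inW L M r1 r2 w : let R := L ++ r1 :: r2 :: M in inW R w ->
  inW (L ++ r2 :: r1 :: M) (tauW (size L).+1 R w).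
Proof. by move=> R hW; have h := tauW_switched hW; apply: (inW_switched hW h). Qed.

Lemma tauWK L M r1 r2 w : inW (L ++ r1 :: r2 :: M) w ->
  tauW (size L).+1 (L ++ r2 :: r1 :: M) (tauW (size L).+1 (L ++ r1 :: r2 :: M) w) = w.
Proof.
move=> hW; apply: switched_inj (tauW_switched (tauW_inW hW)) _.
exact: switched_sym hW (tauW_switched hW).
Qed.

Lemma switched_subst L r1 r2 w z : switched L r1 r2 w z -> subst_rw (blkB L r1 r2) w z.
Proof. by case=> h1 _ h3; split=> //; rewrite -!rw_subw. Qed.

Lemma blkB_convex L r1 r2 : convex (blkB L r1 r2).
Proof. exact: blk_convex. Qed.

Lemma tauW_rw L M r1 r2 w : let R := L ++ r1 :: r2 :: M in inW R w ->
  rw (tauW (size L).+1 R w) = rw w.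
Proof.
move=> R hW; apply/esym; apply: (bisim_rw (bisim_subst (@blkB_convex L r1 r2))).
exact/switched_subst/tauW_switched.
Qed.

(** The moves leading from [w] to [w'], applied to the image of [w], preserve the relation
    [switched]; uniqueness identifies the outcome with the image of [w']. *)
Lemma tauW_knuth L M r1 r2 w w' : let R := L ++ r1 :: r2 :: M in inW R w -> knuth_equiv w w' ->
  knuth_equiv (tauW (size L).+1 R w) (tauW (size L).+1 R w').
Proof.
move=> R hW hk; have hW' := inW_knuth hk hW; have [ks ek] := knuth_kmoves hk.
have h := tauW_switched hW; set z := tauW _ R w in h *.
have hs := bisim_kmoves ks (bisim_subst (@blkB_convex L r1 r2)) (switched_subst h).
suff -> : tauW (size L).+1 R w' = kmoves z ks by apply: rst_sym; apply: kmoves_knuth.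
apply: switched_inj (tauW_switched hW') _; rewrite ek.
case: hs => s1 s2; split=> //; last by rewrite !rw_subw.
have [_ h2 _] := h; apply: LRw_knuth h2; apply: knuth_unshift; first exact: filter_gt.
by apply: knuth_filter; [exact: blkB_convex|apply: rst_sym; apply: kmoves_knuth].
Qed.

(** By [rw_word_of_eq] the image of a reading word is a reading word of the same shape, so cutting
    it into rows yields its insertion tableau. *)
Lemma tauT_word L M r1 r2 T : let R := L ++ r1 :: r2 :: M in inLRT R T ->
  let z := tauW (size L).+1 R (word_of T) in tauT (size L).+1 R T = Ptab z /\ word_of (Ptab z) = z.
Proof.
move=> R [hT hW] z; rewrite tab_is_tableau in hT.
have e : rw z = rw (word_of T) := tauW_rw hW.
have ez := rw_word_of_eq hT e; split=> //.
have es : shape T = shape (Ptab z) by rewrite (rw_shape e) Ptab_word_of.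
have := tab_of_word_of (Ptab z); rewrite -ez -es; exact.
Qed.

Lemma inLRT_Ptab R w : inW R w -> inLRT R (Ptab w).
Proof.
move=> h; split; first by rewrite tab_is_tableau Ptab_tab.
exact: inW_knuth (knuth_word_Ptab w) h.
Qed.

Lemma tauT_Ptab L M r1 r2 w : let R := L ++ r1 :: r2 :: M in inW R w ->
  tauT (size L).+1 R (Ptab w) = Ptab (tauW (size L).+1 R w).
Proof.
move=> R hW; have [-> _] := tauT_word (inLRT_Ptab hW).
apply/knuth_Ptab/tauW_knuth; first exact: inW_knuth (knuth_word_Ptab w) hW.
by apply: rst_sym; apply: knuth_word_Ptab.
Qed.

Lemma inLRT_Ptab_word R T : inLRT R T -> Ptab (word_of T) = T /\ inW R (word_of T).
Proof. by move=> [hT hW]; rewrite tab_is_tableau in hT; rewrite Ptab_word_of. Qed.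

Lemma tauT_inLRT L M r1 r2 T : let R := L ++ r1 :: r2 :: M in inLRT R T ->
  inLRT (L ++ r2 :: r1 :: M) (tauT (size L).+1 R T).
Proof.
move=> R /inLRT_Ptab_word[e hW]; have := inLRT_Ptab (tauW_inW hW).
by rewrite -tauT_Ptab // e.
Qed.

Lemma tauTK L M r1 r2 T : inLRT (L ++ r1 :: r2 :: M) T ->
  tauT (size L).+1 (L ++ r2 :: r1 :: M) (tauT (size L).+1 (L ++ r1 :: r2 :: M) T) = T.
Proof.
move=> /inLRT_Ptab_word[e hW].
have h1 := tauT_Ptab hW; have h2 := tauT_Ptab (tauW_inW hW).
by rewrite -h1 e tauWK // e in h2.
Qed.

Lemma agree_rcons B u v x y : agree B (rcons u x) (rcons v y) =
  agree B u v && ((B x == B y) && (B x || (x == y))).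
Proof.
elim: u v => [|a u IH] [|b v] /=; rewrite ?andbT //.
- by case: v => [|? ?] /=; rewrite !andbF.
- by case: u {IH} => [|? ?] /=; rewrite !andbF.
- by rewrite IH andbA.
Qed.

Lemma agree_map (A B A' : pred nat) (f : nat -> nat) u v :
  (forall x, A x -> B x) -> (forall x, B x -> A' (f x) = A x) -> agree A u v ->
  agree A' (map f (filter B u)) (map f (filter B v)).
Proof.
move=> hAB hA'; elim: u v => [|x u IH] [|y v] //= /andP[/andP[/eqP e o] /IH {}IH].
move: o; case Ax : (A x) => /= o.
  have Ay : A y by rewrite -e.
  by rewrite (hAB x Ax) (hAB y Ay) /= !hA' ?hAB // Ax Ay.
by rewrite -(eqP o); case Bx : (B x) => //=; rewrite !eqxx orbT.
Qed.

Definition positive_rects (R : rects) : Prop :=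
  forall i, i < size R -> 0 < (rect R i).1 /\ 0 < (rect R i).2.

Lemma chispec_chi2 L M r1 r2 b w z : let R := L ++ r1 :: r2 :: M in
  inW R w -> chispec R (if b then size L else (size L).+1) w z ->
  chi2 r1.1 r1.2 r2.1 r2.2 (subw L r1 r2 w) (subw L r1 r2 z).
Proof.
move=> R hW [u [x [v [y [[ew ez] [hx hy] [s1 s2] hz]]]]].
have Bx := inA_B hx; have By := inA_B hy.
exists b, (subw L r1 r2 u), (x - ntot L), (subw L r1 r2 v), (y - ntot L); split.
- by rewrite ew ez /subw filter_rcons Bx map_rcons /= By.
- by split; apply: (inW_subw (M := M)).
- by rewrite !(inA_blk2 M).
- split.
    apply: agree_map s1 => t; first exact: inA_B.
    exact: inA_blk2.
  rewrite !(filter_subw L M) !rw_unshift //; apply/allP => t;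
  by rewrite mem_filter => /andP[/inA_B /andP[]].
Qed.

(** The case of empty [L] and [M], where restriction and shift do nothing. *)
Lemma chi2_exists r1 r2 u x : 0 < r1.1 -> 0 < r1.2 -> 0 < r2.1 -> 0 < r2.2 ->
  LRw r1.1 r1.2 r2.1 r2.2 (rcons u x) -> exists z, chi2 r1.1 r1.2 r2.1 r2.2 (rcons u x) z.
Proof.
move=> p1 p2 p3 p4 h.
have hR : positive_rects [:: r1; r2] by move=> [|[|i]].
have hW : inW [:: r1; r2] (rcons u x) by apply/inW2_LRw.
have [i hi hc] := chi_spec hR hW.
exists (subw [::] r1 r2 (chi [:: r1; r2] (rcons u x))).
have e : subw [::] r1 r2 (rcons u x) = rcons u x.
  have [ha _ _] := h; rewrite /subw (all_filterP _) //.
  by rewrite -[RHS]map_id; apply: eq_map => t; rewrite subn0.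
rewrite -{1}e; have ei : i = if i == 0 then size ([::] : rects) else 1.
  by case: i hi {hc} => [|[|i]].
rewrite ei in hc; move: hc.
case: (i == 0) => hc; first exact: (@chispec_chi2 [::] [::] r1 r2 true).
exact: (@chispec_chi2 [::] [::] r1 r2 false).
Qed.

(** * Commutation of switching with cyclage *)

Section ChiSwitch.
Variables (L M : rects) (r1 r2 : nat * nat).
Let R := L ++ r1 :: r2 :: M.
Let R' := L ++ r2 :: r1 :: M.
Let p := (size L).+1.
Hypothesis hR : positive_rects R.

Lemma positive_r : [/\ 0 < r1.1, 0 < r1.2, 0 < r2.1 & 0 < r2.2].
Proof.
have [] := hR (sizeL L M r1 r2); have [] := hR (sizeL1 L M r1 r2).
by rewrite /R rectL rectL1.
Qed.

Lemma positive_swap : positive_rects R'.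
Proof.
have [p1 p2 p3 p4] := positive_r.
move=> i hi; have [->|n1] := eqVneq i (size L); first by rewrite /R' rectL.
have [->|n2] := eqVneq i (size L).+1; first by rewrite /R' rectL1.
by rewrite /R' rect_other //; apply: hR; move: hi; rewrite !size_cat.
Qed.

Lemma chispec_inW i w z : chispec R i w z -> inW R z.
Proof. by move=> [? [? [? [? [_ _ _]]]]]. Qed.

Lemma index_of_B i x : i < size R -> inA R i x -> blkB L r1 r2 x ->
  exists b : bool, i = if b then size L else (size L).+1.
Proof.
move=> hi hx hB; have [e1|n1] := eqVneq i (size L); first by exists true.
have [e2|n2] := eqVneq i (size L).+1; first by exists false.
by have := inA_other_B hi n1 n2 hx; rewrite hB.
Qed.

(** By [switched_inj] it suffices to relate the two images under [chi] by [switched]. If [x] lies in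
    one of the switched blocks, so does the last letter after switching, though perhaps in the other
    block, and [chi2_rw] compares the recordings. Otherwise the block of [x] is disjoint from the
    switched ones. *)
Lemma chi_tauW u x : inW R (rcons u x) ->
  tauW p R (chi R (rcons u x)) = chi R' (tauW p R (rcons u x)).
Proof.
move=> hW; have [p1 p2 p3 p4] := positive_r.
have hsw := tauW_switched hW; have hW' := tauW_inW hW.
rewrite -/R -/p in hsw hW'; set wt := tauW p R _ in hsw hW' *.
case/lastP: wt hsw hW' => [|ut xt] hsw hW'.
  by case: hsw => /agree_size; rewrite size_rcons.
have [i hi hc] := chi_spec hR hW.
have [i' hi' hc'] := chi_spec positive_swap hW'.
set z := chi R _ in hc *; set zt := chi R' _ in hc' *.
have hz := chispec_inW hc.
have hzt : inW R' zt by move: hc' => [? [? [? [? [_ _ _]]]]].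
apply: switched_inj (tauW_switched hz) _.
have [a1 a2 a3] := hsw; move: (a1); rewrite agree_rcons => /andP[au ax].
have hzt2 : LRw r2.1 r2.2 r1.1 r1.2 (subw L r1 r2 zt).
  by rewrite subw_sym; apply: inW_subw hzt.
have [u0 [x0 [v [y [[/rcons_inj[<- <-] ez] [hx hy] [s1 s2] _]]]]] := hc.
have [u0' [x0' [vt [yt [[/rcons_inj[<- <-] ezt] [hxt hyt] [t1 t2] _]]]]] := hc'.
have eR : size R' = size R by rewrite !size_cat.
case hB : (blkB L r1 r2 x) ax => /= ax.
- have hBt : blkB L r1 r2 xt by case/andP: ax => /eqP <-.
  have [b eb] := index_of_B hi hx hB.
  have [b' eb'] : exists b : bool, i' = if b then size L else (size L).+1.
    have [e1|n1] := eqVneq i' (size L); first by exists true.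
    have [e2|n2] := eqVneq i' (size L).+1; first by exists false.
    by have := inA_other_B (r1 := r2) (r2 := r1) hi' n1 n2 hxt; rewrite blkB_sym hBt.
  split=> //.
    rewrite ez ezt /=; rewrite eb in hy s1; rewrite eb' in hyt t1.
    have hyB := inA_B hy; have := inA_B hyt; rewrite blkB_sym => hytB.
    rewrite -/(blkB L r1 r2) hyB hytB /=.
    apply: agree_trans (agree_sym (agree_sub _ s1)) _; first by move=> t; apply: inA_B.
    apply: agree_trans au _; apply: agree_sub t1 => t; rewrite blkB_sym; exact: inA_B.
  rewrite eb in hc; rewrite eb' in hc'.
  have c1 := chispec_chi2 hW hc; have c2 := chispec_chi2 hW' hc'.
  rewrite -(subw_sym L r1 r2) in c2.
  apply/esym; apply: (chi2_rw p1 p2 p3 p4 _ _ c1 c2) => [u1 x1|u1 x1|].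
  + exact: chi2_exists.
  + exact: chi2_exists.
  + by rewrite a3.
- have ex : x = xt by case/andP: ax => _ /eqP.
  have n1 : i != size L by apply/negP => /eqP e; move: hB; rewrite (@inA_B L M r1 r2 true) // -e.
  have n2 : i != (size L).+1 by apply/negP => /eqP e; move: hB; rewrite (@inA_B L M r1 r2 false) // -e.
  have hA' : inA R' i =1 inA R i by apply: inA_other.
  have ei : i' = i by apply: (inA_disjoint hi' _ hxt); rewrite ?eR // hA' -ex.
  subst i' xt.
  have dis t : inA R i t -> ~~ blkB L r1 r2 t by apply: inA_other_B.
  have dis' t : blkB L r1 r2 t -> ~~ inA R i t by apply: contraL => /dis.
  have hAz := inW_filter hz hi; have hAzt := inW_filter hzt hi'.
  rewrite (eq_filter hA') offs_other // rect_other // -/R in hAzt.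
  rewrite /= in ez ezt; rewrite hA' in hyt.
  rewrite ez /= hy in hAz; rewrite ezt /= hyt in hAzt.
  rewrite !(eq_filter hA') in t2.
  have eu := agree_filter_disjoint au dis'.
  (* Both words on block [i] are rectangular, and their tails are recorded like the same subword of
     [u]; so they coincide. *)
  have eP : Ptab (y :: filter (inA R i) v) = Ptab (yt :: filter (inA R i) vt).
    by rewrite (knuth_Ptab hAz) (knuth_Ptab hAzt).
  have erw : rw (filter (inA R i) v) = rw (filter (inA R i) vt) by rewrite -s2 -t2 eu.
  have [ey ef] : y :: filter (inA R i) v = yt :: filter (inA R i) vt.
    by apply: rsk_inj => //; apply: rw_cons_eq => //; rewrite eP.
  have t1' : agree (inA R i) ut vt.
    move: t1; rewrite /agree; have -> // : all2 (fun x y => (inA R' i x == inA R' i y) && (inA R' i x || (x == y))) ut vt =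
      all2 (fun x y => (inA R i x == inA R i y) && (inA R i x || (x == y))) ut vt.
    by elim: (ut) (vt) => [|a s IH] [|a' s'] //=; rewrite IH !hA'.
  split=> //.
    rewrite ez ezt ey /= !eqxx orbT /=.
    exact: agree_disjoint_step dis s1 au t1' ef.
  rewrite !rw_subw; rewrite !rw_subw in a3.
  move: a3; rewrite !filter_rcons hB => a3.
  have yB : blkB L r1 r2 y = false by apply/negbTE/dis.
  have ytB : blkB L r1 r2 yt = false by apply/negbTE/dis.
  rewrite ez ezt /= yB ytB.
  by rewrite -(agree_filter_disjoint t1' dis) -(agree_filter_disjoint s1 dis).
Qed.

Lemma amax_swap : amax R' = amax R.
Proof. by rewrite /amax /R /R' !big_cat !big_cons /=; congr maxn; rewrite maxnCA. Qed.

(** The side condition carries over because [tau_p] preserves the recording sequence, hence the last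
    cell, and [amax] does not depend on the order of the rectangles. *)
Lemma tauT_ltR T S : ltR R T S -> ltR R' (tauT p R T) (tauT p R S).
Proof.
move=> [hS [hT [u [x [hW [eS [eT [i [n1 n2]]]]]]]]].
have hchi : inW R (chi R (rcons u x)).
  by have [j _ h] := chi_spec hR hW; apply: chispec_inW h.
split; first exact: tauT_inLRT.
split; first exact: tauT_inLRT.
have hW' := tauW_inW hW; have e := tauW_rw hW; have ec := chi_tauW hW.
have fS := tauT_Ptab hW; have fT := tauT_Ptab hchi.
rewrite -/R -/p in hW' e ec fS fT.
case: (lastP (tauW p R (rcons u x))) hW' e ec fS => [|ut xt] hW' e ec fS.
  by have := rw_size e; rewrite size_rcons.
exists ut, xt; split=> //; split; first by rewrite eS fS.
split; first by rewrite eT fT ec.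
have /rcons_inj[eu _] : rcons (rw ut) (irow (Ptab ut) xt) = rcons (rw u) (irow (Ptab u) x).
  by rewrite -!rw_rcons.
have es1 : Defs.shape (Ptab (rcons ut xt)) = Defs.shape (Ptab (rcons u x)) := rw_shape e.
have es2 : Defs.shape (Ptab ut) = Defs.shape (Ptab u) := rw_shape eu.
by exists i; rewrite es1 es2 amax_swap.
Qed.

Lemma tauT_leR T S : leR R T S -> leR R' (tauT p R T) (tauT p R S).
Proof.
elim=> {T S} [T S h|T|T S U _ h1 _ h2]; first by apply: rt_step; apply: tauT_ltR.
- exact: rt_refl.
- exact: rt_trans h1 h2.
Qed.
End ChiSwitch.

Theorem theorem3p9 (R : rects) (p : nat) :
  (forall i, i < size R -> 0 < (rect R i).1 /\ 0 < (rect R i).2) ->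
  1 <= p -> p <= (size R).-1 ->
  (* tau_p maps LRT(R) bijectively onto LRT(tau_p R) *)
  (forall T, inLRT R T -> inLRT (tauR p R) (tauT p R T)) /\
  (forall S T, inLRT R S -> inLRT R T -> tauT p R S = tauT p R T -> S = T) /\
  (forall T', inLRT (tauR p R) T' -> exists T, inLRT R T /\ tauT p R T = T') /\
  (* it preserves and reflects the cover relation and the order *)
  (forall S T, inLRT R S -> inLRT R T ->
     (ltR R T S <-> ltR (tauR p R) (tauT p R T) (tauT p R S))) /\
  (forall S T, inLRT R S -> inLRT R T ->
     (leR R T S <-> leR (tauR p R) (tauT p R T) (tauT p R S))).
Proof.
move=> hR p1 p2.
have [L [M [r1 [r2 [eR ep]]]]] : exists L M r1 r2, R = L ++ r1 :: r2 :: M /\ p = (size L).+1.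
  exists (take p.-1 R), (drop p.+1 R), (rect R p.-1), (rect R p).
  have h1 : p.-1 < size R by lia. have h2 : p < size R by lia.
  rewrite size_takel ?(ltnW h1) // prednK //; split=> //.
  by rewrite -{1}(cat_take_drop p.-1 R) (drop_nth (0, 0) h1) prednK // (drop_nth (0, 0) h2).
subst R p; rewrite tauRE.
(* Switching back is a two-sided inverse by [tauTK]; it yields bijectivity, and order preservation
   applied to it gives the reverse implications. *)
have hR' := positive_swap hR.
split; first by move=> T; apply: tauT_inLRT.
split; first by move=> S T hS hT e; rewrite -(tauTK hS) -(tauTK hT) e.
split.
  move=> T' hT'; exists (tauT (size L).+1 (L ++ r2 :: r1 :: M) T'); split; last exact: tauTK.
  exact: tauT_inLRT.
split=> S T hS hT; split.
- exact: tauT_ltR.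
- by move/(tauT_ltR hR'); rewrite !tauTK.
- exact: tauT_leR.
- by move/(tauT_leR hR'); rewrite !tauTK.
Qed.
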